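(* For every Riemannian metric $g$ on the Klein bottle $K$, $$L_\sigma(g)\,l_v(g)\le 2\,\mathrm{vol}(g).$$ This inequality is optimal (the constant $2$ cannot be replaced by a smaller one), but the equality case is not achieved.
   Context: The Klein bottle $K$ is the quotient of $\mathbb{R}^2=\mathbb{C}$ by the group generated by $\sigma: z\mapsto \bar z+\pi$ and $t: z\mapsto z+2i\beta$, where $\beta>0$; this group is identified with $\pi_1(K)$, and $g_\beta$ denotes the induced flat metric. Every Riemannian metric on $K$ is conformally equivalent to $g_\beta$ for some $\beta>0$. $\mathrm{vol}(g)$ is the total area. Lengths, measured with respect to $g$: - $l_\sigma(g)$: least length of a closed curve in the free homotopy class of the glide reflection $\sigma$; - $l_v(g)$: least length of a closed curve in the free homotopy class of the vertical translation $t$; - $l_h(g)$: least length of a closed curve in the free homotopy class of the horizontal translation $\sigma^2$; - $L_\sigma(g)$: least length of a curve freely homotopic to a geodesic loop closed by a (nontrivial) element of the subgroup $\langle\sigma\rangle$ generated by $\sigma$; since the only candidates are $\sigma$ and $\sigma^2$, $L_\sigma(g)=\inf\{l_\sigma(g),l_h(g)\}$. *)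

(* Defs.v *)
From HB Require Import structures.
From mathcomp Require Import all_boot all_order all_algebra generic_quotient.
From mathcomp Require Import all_classical all_reals all_analysis.

Set Implicit Arguments.
Unset Strict Implicit.
Unset Printing Implicit Defensive.

Import Order.TTheory GRing.Theory Num.Theory.
Import numFieldNormedType.Exports.

Local Open Scope classical_set_scope.
Local Open Scope ring_scope.
Local Open Scope quotient_scope.

(* The plane C is R * R, the point x + i y being (x, y). *)

Section KleinBottle.
Context {R : realType}.
Variable beta : R.

Definition glide (p : R * R) : R * R := (p.1 + pi, - p.2).

Definition vtrans (p : R * R) : R * R := (p.1, p.2 + 2 * beta).

(* The group of transformations of the plane generated by glide and vtrans. *)
Inductive deck : (R * R -> R * R) -> Prop :=
| deck_id : deck id
| deck_glide : deck glide
| deck_vtrans : deck vtrans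
| deck_comp (f h : R * R -> R * R) : deck f -> deck h -> deck (f \o h)
| deck_inv (f h : R * R -> R * R) : deck f -> cancel f h -> cancel h f -> deck h.

Definition same_orbit (p q : R * R) : bool :=
  `[< exists2 f, deck f & f p = q >].

Lemma glideK : cancel glide (fun p => (p.1 - pi, - p.2)).
Proof. by case=> x y; rewrite /glide /= addrK opprK. Qed.

Lemma glideVK : cancel (fun p => (p.1 - pi, - p.2)) glide.
Proof. by case=> x y; rewrite /glide /= subrK opprK. Qed.

Lemma vtransK : cancel vtrans (fun p => (p.1, p.2 - 2 * beta)).
Proof. by case=> x y; rewrite /vtrans /= addrK. Qed.

Lemma vtransVK : cancel (fun p => (p.1, p.2 - 2 * beta)) vtrans.
Proof. by case=> x y; rewrite /vtrans /= subrK. Qed.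

Lemma deck_has_inverse f :
  deck f -> exists h, [/\ deck h, cancel f h & cancel h f].
Proof.
elim=> [|||f1 f2 _ [h1 [d1 c1 c1']] _ [h2 [d2 c2 c2']]|f1 h df _ c c'].
- by exists id; split => //; exact: deck_id.
- exists (fun p => (p.1 - pi, - p.2)).
  by split; [exact: deck_inv deck_glide glideK glideVK|exact: glideK
            |exact: glideVK].
- exists (fun p => (p.1, p.2 - 2 * beta)).
  by split; [exact: deck_inv deck_vtrans vtransK vtransVK|exact: vtransK
            |exact: vtransVK].
- exists (h2 \o h1); split; first exact: deck_comp.
  + by move=> x /=; rewrite c1 c2.
  + by move=> x /=; rewrite c2' c1'.
- by exists f1.
Qed.

Lemma same_orbit_refl : reflexive same_orbit.
Proof. by move=> p; apply/asboolP; exists id => //; exact: deck_id. Qed.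

Lemma same_orbit_sym : symmetric same_orbit.
Proof.
suff imp p q : same_orbit p q -> same_orbit q p.
  by move=> p q; apply/idP/idP; exact: imp.
move=> /asboolP[f df <-]; apply/asboolP.
by have [h [dh fh _]] := deck_has_inverse df; exists h.
Qed.

Lemma same_orbit_trans : transitive same_orbit.
Proof.
move=> q p r /asboolP[f df <-] /asboolP[h dh <-]; apply/asboolP.
by exists (h \o f) => //; exact: deck_comp.
Qed.

Canonical same_orbit_equiv :=
  EquivRel same_orbit same_orbit_refl same_orbit_sym same_orbit_trans.

Definition klein : topologicalType :=
  quotient_topology {eq_quot same_orbit_equiv}.

Definition klein_proj (p : R * R) : klein :=
  \pi_(quotient_topology {eq_quot same_orbit_equiv}) p.

Lemma klein_projE p q :
  klein_proj p = klein_proj q <-> exists2 f, deck f & f p = q.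
Proof.
rewrite /klein_proj; split=> [/eqquotP/asboolP//|pq].
by apply/eqquotP/asboolP.
Qed.

(* C^infinity: every iterated directional derivative is differentiable. *)
Definition smooth (f : R * R -> R) : Prop :=
  forall (vs : seq (R * R)) (p : R * R),
    differentiable (foldr (fun v h => 'D_v h) f vs) p.

(* A Riemannian metric on the quotient is given by its pull-back to the plane, *)
(* i.e. a metric for which glide and vtrans are isometries; their              *)
(* differentials are (u1, u2) |-> (u1, - u2) and the identity.                 *)
Record riemannian_metric := RiemannianMetric {
  metric_form :> R * R -> R * R -> R * R -> R;
  metric_smooth : forall u v, smooth (fun p => metric_form p u v);
  metric_linear : forall p v (a : R) u w,
    metric_form p (a *: u + w) v = a * metric_form p u v + metric_form p w v;
  metric_sym : forall p u v, metric_form p u v = metric_form p v u;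
  metric_pos : forall p u, u != 0 -> 0 < metric_form p u u;
  metric_glide : forall p u v,
    metric_form (glide p) (u.1, - u.2) (v.1, - v.2) = metric_form p u v;
  metric_vtrans : forall p u v,
    metric_form (vtrans p) u v = metric_form p u v
}.

(* The rectangle [0, pi] x [0, 2 beta] is a fundamental domain of the group. *)
Definition volume (g : riemannian_metric) : R :=
  \int[(lebesgue_measure \x lebesgue_measure)%E]_(p in
      `[0, pi] `*` `[0, 2 * beta])
    Num.sqrt (g p (1, 0) (1, 0) * g p (0, 1) (0, 1) - g p (1, 0) (0, 1) ^+ 2).

(* On ]a, b[ the derivative exists and extends continuously to [a, b]. *)
Definition C1_on (a b : R) (c : R -> R * R) : Prop :=
  exists2 d : R -> R * R, continuous d &
    forall s, s \in `]a, b[ -> is_derive s 1 c (d s).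

Definition piecewise_C1 (c : R -> R * R) : Prop :=
  {within `[0, 1], continuous c} /\
  exists (n : nat) (s : nat -> R),
    [/\ s 0%N = 0, s n = 1 &
        forall i, (i < n)%N -> s i < s i.+1 /\ C1_on (s i) (s i.+1) c].

Definition length (g : riemannian_metric) (c : R -> R * R) : R :=
  \int[lebesgue_measure]_(s in `[0, 1])
    Num.sqrt (g (c s) (derive1 c s) (derive1 c s)).

(* Free homotopy of closed curves in K parametrised by [0, 1]; the values of *)
(* c0 and c1 outside [0, 1] are irrelevant.                                  *)
Definition freely_homotopic (c0 c1 : R -> klein) : Prop :=
  exists H : R * R -> klein,
    [/\ {within `[0, 1] `*` `[0, 1], continuous H},
        forall s, s \in `[0, 1] -> H (0, s) = c0 s,
        forall s, s \in `[0, 1] -> H (1, s) = c1 s &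
        forall r, r \in `[0, 1] -> H (r, 0) = H (r, 1)].

(* The closed curve that the identification of the group with pi_1(K)        *)
(* attaches to f, namely the projection of the segment from the origin to    *)
(* its image under f.                                                        *)
Definition deck_loop (f : R * R -> R * R) (s : R) : klein :=
  klein_proj (s *: f 0).

(* Closed curves in K are handled through their lifts to the plane. *)
Definition in_free_class (f : R * R -> R * R) (c : R -> R * R) : Prop :=
  [/\ piecewise_C1 c, klein_proj (c 0) = klein_proj (c 1) &
      freely_homotopic (klein_proj \o c) (deck_loop f)].

Definition least_length (f : R * R -> R * R) (g : riemannian_metric) : R :=
  inf [set length g c | c in in_free_class f].

Definition l_sigma (g : riemannian_metric) : R := least_length glide g.

Definition l_v (g : riemannian_metric) : R := least_length vtrans g.

Definition l_h (g : riemannian_metric) : R := least_length (glide \o glide) g.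

Definition L_sigma (g : riemannian_metric) : R := Num.min (l_sigma g) (l_h g).

End KleinBottle.

(* Main.v *)
(** Let [L = L_sigma g], [l = l_v g], and let [d] be the distance of the lifted
    metric, i.e. the infimum of the lengths of polygons. Write [H] and [T] for
    the translations by [(2 pi, 0)] and [(0, 2 beta)].

    Curves which have to cross, by the Poincare-Miranda theorem, can be cut and
    reglued; this gives [|k| L <= d p (p + k H + n T)] and likewise [|n| l].
    Hence [u p = inf_(k, n) d p (k H + n T) + n l] and its analogue [w] for [H]
    are 1-Lipschitz, and their differentials have periods [(0, l)] and [(L, 0)]
    on the torus generated by [H] and [T], whose area is [2 vol]. Integrating
    [dw /\ du] there, which is done on a grid with averages of [u] and [w] in
    order to avoid any differentiability issue, gives [L l <= 2 vol].

    The function [w] may even be taken for the smaller conformal metric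
    [L / e], where [e p = d p (p + H)], because a loop of class [H] moves each
    of its points by at most its length. So the inequality is strict unless
    [e] is constantly [L]. In that case there is an almost minimizing loop of
    class [H] through each point, and such a loop never meets the mirror image
    of itself, nor of a nearby one: a crossing would create three points at a
    small distance [eta] from it which are pairwise nearly [2 eta] apart, which
    is impossible infinitesimally. But as the base point moves up a vertical
    line, the loop passes from below its mirror image to above it.

    The constant is optimal because of [h(y)^2 dx^2 + a^2 dy^2] with
    [h(y) = 1/2 + cos(pi y / (2 beta))^(2 N)]: [l_v >= 2 beta a], [l_h >= pi] as
    [h >= 1/2], and [l_sigma >= pi] for large [a] as [h >= 1] around the axes of
    the glide reflections, while [vol / a] tends to [pi beta] as [N] grows. *)

Require Import Defs.
From mathcomp Require Import all_boot all_order all_algebra.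
From mathcomp Require Import all_classical all_reals all_analysis.
From mathcomp Require Import unstable measurable_realfun ring lra zify.
Set Implicit Arguments.
Unset Strict Implicit.
Unset Printing Implicit Defensive.
Import Order.TTheory GRing.Theory Num.Theory.
Import numFieldNormedType.Exports.
Local Open Scope classical_set_scope.
Local Open Scope ring_scope.

(** * Topological preliminaries *)

Section Topology.
Context {R : realType}.

(** The conformal factor [L / e] is only Lipschitz, so the argument runs for metrics with merely
    continuous coefficients ([kform]). No geodesic or minimizer is at hand there: every length is an
    infimum, every curve minimizes up to a small error, and each contradiction has to leave room for
    these errors. Calibrations need lower bounds in all classes [k H + n T], not only on the axes.
    The glide reflection supplies them: if [k] and [n] are nonzero, a curve of class [(k, n)] meets
    its mirror image of class [(k, - n)], and the two loops at the meeting point compose to [2 k H]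
    or [2 n T]. When [e] is constant, the almost minimizing loops through nearby points are
    unrelated choices, so nothing is continuous in the base point. What is carried along is a
    homotopy class of arcs in the punctured plane, formed by differences between a loop and a mirror
    image. Polygons are admissible curves, which bounds the least lengths by [d] from above. Lower
    bounds for all piecewise C1 curves are needed for the example metrics only, where linear
    functions calibrate once the ends of lifted curves are known. *)

Lemma lebesgue_number (V : normedModType R) (K : set V) (P : V -> V -> Prop) :
  compact K ->
  (forall x, K x -> exists2 e : R, 0 < e &
     forall y z, K y -> K z -> `|x - y| < e -> `|x - z| < e -> P y z) ->
  exists2 d : R, 0 < d & forall y z, K y -> K z -> `|y - z| < d -> P y z.
Proof.
move=> /compact_near_coveringP cK locP.
have := cK R (0^'+) (fun d y => K y -> forall z, K z -> `|y - z| < d -> P y z) _.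
move=> /(_ _)[]; last first.
  move=> e /= e0 eP.
  exists (e / 2); first by rewrite divr_gt0.
  move=> y z Ky Kz yz; apply: (eP (e / 2)) yz => //=.
    by rewrite sub0r normrN gtr0_norm ?divr_gt0// ltr_pdivrMr// ltr_pMr// ltr1n.
  by rewrite divr_gt0.
move=> x Kx; have [e e0 He] := locP x Kx.
exists (ball x (e / 2), [set d | 0 < d /\ d < e / 2]) => /=.
  split; first by apply: nbhsx_ballx; rewrite divr_gt0.
  exists (e / 2); first by rewrite /= divr_gt0.
  move=> d /=; rewrite sub0r normrN => de d0; split=> //.
  by rewrite gtr0_norm in de.
move=> [y d] /= [xy [d0 de]] Ky z Kz yz.
rewrite -ball_normE /= in xy.
have e2 : e / 2 < e by rewrite ltr_pdivrMr// ltr_pMr// ltr1n.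
apply: He => //; first exact: lt_trans xy e2.
rewrite -(subrKA y) (splitr e); apply: le_lt_trans (ler_normD _ _) _.
by apply: ltrD => //; exact: lt_trans yz de.
Qed.

Lemma unif_cont_compact (V : normedModType R) (K : set V) (f : V -> R) :
  compact K -> continuous f -> forall k, 0 < k ->
  exists2 d : R, 0 < d & forall y z, K y -> K z -> `|y - z| < d ->
    `|f y - f z| < k.
Proof.
move=> cK cf k k0; apply: lebesgue_number => // x Kx.
have /cvgrPdist_lt/(_ (k / 2)) := cf x.
rewrite divr_gt0// => /(_ isT) /nbhs_ballP[e /= e0 He]; exists e => //.
move=> y z _ _ xy xz.
have hy : `|f x - f y| < k / 2 by apply: He; rewrite -ball_normE.
have hz : `|f x - f z| < k / 2 by apply: He; rewrite -ball_normE.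
rewrite -(subrKA (f x)) (splitr k); apply: le_lt_trans (ler_normD _ _) _.
by rewrite ltrD// distrC.
Qed.

Lemma rect_compact (a b c d : R) : compact (`[a, b] `*` `[c, d]).
Proof. by apply: compact_setX; exact: segment_compact. Qed.

Lemma EVT_rect_min (a b c d : R) (f : R * R -> R) : a <= b -> c <= d ->
  continuous f ->
  exists2 z, z.1 \in `[a, b] /\ z.2 \in `[c, d] &
    forall t, t.1 \in `[a, b] -> t.2 \in `[c, d] -> f z <= f t.
Proof.
move=> ab cd cf.
have [||z] := @compact_EVT_min _ _ f _ _ (@rect_compact a b c d).
- by exists (a, c); split; rewrite /= in_itv /= lexx.
- exact: continuous_subspaceT.
rewrite inE => -[z1 z2] zP; exists z => // t t1 t2; apply: zP.
by rewrite inE; split.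
Qed.

Lemma EVT_rect_max (a b c d : R) (f : R * R -> R) : a <= b -> c <= d ->
  continuous f ->
  exists2 z, z.1 \in `[a, b] /\ z.2 \in `[c, d] &
    forall t, t.1 \in `[a, b] -> t.2 \in `[c, d] -> f t <= f z.
Proof.
move=> ab cd cf.
have [|z zP zM] := EVT_rect_min (f := fun z => - f z) ab cd.
  by move=> x; apply: continuousN; exact: cf.
by exists z => // t t1 t2; have := zM t t1 t2; rewrite lerN2.
Qed.

End Topology.

(** * Labelled grids and the Poincare-Miranda theorem *)

Section PoincareMiranda.

(** The labels 0, 1, 2 are the vertices of a cyclically oriented triangle, and this is the signed
    step along one of its edges; around a closed chain of labels the steps add up to three times the
    winding number. *)
Definition lab3_edge (a b : nat) : int :=
  match a, b with
  | 0, 1 | 1, 2 | 2, 0 => 1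
  | 1, 0 | 2, 1 | 0, 2 => -1
  | _, _ => 0
  end.

Definition rainbow (s : seq nat) := [&& 0%N \in s, 1%N \in s & 2%N \in s].

(** With at most two labels the four corners lie on a single edge of the triangle, so the steps
    around the cell cancel. *)
Lemma lab3_cell a b c d : (a < 3)%N -> (b < 3)%N -> (c < 3)%N -> (d < 3)%N ->
  ~~ rainbow [:: a; b; c; d] ->
  lab3_edge a b + lab3_edge b d - lab3_edge c d - lab3_edge a c = 0.
Proof. by case: a b c d => [|[|[|]]]// [|[|[|]]]// [|[|[|]]]// [|[|[|]]]. Qed.

Lemma telescope_ord (V : zmodType) n (f : nat -> V) :
  \sum_(j < n) (f j.+1 - f j) = f n - f 0%N.
Proof. by rewrite -(big_mkord xpredT (fun j => f j.+1 - f j)) telescope_sumr. Qed.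

Lemma lab3_line (phi : nat -> int) (l : nat -> nat) n :
  (forall i, (i < n)%N -> lab3_edge (l i) (l i.+1) = phi (l i.+1) - phi (l i)) ->
  \sum_(i < n) lab3_edge (l i) (l i.+1) = phi (l n) - phi (l 0%N).
Proof.
by move=> h; rewrite -(telescope_ord n (phi \o l)); apply: eq_bigr => i _; rewrite h.
Qed.

Lemma lab3_rainbow (lab : nat -> nat -> nat) n :
  (forall i j, (lab i j < 3)%N) ->
  (forall i, (i <= n)%N -> lab i 0%N = 0%N) ->
  (forall i, (i <= n)%N -> lab i n != 0%N) ->
  (forall j, (j <= n)%N -> lab 0%N j != 2%N) ->
  (forall j, (j <= n)%N -> lab n j != 1%N) ->
  exists i j, [/\ (i < n)%N, (j < n)%N &
    rainbow [:: lab i j; lab i.+1 j; lab i j.+1; lab i.+1 j.+1]].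
Proof.
move=> lt3 bot top left right; apply/not_existsP => nr.
pose h i j := lab3_edge (lab i j) (lab i.+1 j).
pose v i j := lab3_edge (lab i j) (lab i j.+1).
have cell i j : (i < n)%N -> (j < n)%N -> h i j + v i.+1 j - h i j.+1 - v i j = 0.
  move=> iln jln; apply: lab3_cell => //; apply/negP => rb.
  by apply: (nr i); exists j.
have S : \sum_(i < n) \sum_(j < n) (h i j + v i.+1 j - h i j.+1 - v i j) = 0.
  by rewrite big1// => i _; rewrite big1// => j _; exact: cell.
have S1 : \sum_(i < n) \sum_(j < n) (h i j - h i j.+1) =
    \sum_(i < n) h i 0%N - \sum_(i < n) h i n.
  rewrite -sumrB; apply: eq_bigr => i _.
  by rewrite -[RHS]opprB -(telescope_ord n (h i)) -sumrN; apply: eq_bigr => j _; rewrite opprB.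
have S2 : \sum_(i < n) \sum_(j < n) (v i.+1 j - v i j) =
    \sum_(j < n) v n j - \sum_(j < n) v 0%N j.
  rewrite exchange_big -sumrB; apply: eq_bigr => i _.
  exact: (telescope_ord n (fun j => v j i)).
have c0 : lab 0%N 0%N = 0%N by exact: bot.
have c1 : lab n 0%N = 0%N by exact: bot.
have c2 : lab 0%N n = 1%N.
  have := lt3 0%N n; have := top 0%N isT; have := left n (leqnn n).
  by case: (lab 0%N n) => [|[|[|]]].
have c3 : lab n n = 2%N.
  have := lt3 n n; have := top n (leqnn n); have := right n (leqnn n).
  by case: (lab n n) => [|[|[|]]].
have E1 : \sum_(i < n) h i 0%N = 0.
  by rewrite big1// => i _; rewrite /h !bot//; exact: ltnW.
have E2 : \sum_(i < n) h i n = 1.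
  rewrite /h (lab3_line (phi := Posz) (l := lab^~ n)) ?c2 ?c3// => i iln.
  have := top i (ltnW iln); have := top i.+1 iln.
  have := lt3 i n; have := lt3 i.+1 n.
  by case: (lab i n) (lab i.+1 n) => [|[|[|]]]// [|[|[|]]].
have E3 : \sum_(j < n) v n j = -1.
  rewrite /v (lab3_line (phi := fun k => if k == 2%N then -1 else 0)
    (l := lab n)) ?c1 ?c3// => j jln.
  have := right j (ltnW jln); have := right j.+1 jln.
  have := lt3 n j; have := lt3 n j.+1.
  by case: (lab n j) (lab n j.+1) => [|[|[|]]]// [|[|[|]]].
have E4 : \sum_(j < n) v 0%N j = 1.
  rewrite /v (lab3_line (phi := Posz) (l := lab 0%N)) ?c2 ?c0// => j jln.
  have := left j (ltnW jln); have := left j.+1 jln.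
  have := lt3 0%N j; have := lt3 0%N j.+1.
  by case: (lab 0%N j) (lab 0%N j.+1) => [|[|[|]]]// [|[|[|]]].
have : \sum_(i < n) \sum_(j < n) (h i j - h i j.+1) +
       \sum_(i < n) \sum_(j < n) (v i.+1 j - v i j) = 0.
  rewrite -big_split -[RHS]S; apply: eq_bigr => i _ /=.
  by rewrite -big_split; apply: eq_bigr => j _ /=; lia.
by rewrite S1 S2 E1 E2 E3 E4.
Qed.

Context {R : realType}.

Lemma near_le_of_opp (a b e : R) : a < 0 -> 0 <= b -> `|a - b| < e ->
  `|a| < e /\ `|b| < e.
Proof. by rewrite !ltr_norml; move=> ? ? /andP[? ?]; split; apply/andP; split; lra. Qed.

Lemma poincare_miranda_strict (F G : R * R -> R) :
  continuous F -> continuous G ->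
  (forall t, t \in `[0, 1] -> F (0, t) < 0) ->
  (forall t, t \in `[0, 1] -> 0 < F (1, t)) ->
  (forall t, t \in `[0, 1] -> G (t, 0) < 0) ->
  (forall t, t \in `[0, 1] -> 0 < G (t, 1)) ->
  forall e, 0 < e -> exists z, [/\ z.1 \in `[0, 1], z.2 \in `[0, 1],
    `|F z| < e & `|G z| < e].
Proof.
move=> cF cG F0 F1 G0 G1 e e0.
have [d1 d10 H1] := unif_cont_compact (@rect_compact R 0 1 0 1) cF e0.
have [d2 d20 H2] := unif_cont_compact (@rect_compact R 0 1 0 1) cG e0.
pose d := Num.min d1 d2.
have d0 : 0 < d by rewrite lt_min d10.
pose n := (Num.trunc d^-1).+1.
have nd : n%:R^-1 < d.
  rewrite invf_plt ?posrE ?ltr0n// /n.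
  exact: truncnS_gt.
pose pt (i j : nat) : R * R := (i%:R / n%:R, j%:R / n%:R).
have n0 : n%:R != 0 :> R by rewrite pnatr_eq0.
have in01 i : (i <= n)%N -> i%:R / n%:R \in `[0 : R, 1].
  move=> iln; rewrite in_itv /= divr_ge0//= ler_pdivrMr ?ltr0n//.
  by rewrite mul1r ler_nat.
(* Label 0 records [G < 0]; labels 1 and 2 record [G >= 0] together with the sign of [F]. In a cell
   with all three labels both functions change sign, hence are small at the corner labelled 1. *)
pose lab i j : nat := if G (pt i j) < 0 then 0%N else
   if F (pt i j) < 0 then 1%N else 2%N.
have [|i il|i il|j jl|j jl|i [j [iln jln rb]]] := @lab3_rainbow lab n.
- by move=> i j; rewrite /lab; case: ifP => // _; case: ifP.
- by rewrite /lab /pt mul0r G0 ?in01.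
- rewrite /lab /pt divff// ifF ?in01//; first by case: ifP.
  by apply/negbTE; rewrite -leNgt ltW// G1 ?in01.
- by rewrite /lab /pt mul0r F0 ?in01//; case: ifP.
- rewrite /lab /pt divff//; case: ifP => // _; rewrite ifF//.
  by apply/negbTE; rewrite -leNgt ltW// F1 ?in01.
pose C (z : R * R) := exists i' j', [/\ (i <= i' <= i.+1)%N, (j <= j' <= j.+1)%N & z = pt i' j'].
have Csq z : C z -> z.1 \in `[0 : R, 1] /\ z.2 \in `[0 : R, 1].
  by move=> [i' [j' [/andP[_ h1] /andP[_ h2] ->]]]; split => /=; apply: in01; lia.
have Cd z w : C z -> C w -> `|z - w| < d.
  have aux (k a b : nat) : (k <= a <= k.+1)%N -> (k <= b <= k.+1)%N ->
      `|a%:R / n%:R - b%:R / n%:R| < d :> R.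
    move=> ha hb; rewrite -mulrBl normrM [`|n%:R^-1|]gtr0_norm ?invr_gt0 ?ltr0n//.
    apply: le_lt_trans nd; rewrite ler_piMl ?invr_ge0//.
    have [->|->] : a = k \/ a = k.+1 by lia.
      have [->|->] : b = k \/ b = k.+1 by lia.
        by rewrite subrr normr0.
      by rewrite -natr1 opprD addrA subrr sub0r normrN normr1.
    have [->|->] : b = k \/ b = k.+1 by lia.
      by rewrite -natr1 addrAC subrr add0r normr1.
    by rewrite subrr normr0.
  move=> [i' [j' [h1 h2 ->]]] [i2 [j2 [h3 h4 ->]]].
  by rewrite /pt prod_normE /= gt_max (aux i)// (aux j).
have CF z w : C z -> C w -> `|F z - F w| < e.
  move=> Cz Cw; apply: H1; rewrite ?/=; [exact: Csq| exact: Csq|].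
  by apply: lt_le_trans (Cd _ _ Cz Cw) _; rewrite ge_min lexx.
have CG z w : C z -> C w -> `|G z - G w| < e.
  move=> Cz Cw; apply: H2; rewrite ?/=; [exact: Csq| exact: Csq|].
  by apply: lt_le_trans (Cd _ _ Cz Cw) _; rewrite ge_min lexx orbT.
have ex k : k \in [:: lab i j; lab i.+1 j; lab i j.+1; lab i.+1 j.+1] ->
    exists z, C z /\ (k = if G z < 0 then 0%N else if F z < 0 then 1%N else 2%N).
  rewrite !inE => /or4P[] /eqP->.
  - by exists (pt i j); split=> //; exists i, j; rewrite !leqnn !leqnSn.
  - by exists (pt i.+1 j); split=> //; exists i.+1, j; rewrite !leqnn !leqnSn.
  - by exists (pt i j.+1); split=> //; exists i, j.+1; rewrite !leqnn !leqnSn.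
  - by exists (pt i.+1 j.+1); split=> //; exists i.+1, j.+1; rewrite !leqnn !leqnSn.
have /and3P[/ex[a [Ca]] + /ex[b [Cb]] + /ex[c [Cc]]] := rb.
case: ifP => [Ga _|]; last by case: ifP.
case: ifP => // /negbT; rewrite -leNgt => Gb; case: ifP => // Fb _.
case: ifP => // /negbT; rewrite -leNgt => Gc; case: ifP => // /negbT.
rewrite -leNgt => Fc _.
have [sb1 sb2] := Csq _ Cb; exists b; split => //.
  by have [] := near_le_of_opp Fb Fc (CF _ _ Cb Cc).
by have [] := near_le_of_opp Ga Gb (CG _ _ Ca Cb).
Qed.

Lemma poincare_miranda (F G : R * R -> R) :
  continuous F -> continuous G ->
  (forall t, t \in `[0, 1] -> F (0, t) <= 0) ->
  (forall t, t \in `[0, 1] -> 0 <= F (1, t)) ->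
  (forall t, t \in `[0, 1] -> G (t, 0) <= 0) ->
  (forall t, t \in `[0, 1] -> 0 <= G (t, 1)) ->
  exists z, [/\ z.1 \in `[0, 1], z.2 \in `[0, 1], F z = 0 & G z = 0].
Proof.
move=> cF cG F0 F1 G0 G1.
pose S z : R := `|F z| + `|G z|.
have cS : continuous S.
  by move=> z; apply: cvgD; apply: cvg_norm; [exact: cF|exact: cG].
have [z [z1 z2] zmin] := EVT_rect_min (@ler01 R) (@ler01 R) cS.
exists z; suff S0 : S z <= 0.
  have : S z == 0 by rewrite eq_le S0 addr_ge0.
  by rewrite paddr_eq0// !normr_eq0 => /andP[/eqP ? /eqP ?]; split.
rewrite leNgt; apply/negP => Sz.
(* The perturbation that makes the boundary signs strict changes each function by at most [e], and
   the approximate zero costs another [e], so [S] would drop below [4 e] somewhere. *)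
pose e := S z / 5.
have e0 : 0 < e by rewrite divr_gt0.
pose F' z := F z + e * (2 * z.1 - 1).
pose G' z := G z + e * (2 * z.2 - 1).
have [| |t t1|t t1|t t1|t t1|w [w1 w2 Fw Gw]] := @poincare_miranda_strict F' G' _ _ _ _ _ _ e e0.
- move=> x; apply: cvgD; first exact: cF.
  apply: cvgM; first exact: cvg_cst.
  apply: cvgB; last exact: cvg_cst.
  by apply: cvgM; [exact: cvg_cst|exact: cvg_fst].
- move=> x; apply: cvgD; first exact: cG.
  apply: cvgM; first exact: cvg_cst.
  apply: cvgB; last exact: cvg_cst.
  by apply: cvgM; [exact: cvg_cst|exact: cvg_snd].
- by have := F0 t t1; rewrite /F' /=; lra.
- by have := F1 t t1; rewrite /F' /=; lra.
- by have := G0 t t1; rewrite /G' /=; lra.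
- by have := G1 t t1; rewrite /G' /=; lra.
have := zmin w w1 w2; rewrite leNgt => /negP; apply.
have aux (x t : R) : t \in `[0 : R, 1] -> `|x + e * (2 * t - 1)| < e -> `|x| < 2 * e.
  rewrite in_itv /= !ltr_norml => /andP[t0 t1] /andP[h1 h2].
  have : 0 <= e * t by apply: mulr_ge0; lra.
  have : 0 <= e * (1 - t) by apply: mulr_ge0; lra.
  by move=> *; apply/andP; split; lra.
have := aux _ _ w1 Fw; have := aux _ _ w2 Gw.
have -> : S z = 5 * e by rewrite /e; lra.
by rewrite {1}/S => *; lra.
Qed.

End PoincareMiranda.

(** * Integrals on segments *)

Section SegmentIntegral.
Context {R : realType}.
Local Notation mu := (@lebesgue_measure R).

Lemma continuous_integrable (f : R -> R) (a b : R) : continuous f ->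
  mu.-integrable `[a, b] (EFin \o f).
Proof.
move=> cf; apply: continuous_compact_integrable; first exact: segment_compact.
exact: continuous_subspaceT.
Qed.

(** End points are disregarded because the derivative of a piecewise C1 curve is unspecified at the
    breakpoints. *)
Lemma eq_oo_integrable (f g : R -> R) (a b : R) :
  mu.-integrable `[a, b] (EFin \o f) ->
  {in `]a, b[, g =1 f} -> mu.-integrable `[a, b] (EFin \o g).
Proof.
move=> fi gf.
have fo : mu.-integrable `]a, b[ (EFin \o f).
  by apply: integrableS fi => //; exact: subset_itv_oo_cc.
have go : mu.-integrable `]a, b[ (EFin \o g).
  apply: (@eq_integrable _ _ _ mu _ _ (EFin \o f)) => // x; rewrite inE /= => xab.
  by rewrite gf.
have [mg ig] := integrableP _ _ _ go.
apply/integrableP; split.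
  apply/measurable_EFinP; apply: (@measurable_fun_itv_cc _ a b false true).
  exact/measurable_EFinP.
rewrite integral_itv_bndoo//; exact: measurableT_comp.
Qed.

Lemma eq_oo_Rintegral (f g : R -> R) (a b : R) :
  mu.-integrable `[a, b] (EFin \o f) ->
  {in `]a, b[, g =1 f} ->
  \int[mu]_(x in `[a, b]) g x = \int[mu]_(x in `[a, b]) f x.
Proof.
move=> fi gf; have gi := eq_oo_integrable fi gf.
have oo h : mu.-integrable `[a, b] (EFin \o h) ->
    measurable_fun `]a, b[ (EFin \o h).
  move=> /integrableP[mh _]; apply: measurable_funS mh => //.
  exact: subset_itv_oo_cc.
rewrite /Rintegral (@integral_itv_bndoo _ a b (EFin \o g) true false); last exact: oo.
rewrite (@integral_itv_bndoo _ a b (EFin \o f) true false); last exact: oo.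
by congr fine; apply: eq_integral => x; rewrite inE /= => xab; rewrite gf.
Qed.

Lemma integrable_sub_itv (f : R -> R) (a b c d : R) : a <= c -> d <= b ->
  mu.-integrable `[a, b] (EFin \o f) -> mu.-integrable `[c, d] (EFin \o f).
Proof.
move=> ac db; apply: integrableS => //.
by apply: subset_itv; rewrite bnd_simp.
Qed.

Lemma Rintegral_cut (f : R -> R) (a c b : R) : a <= c -> c <= b ->
  mu.-integrable `[a, b] (EFin \o f) ->
  \int[mu]_(x in `[a, b]) f x =
  \int[mu]_(x in `[a, c]) f x + \int[mu]_(x in `[c, b]) f x.
Proof.
move=> ac cb fi.
rewrite -(@Rintegral_itv_obnd_cbnd _ c (BRight b)); last first.
  by apply: integrableS fi => //; apply: subset_itv; rewrite bnd_simp.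
by rewrite -(Rintegral_itvB fi) ?bnd_simp// addrC subrK.
Qed.

Lemma Rintegral_itv_cst (a b k : R) : a <= b ->
  \int[mu]_(x in `[a, b]) k = k * (b - a).
Proof.
move=> ab; rewrite Rintegral_cst//= lebesgue_measure_itv /= lte_fin.
case: ltP => //= ba; have -> : a = b by lra.
by rewrite subrr.
Qed.

Lemma le_Rintegral_itv (f g : R -> R) (a b : R) :
  mu.-integrable `[a, b] (EFin \o f) -> mu.-integrable `[a, b] (EFin \o g) ->
  (forall x, x \in `[a, b] -> f x <= g x) ->
  \int[mu]_(x in `[a, b]) f x <= \int[mu]_(x in `[a, b]) g x.
Proof. by move=> fi gi fg; apply: le_Rintegral => // x; exact: fg. Qed.

Lemma Rintegral_affine (f : R -> R) (a b : R) : continuous f -> a <= b ->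
  \int[mu]_(x in `[a, b]) f x =
  (b - a) * \int[mu]_(t in `[0, 1]) f (a + t * (b - a)).
Proof.
move=> cf; rewrite le_eqVlt => /orP[/eqP<-|ab].
  by rewrite subrr mul0r set_itv1 Rintegral_set1.
pose F (t : R) := a + t * (b - a).
have dF (t : R) : is_derive t 1 F (b - a).
  have := is_deriveD (is_derive_cst a t 1) (is_deriveM (is_derive_id t 1) (is_derive_cst (b - a) t 1)).
  rewrite add0r scaler0 add0r => h.
  by apply: is_derive_eq h _; rewrite /GRing.scale /= mulr1.
have F' : F^`()%classic = fun=> b - a.
  by apply/funext => t; rewrite derive1E; by case: (dF t).
have cF : continuous F.
  by move=> t; apply: cvgD; [exact: cvg_cst|apply: cvgM; [exact: cvg_id|exact: cvg_cst]].
have S := @integration_by_substitution_increasing R F f 0 1 ler01.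
have F0 : F 0 = a by rewrite /F mul0r addr0.
have F1 : F 1 = b by rewrite /F mul1r addrC subrK.
rewrite /Rintegral -{1}F0 -{1}F1 S.
- have fi : mu.-integrable `[0, 1] (EFin \o (f \o F)).
    by apply: continuous_integrable => t; apply: continuous_comp; [exact: cF|exact: cf].
  rewrite -[RHS](RintegralZl (b - a) _ fi)// F'; congr fine.
  by apply: eq_integral => t _ /=; rewrite mulrC.
- by move=> x y _ _ xy; rewrite /F ltrD2l ltr_pM2r// subr_gt0.
- by rewrite F' => x _; exact: cvg_cst.
- by rewrite F'; apply/cvg_ex; exists (b - a); exact: cvg_cst.
- by rewrite F'; apply/cvg_ex; exists (b - a); exact: cvg_cst.
- split; first by move=> t _; have := dF t; case.
  + by apply: cvg_at_right_filter; exact: cF.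
  + by apply: cvg_at_left_filter; exact: cF.
- exact: continuous_subspaceT.
Qed.

End SegmentIntegral.

(** * Lattice, quadratic forms and their norms *)

Section Lattice.
Context {R : realType}.
Variable beta : R.

Definition hvec : R * R := (2 * pi, 0).
Definition tvec : R * R := (0, 2 * beta).
Definition lat (k n : int) : R * R := (2 * pi * k%:~R, 2 * beta * n%:~R).

Lemma lat00 : lat 0 0 = 0.
Proof. by rewrite /lat !mulr0. Qed.

Lemma latD k n k' n' : lat (k + k') (n + n') = lat k n + lat k' n'.
Proof. by rewrite /lat !intrD !mulrDr. Qed.

Lemma latN k n : lat (- k) (- n) = - lat k n.
Proof. by rewrite /lat !intrN !mulrN. Qed.

Lemma latB k n k' n' : lat (k - k') (n - n') = lat k n - lat k' n'.
Proof. by rewrite latD latN. Qed.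

Lemma lat10 : lat 1 0 = hvec.
Proof. by rewrite /lat mulr0 mulr1. Qed.

Lemma lat01 : lat 0 1 = tvec.
Proof. by rewrite /lat mulr0 mulr1. Qed.

Lemma periodic_lat (A : Type) (f : R * R -> A) :
  (forall p, f (p + hvec) = f p) -> (forall p, f (p + tvec) = f p) ->
  forall k n p, f (p + lat k n) = f p.
Proof.
move=> fh ft k n p.
have fhn m q : f (q + lat (Posz m) 0) = f q.
  elim: m q => [|m IH] q; first by rewrite lat00 addr0.
  have -> : lat (Posz m.+1) 0 = lat (Posz m) 0 + hvec.
    by rewrite -lat10 -latD addr0 -PoszD addn1.
  by rewrite addrA fh IH.
have ftn m q : f (q + lat 0 (Posz m)) = f q.
  elim: m q => [|m IH] q; first by rewrite lat00 addr0.
  have -> : lat 0 (Posz m.+1) = lat 0 (Posz m) + tvec.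
    by rewrite -lat01 -latD addr0 -PoszD addn1.
  by rewrite addrA ft IH.
have fhz q : f (q + lat k 0) = f q.
  case: k => m; first exact: fhn.
  by rewrite NegzE -(fhn m.+1) -addrA -latD addNr lat00 addr0.
have ftz q : f (q + lat 0 n) = f q.
  case: n => m; first exact: ftn.
  by rewrite NegzE -(ftn m.+1) -addrA -latD addNr lat00 addr0.
have -> : lat k n = lat k 0 + lat 0 n by rewrite -latD addr0 add0r.
by rewrite addrA ftz fhz.
Qed.

Hypothesis beta0 : 0 < beta.

Lemma floor_reduce (a x : R) : 0 < a -> exists k : int, x + a * k%:~R \in `[0, a].
Proof.
move=> a0; exists (- Num.floor (x / a)).
have := floor_le_tmp (x / a); have := floorD1_gt (x / a).
rewrite ltr_pdivrMr// ler_pdivlMr// intrN in_itv /= intrD mulrDl mul1r.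
by move=> h1 h2; apply/andP; split; lra.
Qed.

Lemma lat_reduce (p : R * R) : exists k n,
  (p + lat k n).1 \in `[0, 2 * pi] /\ (p + lat k n).2 \in `[0, 2 * beta].
Proof.
have [k kP] := floor_reduce p.1 (mulr_gt0 (ltr0Sn R 1) (pi_gt0 R)).
have [n nP] := floor_reduce p.2 (mulr_gt0 (ltr0Sn R 1) beta0).
by exists k, n.
Qed.

Variable f : R * R -> R.
Hypothesis cf : continuous f.
Hypothesis fh : forall p, f (p + hvec) = f p.
Hypothesis ft : forall p, f (p + tvec) = f p.

Lemma periodic_unif_cont (k : R) : 0 < k ->
  exists2 d : R, 0 < d & forall p q, `|p - q| < d -> `|f p - f q| < k.
Proof.
move=> k0.
(* A margin of 1 around the period rectangle keeps both points inside once the first one has been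
   translated into it. *)
have [d d0 dP] := unif_cont_compact (@rect_compact R (-1) (2 * pi + 1) (-1) (2 * beta + 1)) cf k0.
exists (Num.min d 1); first by rewrite lt_min d0 ltr01.
move=> p q; rewrite lt_min => /andP[pqd pq1].
have [k' [n [p1 p2]]] := lat_reduce p.
rewrite -(periodic_lat fh ft k' n p) -(periodic_lat fh ft k' n q).
have E : p + lat k' n - (q + lat k' n) = p - q by rewrite opprD addrACA subrr addr0.
rewrite -E in pqd pq1.
move: (p + _) (q + _) p1 p2 pqd pq1 => {E}p {}q p1 p2 pqd pq1.
apply: dP => //.
  move: p1 p2; rewrite !in_itv /= => /andP[? ?] /andP[? ?].
  by split; rewrite /= in_itv /=; apply/andP; split; lra.
move: p1 p2 pq1; rewrite !in_itv /= prod_normE gt_max /=.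
move=> /andP[? ?] /andP[? ?] /andP[/ltr_normlP[? ?] /ltr_normlP[? ?]].
by split; rewrite /= in_itv /=; apply/andP; split; lra.
Qed.

Lemma periodic_max : exists M : R, forall p, f p <= M.
Proof.
have [||z _ zP] := @EVT_rect_max R 0 (2 * pi) 0 (2 * beta) f _ _ cf.
- by rewrite mulr_ge0// ltW// pi_gt0.
- by rewrite mulr_ge0// ltW.
exists (f z) => p; have [k [n [p1 p2]]] := lat_reduce p.
by rewrite -(periodic_lat fh ft k n p); exact: zP.
Qed.

Lemma periodic_min_gt0 : (forall p, 0 < f p) ->
  exists2 m : R, 0 < m & forall p, m <= f p.
Proof.
have [||z _ zP] := @EVT_rect_min R 0 (2 * pi) 0 (2 * beta) f _ _ cf.
- by rewrite mulr_ge0// ltW// pi_gt0.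
- by rewrite mulr_ge0// ltW.
move=> f0; exists (f z) => // p; have [k [n [p1 p2]]] := lat_reduce p.
by rewrite -(periodic_lat fh ft k n p); exact: zP.
Qed.

End Lattice.

(** * Positive binary quadratic forms *)

Section QuadraticForms.
Context {R : realType}.

Definition qf (E F G : R) (v : R * R) : R :=
  E * v.1 ^+ 2 + 2 * F * v.1 * v.2 + G * v.2 ^+ 2.

Definition qb (E F G : R) (v w : R * R) : R :=
  E * v.1 * w.1 + F * (v.1 * w.2 + v.2 * w.1) + G * v.2 * w.2.

(** Lagrange's identity with the determinant as a factor; it yields the Cauchy-Schwarz inequality
    behind [qf_triangle]. *)
Lemma qf_cauchy E F G v w :
  qf E F G v * qf E F G w - qb E F G v w ^+ 2 =
  (E * G - F ^+ 2) * (v.1 * w.2 - v.2 * w.1) ^+ 2.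
Proof. rewrite /qf /qb; ring. Qed.

(** Cayley-Hamilton for the symmetric matrix [A] of the form, paired with [v]:
    [tr A <v, A v> - det A |v|^2 = |A v|^2]. Positivity and the lower bound [det / trace] follow
    without eigenvalues. *)
Lemma qf_trace E F G v :
  (E + G) * qf E F G v - (E * G - F ^+ 2) * (v.1 ^+ 2 + v.2 ^+ 2) =
  (E * v.1 + F * v.2) ^+ 2 + (F * v.1 + G * v.2) ^+ 2.
Proof. rewrite /qf; ring. Qed.

Variables E F G : R.
Hypothesis E0 : 0 < E.
Hypothesis D0 : 0 < E * G - F ^+ 2.

Lemma posdef_G0 : 0 < G.
Proof.
have : 0 < E * G by apply: lt_le_trans D0 _; rewrite gerBl sqr_ge0.
by rewrite pmulr_rgt0.
Qed.

Lemma qf_ge0 v : 0 <= qf E F G v.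
Proof.
rewrite -(pmulr_rge0 _ (addr_gt0 E0 posdef_G0)).
have := qf_trace E F G v.
have : 0 <= (E * G - F ^+ 2) * (v.1 ^+ 2 + v.2 ^+ 2).
  by apply: mulr_ge0; [exact: ltW|rewrite addr_ge0 ?sqr_ge0].
have := sqr_ge0 (E * v.1 + F * v.2); have := sqr_ge0 (F * v.1 + G * v.2).
by move=> *; lra.
Qed.

Lemma qf_lower v : (E * G - F ^+ 2) / (E + G) * `|v| ^+ 2 <= qf E F G v.
Proof.
have EG := addr_gt0 E0 posdef_G0.
rewrite mulrAC ler_pdivrMr//.
have := qf_trace E F G v.
have : (E * G - F ^+ 2) * `|v| ^+ 2 <= (E * G - F ^+ 2) * (v.1 ^+ 2 + v.2 ^+ 2).
  rewrite ler_pM2l// prod_normE.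
  have h1 := sqr_ge0 v.1; have h2 := sqr_ge0 v.2.
  by case: (leP `|v.1| `|v.2|) => _; rewrite real_normK ?num_real//; lra.
have := sqr_ge0 (E * v.1 + F * v.2); have := sqr_ge0 (F * v.1 + G * v.2).
by move=> *; lra.
Qed.

Lemma qf_triangle v w : Num.sqrt (qf E F G (v + w)) <=
  Num.sqrt (qf E F G v) + Num.sqrt (qf E F G w).
Proof.
rewrite -(@ler_pXn2r _ 2)// ?nnegrE ?addr_ge0 ?sqrtr_ge0//.
rewrite sqrrD !sqr_sqrtr ?qf_ge0//.
have -> : qf E F G (v + w) = qf E F G v + 2 * qb E F G v w + qf E F G w.
  by rewrite /qf /qb /=; ring.
rewrite lerD2r lerD2l -[X in _ <= X]mulr_natl ler_pM2l//.
rewrite -sqrtrM ?qf_ge0//; apply: le_trans (ler_norm _) _.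
rewrite -sqrtr_sqr ler_wsqrtr//.
have := qf_cauchy E F G v w.
have : 0 <= (E * G - F ^+ 2) * (v.1 * w.2 - v.2 * w.1) ^+ 2.
  by apply: mulr_ge0; [exact: ltW|exact: sqr_ge0].
by move=> *; lra.
Qed.

End QuadraticForms.

(** * Continuous metrics on the Klein bottle *)

Section KForm.
Context {R : realType}.
Local Notation mu := (@lebesgue_measure R).

Lemma pair_ext (p q : R * R) : p.1 = q.1 -> p.2 = q.2 -> p = q.
Proof. by case: p q => [? ?] [? ?] /= -> ->. Qed.

Lemma glide_glide (p : R * R) : glide (glide p) = p + hvec.
Proof.
by apply: pair_ext; rewrite /=; lra.
Qed.

Lemma vtransE (beta : R) (p : R * R) : vtrans beta p = p + tvec beta.
Proof. by apply: pair_ext; rewrite /=; lra. Qed.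

Definition refl2 (v : R * R) : R * R := (v.1, - v.2).

Lemma glideB (p q : R * R) : glide p - glide q = refl2 (p - q).
Proof. by apply: pair_ext; rewrite /=; lra. Qed.

Lemma glideD (p v : R * R) : glide (p + v) = glide p + refl2 v.
Proof. by apply: pair_ext; rewrite /=; lra. Qed.

Lemma refl2Z (t : R) (v : R * R) : refl2 (t *: v) = t *: refl2 v.
Proof. by apply: pair_ext; rewrite /= ?scalerN. Qed.

Variable beta : R.

(** The metric [E dx^2 + 2 F dx dy + G dy^2], with coefficients that are only continuous because
    Lipschitz conformal factors have to be allowed. The differential of [glide] reverses [dy],
    whence the sign in [kF_glide]. *)
Record kform := KForm {
  kE : R * R -> R; kF : R * R -> R; kG : R * R -> R;
  kE_cont : continuous kE; kF_cont : continuous kF; kG_cont : continuous kG;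
  kE_glide : forall p, kE (glide p) = kE p;
  kF_glide : forall p, kF (glide p) = - kF p;
  kG_glide : forall p, kG (glide p) = kG p;
  kE_vtrans : forall p, kE (vtrans beta p) = kE p;
  kF_vtrans : forall p, kF (vtrans beta p) = kF p;
  kG_vtrans : forall p, kG (vtrans beta p) = kG p;
  kE_gt0 : forall p, 0 < kE p;
  kD_gt0 : forall p, 0 < kE p * kG p - kF p ^+ 2
}.

Definition nrm (K : kform) (p v : R * R) : R :=
  Num.sqrt (qf (kE K p) (kF K p) (kG K p) v).

Section Norm.
Variable K : kform.

Lemma kG_gt0 p : 0 < kG K p.
Proof. exact: posdef_G0 (kE_gt0 K p) (kD_gt0 K p). Qed.

Lemma kE_h p : kE K (p + hvec) = kE K p.
Proof. by rewrite -glide_glide !kE_glide. Qed.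
Lemma kF_h p : kF K (p + hvec) = kF K p.
Proof. by rewrite -glide_glide !kF_glide opprK. Qed.
Lemma kG_h p : kG K (p + hvec) = kG K p.
Proof. by rewrite -glide_glide !kG_glide. Qed.
Lemma kE_t p : kE K (p + tvec beta) = kE K p.
Proof. by rewrite -vtransE kE_vtrans. Qed.
Lemma kF_t p : kF K (p + tvec beta) = kF K p.
Proof. by rewrite -vtransE kF_vtrans. Qed.
Lemma kG_t p : kG K (p + tvec beta) = kG K p.
Proof. by rewrite -vtransE kG_vtrans. Qed.

Lemma nrm_ge0 p v : 0 <= nrm K p v.
Proof. exact: sqrtr_ge0. Qed.

Lemma nrm_sqr p v : nrm K p v ^+ 2 = qf (kE K p) (kF K p) (kG K p) v.
Proof. by rewrite sqr_sqrtr// qf_ge0 ?kE_gt0 ?kD_gt0. Qed.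

Lemma nrmZ p a v : nrm K p (a *: v) = `|a| * nrm K p v.
Proof.
rewrite /nrm -sqrtr_sqr -sqrtrM ?sqr_ge0//; congr Num.sqrt.
by rewrite /qf /= /GRing.scale /=; ring.
Qed.

Lemma nrmN p v : nrm K p (- v) = nrm K p v.
Proof. by rewrite -scaleN1r nrmZ normrN1 mul1r. Qed.

Lemma nrm_triangle p v w : nrm K p (v + w) <= nrm K p v + nrm K p w.
Proof. exact: qf_triangle (kE_gt0 K p) (kD_gt0 K p) v w. Qed.

Lemma nrm_glide p v : nrm K (glide p) (refl2 v) = nrm K p v.
Proof.
by rewrite /nrm kE_glide kF_glide kG_glide; congr Num.sqrt; rewrite /qf /=; ring.
Qed.

Lemma nrm_lat k n p v : nrm K (p + lat beta k n) v = nrm K p v.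
Proof.
move: p; apply: (periodic_lat (f := fun p => nrm K p v)) => p; rewrite /nrm.
  by rewrite kE_h kF_h kG_h.
by rewrite kE_t kF_t kG_t.
Qed.

Lemma nrm_cont v : continuous (fun p => nrm K p v).
Proof.
move=> p; apply: (@continuous_comp _ _ _ (fun p => qf (kE K p) (kF K p) (kG K p) v)); last exact: sqrt_continuous.
apply: cvgD; first apply: cvgD.
- by apply: cvgM; [exact: kE_cont|exact: cvg_cst].
- do 2 (apply: cvgM; last exact: cvg_cst).
  by apply: cvgM; [exact: cvg_cst|exact: kF_cont].
- by apply: cvgM; [exact: kG_cont|exact: cvg_cst].
Qed.

Lemma line_cont (p v : R * R) : continuous (fun t : R => p + t *: v).
Proof.
move=> t; apply: cvgD; first exact: cvg_cst.
by apply: cvgZr_tmp; exact: cvg_id.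
Qed.

Lemma nrm_line_cont p v w : continuous (fun t : R => nrm K (p + t *: v) w).
Proof.
move=> t; apply: (@continuous_comp _ _ _ (fun t : R => p + t *: v) (fun p => nrm K p w)).
  exact: line_cont.
exact: nrm_cont.
Qed.

Hypothesis beta0 : 0 < beta.

Lemma nrm_lower : exists2 c : R, 0 < c & forall p v, c * `|v| <= nrm K p v.
Proof.
pose m p := (kE K p * kG K p - kF K p ^+ 2) / (kE K p + kG K p).
have EG p : 0 < kE K p + kG K p by rewrite addr_gt0 ?kE_gt0 ?kG_gt0.
have cm : continuous m.
  move=> p; apply: cvgM.
    apply: cvgB; first by apply: cvgM; [exact: kE_cont|exact: kG_cont].
    by rewrite expr2; apply: cvgM; exact: kF_cont.
  by apply: cvgV; [rewrite gt_eqF|apply: cvgD; [exact: kE_cont|exact: kG_cont]].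
have [||p|c c0 cP] := periodic_min_gt0 beta0 cm.
- by move=> p; rewrite /m kE_h kF_h kG_h.
- by move=> p; rewrite /m kE_t kF_t kG_t.
- by rewrite divr_gt0 ?kD_gt0.
exists (Num.sqrt c); first by rewrite sqrtr_gt0.
move=> p v; rewrite -[`|v|]normr_id -sqrtr_sqr -sqrtrM ?(ltW c0)//.
apply: ler_wsqrtr; apply: le_trans (qf_lower (kE_gt0 K p) (kD_gt0 K p) v).
by apply: ler_wpM2r; [exact: sqr_ge0|exact: cP].
Qed.

Lemma coord_le_norm (v : R * R) : `|v.1| <= `|v| /\ `|v.2| <= `|v|.
Proof. by rewrite prod_normE !le_max !lexx orbT. Qed.

Lemma qf_norm_le (a b c : R) v :
  qf a b c v <= (`|a| + 2 * `|b| + `|c|) * `|v| ^+ 2.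
Proof.
have [v1 v2] := coord_le_norm v.
have sq x : `|x| <= `|v| -> x ^+ 2 <= `|v| ^+ 2.
  by move=> h; rewrite -(real_normK (num_real x)) ler_pXn2r ?nnegrE.
have -> : (`|a| + 2 * `|b| + `|c|) * `|v| ^+ 2 =
    `|a| * `|v| ^+ 2 + 2 * `|b| * `|v| ^+ 2 + `|c| * `|v| ^+ 2 by ring.
rewrite /qf; apply: lerD; first apply: lerD.
- apply: le_trans (_ : `|a| * v.1 ^+ 2 <= _).
    by rewrite ler_wpM2r ?sqr_ge0 ?ler_norm.
  by rewrite ler_wpM2l// sq.
- apply: (le_trans (ler_norm (2 * b * v.1 * v.2))); rewrite !normrM (ger0_norm (ler0n R 2)).
  by rewrite expr2 -!mulrA ler_pM2l// ler_wpM2l// ler_pM.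
- apply: le_trans (_ : `|c| * v.2 ^+ 2 <= _).
    by rewrite ler_wpM2r ?sqr_ge0 ?ler_norm.
  by rewrite ler_wpM2l// sq.
Qed.

Lemma nrm_upper : exists2 C : R, 0 < C & forall p v, nrm K p v <= C * `|v|.
Proof.
pose m p := `|kE K p| + 2 * `|kF K p| + `|kG K p|.
have cm : continuous m.
  move=> p; apply: cvgD; first apply: cvgD.
  - by apply: cvg_norm; exact: kE_cont.
  - by apply: cvgM; [exact: cvg_cst|apply: cvg_norm; exact: kF_cont].
  - by apply: cvg_norm; exact: kG_cont.
have [||M MP] := periodic_max beta0 cm.
- by move=> p; rewrite /m kE_h kF_h kG_h.
- by move=> p; rewrite /m kE_t kF_t kG_t.
have M0 : 0 < M.
  apply: lt_le_trans (MP 0); rewrite /m.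
  have := kE_gt0 K 0; have := normr_ge0 (kF K 0); have := normr_ge0 (kG K 0).
  have := ler_norm (kE K 0); lra.
exists (Num.sqrt M); first by rewrite sqrtr_gt0.
move=> p v; rewrite -[`|v|]normr_id -sqrtr_sqr -sqrtrM ?(ltW M0)//.
apply: ler_wsqrtr; apply: le_trans (qf_norm_le _ _ _ _) _.
by apply: ler_wpM2r; [exact: sqr_ge0|exact: MP].
Qed.

Lemma nrm_unif (k : R) : 0 < k -> exists2 d : R, 0 < d &
  forall p q v, `|p - q| < d -> nrm K p v <= nrm K q v + k * `|v|.
Proof.
(* The coefficients enter [qf_norm_le] with weights 1, 2, 1, so variations below [k ^+ 2 / 4] change
   the squared norm of [v] by at most [k ^+ 2] times [|v| ^+ 2]. *)
move=> k0; have k4 : 0 < k ^+ 2 / 4 by rewrite divr_gt0// exprn_gt0.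
have [dE dE0 HE] := periodic_unif_cont beta0 (@kE_cont K) kE_h kE_t k4.
have [dF dF0 HF] := periodic_unif_cont beta0 (@kF_cont K) kF_h kF_t k4.
have [dG dG0 HG] := periodic_unif_cont beta0 (@kG_cont K) kG_h kG_t k4.
exists (Num.min dE (Num.min dF dG)); first by rewrite !lt_min dE0 dF0.
move=> p q v; rewrite !lt_min => /and3P[pqE pqF pqG].
rewrite -(@ler_pXn2r _ 2)// ?nnegrE ?nrm_ge0//; last first.
  by rewrite addr_ge0 ?nrm_ge0// mulr_ge0// ltW.
rewrite sqrrD !nrm_sqr exprMn.
have := qf_norm_le (kE K p - kE K q) (kF K p - kF K q) (kG K p - kG K q) v.
have : (`|kE K p - kE K q| + 2 * `|kF K p - kF K q| + `|kG K p - kG K q|) * `|v| ^+ 2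
   <= k ^+ 2 * `|v| ^+ 2.
  by rewrite ler_wpM2r ?sqr_ge0//; have := HE _ _ pqE; have := HF _ _ pqF; have := HG _ _ pqG; lra.
have : 0 <= nrm K q v * (k * `|v|) *+ 2.
  by rewrite mulrn_wge0// mulr_ge0 ?nrm_ge0// mulr_ge0// ltW.
rewrite /qf /=; lra.
Qed.

End Norm.
End KForm.

(** * Polygonal distance of a metric on the plane *)

Section PolygonalDistance.
Context {R : realType}.
Variable beta : R.
Local Notation mu := (@lebesgue_measure R).
Variable K : kform beta.

Definition seg (p q : R * R) : R :=
  \int[mu]_(t in `[0, 1]) nrm K (p + t *: (q - p)) (q - p).

Fixpoint plen (p : R * R) (s : seq (R * R)) : R :=
  if s is q :: s' then seg p q + plen q s' else 0.

(** With polygons, concatenation and reversal become operations on lists. Polygons are piecewise C1,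
    so [dist] bounds the least lengths from above, which is the direction that the inequality
    requires. *)
Definition dist (p q : R * R) : R := inf [set plen p s | s in [set s | last p s = q]].

Lemma seg_ge0 p q : 0 <= seg p q.
Proof. by apply: Rintegral_ge0 => t _; exact: nrm_ge0. Qed.

Lemma seg_int p q a b :
  mu.-integrable `[a, b] (EFin \o (fun t => nrm K (p + t *: (q - p)) (q - p))).
Proof. by apply: continuous_integrable; exact: nrm_line_cont. Qed.

Lemma seg_sub p q a b : a <= b ->
  seg (p + a *: (q - p)) (p + b *: (q - p)) =
  \int[mu]_(t in `[a, b]) nrm K (p + t *: (q - p)) (q - p).
Proof.
move=> ab; rewrite (Rintegral_affine (@nrm_line_cont _ _ K p (q - p) (q - p)) ab).
rewrite -RintegralZl//; last first.
  apply: (@continuous_integrable _ (fun t => nrm K (p + (a + t * (b - a)) *: (q - p)) (q - p))) => t.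
  apply: (@continuous_comp R R R (fun t : R => a + t * (b - a)) (fun t : R => nrm K (p + t *: (q - p)) (q - p))).
    by apply: cvgD; [exact: cvg_cst|apply: cvgM; [exact: cvg_id|exact: cvg_cst]].
  exact: nrm_line_cont.
have E : p + b *: (q - p) - (p + a *: (q - p)) = (b - a) *: (q - p).
  by rewrite opprD addrACA subrr add0r scalerBl.
apply: eq_Rintegral => t _ /=; rewrite E nrmZ ger0_norm ?subr_ge0//.
by rewrite scalerA -addrA -scalerDl.
Qed.

Lemma segE p q : seg p q = seg (p + 0 *: (q - p)) (p + 1 *: (q - p)).
Proof. by rewrite scale0r addr0 scale1r addrC subrK. Qed.

Lemma seg_split p q a b c : a <= b -> b <= c ->
  seg (p + a *: (q - p)) (p + c *: (q - p)) =
  seg (p + a *: (q - p)) (p + b *: (q - p)) +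
  seg (p + b *: (q - p)) (p + c *: (q - p)).
Proof.
move=> ab bc; rewrite !seg_sub//; last exact: le_trans bc.
by apply: Rintegral_cut => //; exact: seg_int.
Qed.

Lemma seg_le p q M : (forall t, t \in `[0, 1] -> nrm K (p + t *: (q - p)) (q - p) <= M) ->
  seg p q <= M.
Proof.
move=> h; have -> : M = M * (1 - 0) by rewrite subr0 mulr1.
rewrite -(Rintegral_itv_cst M ler01).
by apply: le_Rintegral_itv => //; [exact: seg_int|apply: continuous_integrable => x; exact: cvg_cst].
Qed.

Lemma seg_ge p q M : (forall t, t \in `[0, 1] -> M <= nrm K (p + t *: (q - p)) (q - p)) ->
  M <= seg p q.
Proof.
move=> h; have -> : M = M * (1 - 0) by rewrite subr0 mulr1.
rewrite -(Rintegral_itv_cst M ler01).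
by apply: le_Rintegral_itv => //; [apply: continuous_integrable => x; exact: cvg_cst|exact: seg_int].
Qed.

Lemma seg_lat k n p q : seg (p + lat beta k n) (q + lat beta k n) = seg p q.
Proof.
apply: eq_Rintegral => t _; rewrite opprD addrACA subrr addr0.
by rewrite addrAC nrm_lat.
Qed.

Lemma seg_glide p q : seg (glide p) (glide q) = seg p q.
Proof.
by apply: eq_Rintegral => t _; rewrite glideB -refl2Z -glideD nrm_glide.
Qed.

Lemma seg_sym p q : seg p q = seg q p.
Proof.
have := @Rintegration_by_substitution_onem R
  (fun t : R => nrm K (p + t *: (q - p)) (q - p)) 1.
rewrite ler01 lexx onem1 /seg => /(_ isT) ->; last first.
  by apply: continuous_subspaceT; exact: nrm_line_cont.
apply: eq_Rintegral => t _ /=.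
rewrite -nrmN opprB; congr (nrm K _ _).
by apply: pair_ext; rewrite /= /onem /GRing.scale /=; ring.
Qed.

Lemma plen_ge0 p s : 0 <= plen p s.
Proof. by elim: s p => //= q s IH p; rewrite addr_ge0 ?seg_ge0. Qed.

Lemma plen_cat p s s' : plen p (s ++ s') = plen p s + plen (last p s) s'.
Proof. by elim: s p => /= [|q s IH] p; rewrite ?add0r// IH addrA. Qed.

Lemma dist_has_inf p q : has_inf [set plen p s | s in [set s | last p s = q]].
Proof.
split; first by exists (plen p [:: q]); exists [:: q].
by exists 0 => _ [s _ <-]; exact: plen_ge0.
Qed.

Lemma dist_le_plen p s : dist p (last p s) <= plen p s.
Proof. by apply: ge_inf; [case: (dist_has_inf p (last p s))|exists s]. Qed.

Lemma dist_ge0 p q : 0 <= dist p q.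
Proof.
apply: lb_le_inf; first by case: (dist_has_inf p q).
by move=> _ [s _ <-]; exact: plen_ge0.
Qed.

Lemma dist_lb p q M : (forall s, last p s = q -> M <= plen p s) -> M <= dist p q.
Proof.
move=> h; apply: lb_le_inf; first by case: (dist_has_inf p q).
by move=> _ [s sq <-]; exact: h.
Qed.

Lemma dist_approx p q e : 0 < e ->
  exists2 s, last p s = q & plen p s < dist p q + e.
Proof.
move=> e0; have [_ [s sq <-] h] := inf_adherent e0 (dist_has_inf p q).
by exists s.
Qed.

Lemma dist_seg p q : dist p q <= seg p q.
Proof. by have := dist_le_plen p [:: q]; rewrite /= addr0. Qed.

Lemma dist_refl p : dist p p = 0.
Proof. by apply/eqP; rewrite eq_le dist_ge0 andbT; exact: (dist_le_plen p [::]). Qed.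

Lemma dist_triangle q p r : dist p r <= dist p q + dist q r.
Proof.
apply/ler_addgt0Pr => e e0; have e2 : 0 < e / 2 by rewrite divr_gt0.
have [s sq sl] := dist_approx p q e2; have [s' sr sl'] := dist_approx q r e2.
have := dist_le_plen p (s ++ s'); rewrite plen_cat last_cat sq sr.
by move=> ?; lra.
Qed.

Lemma plen_map (f : R * R -> R * R) : (forall p q, seg (f p) (f q) = seg p q) ->
  forall p s, plen (f p) (map f s) = plen p s.
Proof. by move=> fi p s; elim: s p => //= q s IH p; rewrite fi IH. Qed.

Lemma dist_isom (f : R * R -> R * R) : (forall p q, seg (f p) (f q) = seg p q) ->
  forall p q, dist (f p) (f q) <= dist p q.
Proof.
move=> fi p q; apply: dist_lb => s <-.
by rewrite -last_map -(plen_map fi); exact: dist_le_plen.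
Qed.

Lemma dist_lat k n p q : dist (p + lat beta k n) (q + lat beta k n) = dist p q.
Proof.
apply/eqP; rewrite eq_le (dist_isom (f := fun p => p + lat beta k n)) ?andbT; last exact: seg_lat.
have := dist_isom (f := fun p => p + lat beta (- k) (- n)) (seg_lat (- k) (- n)) (p + lat beta k n) (q + lat beta k n).
by rewrite latN !addrK.
Qed.

Lemma dist_glide p q : dist (glide p) (glide q) = dist p q.
Proof.
apply/eqP; rewrite eq_le (dist_isom (f := glide)) ?andbT; last exact: seg_glide.
rewrite -(dist_lat 1 0 p q) lat10 -!glide_glide.
exact: (dist_isom (f := glide) seg_glide).
Qed.

Lemma plen_rev p s : plen (last p s) (rev (belast p s)) = plen p s.
Proof.
elim: s p => //= q s IH p.
by rewrite rev_cons -cats1 plen_cat IH /= addr0 addrC seg_sym; congr (seg _ _ + _);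
  case: s {IH} => //= r s; rewrite rev_cons last_rcons.
Qed.

Lemma dist_sym p q : dist p q = dist q p.
Proof.
suff h p' q' : dist p' q' <= dist q' p' by apply/eqP; rewrite eq_le !h.
apply: dist_lb => s <-; rewrite -plen_rev.
have := dist_le_plen (last q' s) (rev (belast q' s)).
suff -> : last (last q' s) (rev (belast q' s)) = q' by [].
by case: s => //= r s; rewrite rev_cons last_rcons.
Qed.

Hypothesis beta0 : 0 < beta.

Lemma dist_upper : exists2 C : R, 0 < C & forall p q, dist p q <= C * `|p - q|.
Proof.
have [C C0 CP] := nrm_upper K beta0; exists C => // p q.
by apply: le_trans (dist_seg p q) _; apply: seg_le => t _; rewrite distrC; exact: CP.
Qed.

Lemma dist_lower : exists2 c : R, 0 < c & forall p q, c * `|p - q| <= dist p q.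
Proof.
have [c c0 cP] := nrm_lower K beta0; exists c => // p q; apply: dist_lb => s <-.
elim: s p => /= [|r s IH] p; first by rewrite subrr normr0 mulr0.
have h1 : c * `|p - r| <= seg p r by apply: seg_ge => t _; rewrite distrC.
apply: le_trans (_ : c * (`|p - r| + `|r - last r s|) <= _).
  by rewrite ler_pM2l// -[X in `|X|](subrKA r) ler_normD.
by rewrite mulrDr lerD.
Qed.

Lemma dist_lip p q r : `|dist p r - dist q r| <= dist p q.
Proof.
have := dist_triangle p q r; have := dist_triangle q p r.
by rewrite (dist_sym q p) ler_norml => h1 h2; apply/andP; split; lra.
Qed.

End PolygonalDistance.

(** * Periodic continuation of curves and the universal chord theorem *)

Section Arcs.
Context {R : realType}.

Lemma continuous_min_cst (a : R) : continuous (fun x : R => Num.min x a).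
Proof. by move=> x; apply: continuous_min; [exact: cvg_id|exact: cvg_cst]. Qed.

Lemma continuous_max_cst (a : R) : continuous (fun x : R => Num.max x a).
Proof. by move=> x; apply: continuous_max; [exact: cvg_id|exact: cvg_cst]. Qed.

Lemma continuous_affine (a b : R) : continuous (fun x : R => a * x + b).
Proof.
by move=> x; apply: cvgD; [apply: cvgM; [exact: cvg_cst|exact: cvg_id]|exact: cvg_cst].
Qed.

Definition clamp (x : R) : R := Num.max (Num.min x 1) 0.

Lemma clamp_cont : continuous clamp.
Proof.
move=> x; apply: (@continuous_comp _ _ _ (fun x : R => Num.min x 1) (fun x : R => Num.max x 0)).
  exact: continuous_min_cst.
exact: continuous_max_cst.
Qed.

Lemma clamp_id x : 0 <= x -> x <= 1 -> clamp x = x.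
Proof. by move=> x0 x1; rewrite /clamp (min_idPl x1) (max_idPl x0). Qed.

Lemma clamp_le0 x : x <= 0 -> clamp x = 0.
Proof.
move=> x0; rewrite /clamp (min_idPl _) ?(max_idPr _)//; exact: le_trans ler01.
Qed.

Lemma clamp_ge1 x : 1 <= x -> clamp x = 1.
Proof. by move=> x1; rewrite /clamp (min_idPr x1) (max_idPl ler01). Qed.

Lemma clamp_itv x : 0 <= clamp x /\ clamp x <= 1.
Proof. by rewrite /clamp le_max ge_max ge_min !lexx ler01 !orbT. Qed.

Lemma clamp_mono x y : x <= y -> clamp x <= clamp y.
Proof.
move=> xy; rewrite /clamp ge_max !le_max lexx orbT andbT; apply/orP; left.
by rewrite le_min !ge_min xy lexx orbT.
Qed.

(* Values at [s] in [[0, m]] of the curve obtained from [c] restricted to     *)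
(* [[0, 1]] by concatenating its translates by the multiples of [c 1 - c 0].  *)
Fixpoint ext (c : R -> R * R) (m : nat) (s : R) : R * R :=
  if m is m'.+1 then ext c m' (Num.min s m'%:R) + (c (clamp (s - m'%:R)) - c 0)
  else c 0.

Lemma ext_cont (c : R -> R * R) m : continuous c -> continuous (ext c m).
Proof.
move=> cc; elim: m => [|m IH] s; first exact: cvg_cst.
apply: cvgD.
  by apply: (@continuous_comp _ _ _ (fun s : R => Num.min s m%:R) (ext c m)); [exact: continuous_min_cst|exact: IH].
apply: cvgB; last exact: cvg_cst.
apply: (@continuous_comp _ _ _ (fun s : R => clamp (s - m%:R)) c); last exact: cc.
apply: (@continuous_comp _ _ _ (fun s : R => s - m%:R) clamp); last exact: clamp_cont.
by apply: cvgB; [exact: cvg_id|exact: cvg_cst].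
Qed.

Lemma ext_nat_aux c V m : c 1 = c 0 + V -> ext c m m%:R = c 0 + V *+ m.
Proof.
move=> c1; elim: m => [|m IH]; first by rewrite mulr0n addr0.
have E : m.+1%:R - m%:R = 1 :> R by rewrite -natrB ?subSnn.
rewrite /= (min_idPr _) ?ler_nat// IH E clamp_id// c1.
have -> : c 0 + V - c 0 = V by rewrite addrAC subrr add0r.
by rewrite -addrA -mulrSr.
Qed.

Lemma ext_spec c V m s : c 1 = c 0 + V -> 0 <= s -> s <= m%:R ->
  exists (j : nat) (s0 : R), [/\ 0 <= s0, s0 <= 1, s = j%:R + s0 &
    ext c m s = c s0 + V *+ j].
Proof.
move=> c1 s0; elim: m => [|m IH] sm.
  exists 0%N, 0; rewrite mulr0n !addr0; split => //.
  by apply/eqP; rewrite eq_le s0 andbT.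
have [sm'|ms] := leP s m%:R.
  have [j [t [t0 t1 sE eE]]] := IH sm'; exists j, t; split => //=.
  by rewrite (min_idPl sm') clamp_le0 ?subrr ?addr0// subr_le0.
exists m, (s - m%:R); rewrite /= (min_idPr (ltW ms)) (ext_nat_aux _ c1).
rewrite clamp_id ?subr_ge0 ?(ltW ms)//; last by rewrite lerBlDr addrC natr1.
split; rewrite ?subr_ge0 ?(ltW ms)//.
- by rewrite lerBlDr addrC natr1.
- by rewrite addrCA subrr addr0.
- by rewrite [LHS]addrC [c 0 + _]addrC addrA [LHS]addrAC subrK.
Qed.

Lemma ext_nat c V m j : c 1 = c 0 + V -> (j <= m)%N -> ext c m j%:R = c 0 + V *+ j.
Proof.
move=> c1 jm; have [|i [t [t0 t1 jE ->]]] := @ext_spec c V m j%:R c1 (ler0n _ _).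
  by rewrite ler_nat.
have [/eqP ij|ij] := boolP (i == j); first by move: t0 t1 jE; rewrite ij => _ _ ?; have -> : t = 0 by lra.
have ji : j = i.+1.
  have h1 : (i <= j)%N by rewrite -(ler_nat R); lra.
  have h2 : (j <= i.+1)%N by rewrite -(ler_nat R) -natr1; lra.
  by move/eqP: ij; lia.
have -> : t = 1 by move: jE; rewrite ji -natr1; lra.
by rewrite c1 ji mulrS addrA.
Qed.

Lemma comp_fst_cont (c : R -> R * R) : continuous c -> continuous (fun s => (c s).1).
Proof. by move=> cc s; apply: continuous_comp; [exact: cc|exact: cvg_fst]. Qed.

Lemma comp_snd_cont (c : R -> R * R) : continuous c -> continuous (fun s => (c s).2).
Proof. by move=> cc s; apply: continuous_comp; [exact: cc|exact: cvg_snd]. Qed.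

(** The difference [ext c m s - s *: V] is 1-periodic in [s], hence bounded uniformly in [m]. *)
Lemma ext_near_line (c : R -> R * R) (V : R * R) : continuous c -> c 1 = c 0 + V ->
  exists2 B : R, 0 <= B & forall m (s : R), 0 <= s -> s <= m%:R -> `|ext c m s - s *: V| <= B.
Proof.
move=> cc c1.
have [|t t01 tP] := @EVT_max R (fun s => `|c s - s *: V|) 0 1 ler01.
  apply: continuous_subspaceT => s; apply: cvg_norm; apply: cvgB; first exact: cc.
  by apply: cvgZr_tmp; exact: cvg_id.
exists `|c t - t *: V| => // m s s0 sm.
have [j [r [r0 r1 -> ->]]] := ext_spec c1 s0 sm.
have -> : c r + V *+ j - (j%:R + r) *: V = c r - r *: V.
  by rewrite scalerDl scaler_nat [V *+ j + _]addrC opprD addrACA subrr addr0.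
by apply: tP; rewrite in_itv /= r0.
Qed.

(** Poincare-Miranda, applied to a base point moving from a maximum to a minimum of [b] and to the
    length of a parameter interval starting there: in the first direction the increment of [b]
    changes sign, in the second the increment of [a] passes [u]. If the interval runs beyond 1, the
    complementary chord [M - u] appears instead. *)
Lemma universal_chord (a b : R -> R) (M u : R) :
  continuous a -> continuous b -> a 1 = a 0 + M -> b 1 = b 0 -> 0 <= u <= M ->
  exists s t, [/\ 0 <= s, s <= t, t <= 1, b t = b s &
     a t = a s + u \/ a t = a s + (M - u)].
Proof.
move=> ca cb a1 b1 /andP[u0 uM].
have [s0 s01 s0P] := EVT_max ler01 (continuous_subspaceT cb).
have [s1 s11 s1P] := EVT_min ler01 (continuous_subspaceT cb).
rewrite !in_itv /= in s01 s11.
(* [cl f] continues [f] to [[0, 2]] by repeating it, shifted by its increment [f 1 - f 0]. *)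
pose cl (f : R -> R) (x : R) := f (clamp x) + f (clamp (x - 1)) - f 0.
have ccl f : continuous f -> continuous (cl f).
  move=> cf x; apply: cvgB; last exact: cvg_cst.
  apply: cvgD; first by apply: (@continuous_comp _ _ _ clamp f); [exact: clamp_cont|exact: cf].
  apply: (@continuous_comp _ _ _ (fun x : R => clamp (x - 1)) f); last exact: cf.
  apply: (@continuous_comp _ _ _ (fun x : R => x - 1) clamp); last exact: clamp_cont.
  by apply: cvgB; [exact: cvg_id|exact: cvg_cst].
have cl1 f x : 0 <= x -> x <= 1 -> cl f x = f x.
  by move=> x0 x1; rewrite /cl clamp_id// clamp_le0 ?addrK// subr_le0.
have cl2 f x : 1 <= x -> x <= 2 -> cl f x = f (x - 1) + (f 1 - f 0).
  move=> x1 x2; rewrite /cl clamp_ge1// clamp_id ?subr_ge0//; last lra.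
  by rewrite addrAC addrC.
pose S (z : R * R) : R := s0 + z.1 * (s1 - s0).
have cS : continuous S.
  move=> z; apply: cvgD; first exact: cvg_cst.
  by apply: cvgM; [exact: cvg_fst|exact: cvg_cst].
have S01 z : z.1 \in `[0, 1] -> 0 <= S z /\ S z <= 1.
  rewrite in_itv /= => /andP[z0 z1]; rewrite /S.
  have := mulr_ge0 z0 (ltac:(lra) : 0 <= s1); have := mulr_ge0 z0 (ltac:(lra) : 0 <= 1 - s1).
  have := mulr_ge0 (ltac:(lra) : 0 <= 1 - z.1) (ltac:(lra) : 0 <= s0).
  have := mulr_ge0 (ltac:(lra) : 0 <= 1 - z.1) (ltac:(lra) : 0 <= 1 - s0).
  by move=> *; split; lra.
have clb x : 0 <= x -> x <= 2 -> exists2 y, y \in `[0, 1] & cl b x = b y.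
  move=> x0 x2; have [x1|x1] := leP x 1.
    by exists x; [rewrite in_itv /= x0|rewrite cl1].
  exists (x - 1); first by rewrite in_itv /=; apply/andP; split; lra.
  by rewrite cl2 ?(ltW x1)// b1 subrr addr0.
pose F (z : R * R) := cl b (S z + z.2) - cl b (S z).
pose G (z : R * R) := cl a (S z + z.2) - cl a (S z) - u.
have cSr : continuous (fun z : R * R => S z + z.2).
  by move=> z; apply: cvgD; [exact: cS|exact: cvg_snd].
have cF : continuous F.
  move=> z; apply: cvgB.
    by apply: (@continuous_comp _ _ _ (fun z : R * R => S z + z.2) (cl b)); [exact: cSr|exact: ccl].
  by apply: (@continuous_comp _ _ _ S (cl b)); [exact: cS|exact: ccl].
have cG : continuous G.
  move=> z; apply: cvgB; last exact: cvg_cst; apply: cvgB.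
    by apply: (@continuous_comp _ _ _ (fun z : R * R => S z + z.2) (cl a)); [exact: cSr|exact: ccl].
  by apply: (@continuous_comp _ _ _ S (cl a)); [exact: cS|exact: ccl].
have S0 t : S (0, t) = s0 by rewrite /S /= mul0r addr0.
have S1 t : S (1, t) = s1 by rewrite /S /= mul1r addrC subrK.
have [t|t|t|t|z [z1 z2 Fz Gz]] := poincare_miranda cF cG.
- rewrite in_itv /= /F S0 /= => /andP[t0 t1].
  have [||y y01 ->] := clb (s0 + t); [lra|lra|].
  by rewrite cl1; [rewrite subr_le0 s0P|lra|lra].
- rewrite in_itv /= /F S1 /= => /andP[t0 t1].
  have [||y y01 ->] := clb (s1 + t); [lra|lra|].
  by rewrite cl1; [rewrite subr_ge0 s1P|lra|lra].
- by move=> _; rewrite /G /= addr0 subrr sub0r oppr_le0.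
- move=> t01; rewrite /G /=; have [h1 h2] := S01 (t, 1) t01.
  rewrite cl2; [|lra|lra]; rewrite cl1// addrK a1; lra.
have [h1 h2] := S01 z z1; move: z2; rewrite in_itv /= => /andP[r0 r1].
move: Fz Gz; rewrite /F /G !(cl1 _ (S z))//.
have [le1|gt1] := leP (S z + z.2) 1.
  rewrite !cl1; [|lra|lra|lra|lra] => Fz Gz.
  by exists (S z), (S z + z.2); split; [|lra|lra|lra|left; lra].
rewrite !cl2; [|lra|lra|lra|lra] => Fz Gz.
by exists (S z + z.2 - 1), (S z); split; [lra|lra| |lra|right; lra].
Qed.

End Arcs.

(** * Cutting and regluing almost minimizing curves *)

Section NearGeodesics.
Context {R : realType}.
Variable beta : R.
Variable K : kform beta.
Local Notation d := (dist K).

(* [l] plays the part of arc length along [c]. *)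
Definition arc (c : R -> R * R) (l : R -> R) : Prop := continuous c /\
  forall x y, 0 <= x -> x <= y -> y <= 1 -> d (c x) (c y) <= l y - l x.

Lemma seg_arc p q : exists c l,
  [/\ arc c l, c 0 = p, c 1 = q & l 1 - l 0 = seg K p q].
Proof.
exists (fun t : R => p + t *: (q - p)), (fun t : R => seg K (p + 0 *: (q - p)) (p + t *: (q - p))).
split.
- split; first exact: line_cont.
  move=> x y x0 xy y1; rewrite (seg_split K p q x0 xy) addrAC subrr add0r.
  exact: dist_seg.
- by rewrite scale0r addr0.
- by rewrite scale1r addrC subrK.
- rewrite -segE (_ : seg K (p + 0 *: _) (p + 0 *: _) = 0) ?subr0//.
  have := seg_split K p q (lexx 0) (lexx 0); lra.
Qed.

Lemma arc_cat c1 l1 c2 l2 : arc c1 l1 -> arc c2 l2 -> c1 1 = c2 0 ->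
  exists c l, [/\ arc c l, c 0 = c1 0, c 1 = c2 1 &
    l 1 - l 0 = (l1 1 - l1 0) + (l2 1 - l2 0)].
Proof.
move=> [cc1 h1] [cc2 h2] e.
pose f (t : R) := clamp (2 * t + 0); pose g (t : R) := clamp (2 * t + (-1)).
have cf : continuous f.
  move=> t; apply: (@continuous_comp _ _ _ (fun t : R => 2 * t + 0) clamp);
    [exact: continuous_affine|exact: clamp_cont].
have cg : continuous g.
  move=> t; apply: (@continuous_comp _ _ _ (fun t : R => 2 * t + (-1)) clamp);
    [exact: continuous_affine|exact: clamp_cont].
have f0 : f 0 = 0 by rewrite /f clamp_le0; lra.
have f1 : f 1 = 1 by rewrite /f clamp_ge1; lra.
have g0 : g 0 = 0 by rewrite /g clamp_le0; lra.
have g1 : g 1 = 1 by rewrite /g clamp_id; lra.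
have fm x y : x <= y -> f x <= f y by move=> xy; apply: clamp_mono; lra.
have gm x y : x <= y -> g x <= g y by move=> xy; apply: clamp_mono; lra.
have fi x : 0 <= f x /\ f x <= 1 by exact: clamp_itv.
have gi x : 0 <= g x /\ g x <= 1 by exact: clamp_itv.
(* The second arc starts moving only when the first one has stopped. *)
have fg x : f x = 1 \/ g x = 0.
  have [x2|x2] := leP 1 (2 * x); first by left; rewrite /f clamp_ge1; lra.
  by right; rewrite /g clamp_le0; lra.
pose c t := c1 (f t) + (c2 (g t) - c1 1).
pose l t := l1 (f t) + l2 (g t).
have cl x : f x = 1 -> c x = c2 (g x) by rewrite /c => ->; rewrite addrC subrK.
have cr x : g x = 0 -> c x = c1 (f x) by rewrite /c => ->; rewrite e subrr addr0.
exists c, l; split.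
- split.
    move=> t; apply: cvgD.
      by apply: (@continuous_comp _ _ _ f c1); [exact: cf|exact: cc1].
    apply: cvgB; last exact: cvg_cst.
    by apply: (@continuous_comp _ _ _ g c2); [exact: cg|exact: cc2].
  move=> x y x0 xy y1; have [fx0 fx1] := fi x; have [gx0 gx1] := gi x.
  have [fy0 fy1] := fi y; have [gy0 gy1] := gi y.
  have [fx|gx] := fg x.
    have fy : f y = 1 by apply/eqP; rewrite eq_le fy1 -fx fm.
    rewrite !cl// /l fx fy; have := h2 _ _ gx0 (gm _ _ xy) gy1; lra.
  rewrite (cr x gx); have [fy|gy] := fg y.
    rewrite (cl y fy); apply: le_trans (dist_triangle K (c1 1) _ _) _.
    rewrite {2}e /l fy gx.
    have := h1 _ _ fx0 fx1 (lexx 1); have := h2 _ _ (lexx 0) gy0 gy1; lra.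
  rewrite (cr y gy) /l gx gy; have := h1 _ _ fx0 (fm _ _ xy) fy1; lra.
- by rewrite cr ?f0.
- by rewrite cl ?g1.
- by rewrite /l f0 f1 g0 g1; lra.
Qed.

Lemma near_geodesic p q e : 0 < e -> exists c l,
  [/\ arc c l, c 0 = p, c 1 = q & l 1 - l 0 < d p q + e].
Proof.
move=> e0; have [s sq sl] := dist_approx K p q e0.
have [c [l [cl c0 c1 ll]]] : exists c l, [/\ arc c l, c 0 = p, c 1 = q & l 1 - l 0 = plen K p s].
  elim: s p sq {sl} => [|r s IH] p sq.
    move: sq => /= <-; exists (fun=> p), (fun=> 0); split; rewrite ?subrr//.
    by split; [move=> t; exact: cvg_cst|move=> *; rewrite dist_refl subrr].
  have [c2 [l2 [a2 c20 c21 ll2]]] := IH r sq.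
  have [c1 [l1 [a1 c10 c11 ll1]]] := seg_arc p r.
  have [|c [l [a c0 c1' ll]]] := arc_cat a1 a2; first by rewrite c11 c20.
  by exists c, l; split; rewrite ?c0 ?c1'// ll ll1 ll2.
by exists c, l; split; rewrite ?ll.
Qed.

Section Closed.
Variables (c : R -> R * R) (l : R -> R).
Hypothesis cl : arc c l.
Let dl := cl.2.

Lemma arc_three x y : 0 <= x -> x <= y -> y <= 1 ->
  d (c 0) (c x) + d (c x) (c y) + d (c y) (c 1) <= l 1 - l 0.
Proof.
move=> x0 xy y1; have := dl (lexx 0) x0 (le_trans xy y1); have := dl x0 xy y1.
by have := dl (le_trans x0 xy) y1 (lexx 1); lra.
Qed.

(** The closed curve is started at [c x] instead of [c 0]: run to the end [c 1], then along the
    translate of the initial piece. *)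
Lemma arc_shift k n x : c 1 = c 0 + lat beta k n -> 0 <= x -> x <= 1 ->
  d (c x) (c x + lat beta k n) <= l 1 - l 0.
Proof.
move=> c1 x0 x1; apply: le_trans (dist_triangle K (c 1) _ _) _.
rewrite {2}c1 dist_lat; have := dl (lexx 0) x0 x1; have := dl x0 x1 (lexx 1); lra.
Qed.
End Closed.

Lemma fst_addMn (p V : R * R) n : (p + V *+ n).1 = p.1 + V.1 *+ n.
Proof. by congr (_ + _); elim: n => // n IH; rewrite !mulrS /= IH. Qed.

Lemma snd_addMn (p V : R * R) n : (p + V *+ n).2 = p.2 + V.2 *+ n.
Proof. by congr (_ + _); elim: n => // n IH; rewrite !mulrS /= IH. Qed.

(** By strong induction. Since [V] lies along an axis, [universal_chord] gives an almost minimizing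
    curve of class [n.+2] a chord equal to [V] or to [n.+1] times [V]. The piece above the chord has
    class [j]; the two remaining pieces, one of them translated, form a curve of class [k], with
    [j + k = n.+2] and both smaller. *)
Lemma mul_le_dist (V : R * R) (L : R) :
  (0 < V.1 /\ V.2 = 0) \/ (V.1 = 0 /\ 0 < V.2) ->
  (forall n p q, d (p + V *+ n) (q + V *+ n) = d p q) ->
  (forall p, L <= d p (p + V)) ->
  forall n p, n%:R * L <= d p (p + V *+ n).
Proof.
move=> V12 dV LV; elim/ltn_ind => -[|[|n]] IH p.
- by rewrite mul0r dist_ge0.
- by rewrite mul1r mulr1n.
apply/ler_addgt0Pr => e e0.
have [c [l [cl c0 c1 ll]]] := near_geodesic p (p + V *+ n.+2) e0.
suff [s [t [s0 st t1 [j [k [jn kn njk ct]]]]]] : exists s t, [/\ 0 <= s, s <= t, t <= 1 &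
    exists j k, [/\ (j < n.+2)%N, (k < n.+2)%N, (n.+2 = j + k)%N & c t = c s + V *+ j]].
  have A := arc_three cl s0 st t1.
  have B : d (c s) (c s + V *+ k) <= d (c 0) (c s) + d (c t) (c 1).
    rewrite ct c1 njk mulrnDr -c0 [V *+ j + _]addrC addrA dV.
    rewrite -(dV k (c 0) (c s)) [leRHS]addrC; exact: dist_triangle.
  have C := IH j jn (c s); have D := IH k kn (c s).
  have -> : n.+2%:R * L = j%:R * L + k%:R * L by rewrite njk natrD mulrDl.
  by rewrite ct in A B; lra.
have cV : c 1 = c 0 + V *+ n.+2 by rewrite c1 c0.
have nV x : x *+ n.+2 - x = x *+ n.+1 :> R by rewrite mulrSr addrK.
case: V12 => -[V1 V2].
- have [|||s [t [s0 st t1 bt at']]] := @universal_chord R (fun s => (c s).1) (fun s => (c s).2) (V.1 *+ n.+2) V.1 (comp_fst_cont cl.1) (comp_snd_cont cl.1).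
  + by rewrite cV fst_addMn.
  + by rewrite cV snd_addMn V2 mul0rn addr0.
  + by rewrite ltW//= mulrSr lerDr mulrn_wge0// ltW.
  exists s, t; split=> //; case: at' => at'.
  + exists 1%N, n.+1; rewrite addSn add0n; split => //.
    by apply: pair_ext; rewrite ?fst_addMn ?snd_addMn ?V2 ?mulr1n ?addr0.
  + exists n.+1, 1%N; rewrite addn1; split => //.
    by apply: pair_ext; rewrite ?fst_addMn ?snd_addMn ?at' ?nV// bt V2 mul0rn addr0.
- have [|||s [t [s0 st t1 bt at']]] := @universal_chord R (fun s => (c s).2) (fun s => (c s).1) (V.2 *+ n.+2) V.2 (comp_snd_cont cl.1) (comp_fst_cont cl.1).
  + by rewrite cV snd_addMn.
  + by rewrite cV fst_addMn V1 mul0rn addr0.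
  + by rewrite ltW//= mulrSr lerDr mulrn_wge0// ltW.
  exists s, t; split=> //; case: at' => at'.
  + exists 1%N, n.+1; rewrite addSn add0n; split => //.
    by apply: pair_ext; rewrite ?fst_addMn ?snd_addMn ?V1 ?mulr1n ?addr0.
  + exists n.+1, 1%N; rewrite addn1; split => //.
    by apply: pair_ext; rewrite ?fst_addMn ?snd_addMn ?at' ?nV// bt V1 mul0rn addr0.
Qed.

Lemma latMn k n m : lat beta k n *+ m = lat beta (k *+ m) (n *+ m).
Proof. by elim: m => [|m IH]; rewrite ?mulr0n ?lat00// !mulrS latD IH. Qed.

Hypothesis beta0 : 0 < beta.

Lemma refl2_lat k n : refl2 (lat beta k n) = lat beta k (- n).
Proof. by apply: pair_ext; rewrite /= ?intrN ?mulrN. Qed.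

(* A curve from [p] to [p + lat k n] and its image under the glide reflection *)
(* meet modulo the lattice: both are close to lines of independent directions.*)
Lemma mirror_meet (k n : int) (p : R * R) (lam : R) : k != 0 -> n != 0 -> d p (p + lat beta k n) < lam ->
  exists z, d z (z + lat beta k n) <= lam /\ d z (z + lat beta k (- n)) <= lam.
Proof.
move=> k0 n0 dl.
have e0 : 0 < lam - d p (p + lat beta k n) by rewrite subr_gt0.
have [c [l [cl c0 c1 ll']]] := near_geodesic p (p + lat beta k n) e0.
have {ll'} ll : l 1 - l 0 <= lam by lra.
pose V := lat beta k n.
have cV : c 1 = c 0 + V by rewrite c1 c0.
have [B B0 BP] := ext_near_line cl.1 cV.
(* After [M] repetitions the drift along the lines outweighs both the deviation [B] from them and
   the shift [pi] of the glide reflection. *)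
pose M := (Num.trunc (2 * B / beta + (2 * B + pi) / pi)).+1.
have [M1 M2] : 2 * B <= beta * M%:R /\ 2 * B + pi <= pi * M%:R.
  have := ltW (truncnS_gt (2 * B / beta + (2 * B + pi) / pi)); rewrite -/M => h.
  have p0 := pi_gt0 R.
  have h1 : 0 <= 2 * B / beta by apply: divr_ge0; [rewrite mulr_ge0|exact: ltW].
  have h2 : 0 <= (2 * B + pi) / pi by apply: divr_ge0; [rewrite addr_ge0 ?mulr_ge0 ?(ltW p0)|exact: ltW].
  split; [rewrite [beta * _]mulrC|rewrite [pi * _]mulrC]; rewrite -ler_pdivrMr//; lra.
(* Rotated parameters decouple the two equations: the horizontal one is driven by
   [s - t = M (z.1 - 1/2)], the vertical one by [s + t - M = M (z.2 - 1/2)]. *)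
pose s (z : R * R) : R := M%:R / 2 * (z.1 + z.2).
pose t (z : R * R) : R := M%:R / 2 * (z.2 + 1 - z.1).
have M0 : 0 <= M%:R :> R by [].
have s01 z : z.1 \in `[0, 1] -> z.2 \in `[0, 1] -> 0 <= s z /\ s z <= M%:R.
  rewrite !in_itv /= /s => /andP[? ?] /andP[? ?].
  have : 0 <= M%:R * (z.1 + z.2) by apply: mulr_ge0; lra.
  have : 0 <= M%:R * (2 - (z.1 + z.2)) by apply: mulr_ge0; lra.
  by move=> *; split; lra.
have t01 z : z.1 \in `[0, 1] -> z.2 \in `[0, 1] -> 0 <= t z /\ t z <= M%:R.
  rewrite !in_itv /= /t => /andP[? ?] /andP[? ?].
  have : 0 <= M%:R * (z.2 + 1 - z.1) by apply: mulr_ge0; lra.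
  have : 0 <= M%:R * (1 + z.1 - z.2) by apply: mulr_ge0; lra.
  by move=> *; split; lra.
have cs : continuous s.
  by move=> z; apply: cvgM; [exact: cvg_cst|apply: cvgD; [exact: cvg_fst|exact: cvg_snd]].
have ct : continuous t.
  move=> z; apply: cvgM; first exact: cvg_cst.
  by apply: cvgB; [apply: cvgD; [exact: cvg_snd|exact: cvg_cst]|exact: cvg_fst].
have ce := @ext_cont _ c M cl.1.
pose a := ext c M.
have X z : z.1 \in `[0, 1] -> z.2 \in `[0, 1] -> `|(a (s z)).1 - s z * V.1| <= B.
  move=> z1 z2; have [h1 h2] := s01 z z1 z2.
  by apply: le_trans (coord_le_norm (a (s z) - s z *: V)).1 _; exact: BP.
have X' z : z.1 \in `[0, 1] -> z.2 \in `[0, 1] -> `|(a (t z)).1 - t z * V.1| <= B.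
  move=> z1 z2; have [h1 h2] := t01 z z1 z2.
  by apply: le_trans (coord_le_norm (a (t z) - t z *: V)).1 _; exact: BP.
have Y z : z.1 \in `[0, 1] -> z.2 \in `[0, 1] -> `|(a (s z)).2 - s z * V.2| <= B.
  move=> z1 z2; have [h1 h2] := s01 z z1 z2.
  by apply: le_trans (coord_le_norm (a (s z) - s z *: V)).2 _; exact: BP.
have Y' z : z.1 \in `[0, 1] -> z.2 \in `[0, 1] -> `|(a (t z)).2 - t z * V.2| <= B.
  move=> z1 z2; have [h1 h2] := t01 z z1 z2.
  by apply: le_trans (coord_le_norm (a (t z) - t z *: V)).2 _; exact: BP.
pose F0 (z : R * R) := (a (s z)).1 - (a (t z)).1 - pi.
pose G0 (z : R * R) := (a (s z)).2 + (a (t z)).2 - M%:R * V.2.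
have cas : continuous (a \o s) by move=> z; apply: continuous_comp; [exact: cs|exact: ce].
have cat : continuous (a \o t) by move=> z; apply: continuous_comp; [exact: ct|exact: ce].
have cF0 : continuous F0.
  move=> z; apply: cvgB; last exact: cvg_cst; apply: cvgB.
    by apply: (@continuous_comp _ _ _ (a \o s) fst); [exact: cas|exact: cvg_fst].
  by apply: (@continuous_comp _ _ _ (a \o t) fst); [exact: cat|exact: cvg_fst].
have cG0 : continuous G0.
  move=> z; apply: cvgB; last exact: cvg_cst; apply: cvgD.
    by apply: (@continuous_comp _ _ _ (a \o s) snd); [exact: cas|exact: cvg_snd].
  by apply: (@continuous_comp _ _ _ (a \o t) snd); [exact: cat|exact: cvg_snd].
(* As [k] and [n] may be negative, the two equations are multiplied by their signs to obtain the
   right signs on the boundary of the square. *)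
have sgn_mul (e : int) (x : R) : e != 0 -> 0 < x -> exists2 u : R, `|u| = 1 & x <= u * (x * e%:~R).
  move=> en0 x0; exists (Num.sg e%:~R); first by rewrite normr_sg intr_eq0 en0.
  rewrite mulrCA -normrEsg ler_peMr ?(ltW x0)// -intr_norm -[1]/(1%:~R) ler_int.
  by rewrite -gtz0_ge1 normr_gt0.
have p0 := pi_gt0 R.
have pp : 0 < 2 * pi :> R by rewrite mulr_gt0.
have pin : `|pi| <= pi :> R by rewrite (ger0_norm (ltW p0)).
have bb : 0 < 2 * beta by rewrite mulr_gt0.
have [u u1 uP] := sgn_mul k (2 * pi) k0 pp.
have [w w1 wP] := sgn_mul n (2 * beta) n0 bb.
have uw1 (v x y : R) : `|v| = 1 -> `|x| <= y -> - y <= v * x /\ v * x <= y.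
  move=> v1 xy; have : `|v * x| <= y by rewrite normrM v1 mul1r.
  by rewrite ler_norml => /andP.
have Q (x : R) : M%:R * x = x * M%:R by rewrite mulrC.
have o0 : (0 : R) \in `[0, 1] by rewrite in_itv /= lexx ler01.
have o1 : (1 : R) \in `[0, 1] by rewrite in_itv /= lexx ler01.
have [||y yi|y yi|x xi|x xi|z [z1 z2 Fz Gz]] := @poincare_miranda R (fun z => u * F0 z) (fun z => w * G0 z).
- by move=> z; apply: cvgM; [exact: cvg_cst|exact: cF0].
- by move=> z; apply: cvgM; [exact: cvg_cst|exact: cG0].
- have [_ h1] := uw1 _ _ _ u1 (X (0, y) o0 yi); have [h2 _] := uw1 _ _ _ u1 (X' (0, y) o0 yi).
  have [h3 _] := uw1 u pi pi u1 pin.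
  rewrite -[u * _]/(u * ((a (s (0, y))).1 - (a (t (0, y))).1 - pi)).
  have : M%:R / 2 * (2 * pi) <= M%:R / 2 * (u * V.1) by rewrite ler_wpM2l ?divr_ge0.
  move: h1 h2 {X X' Y Y' uw1}; rewrite /s /t /=; lra.
- have [h1 _] := uw1 _ _ _ u1 (X (1, y) o1 yi); have [_ h2] := uw1 _ _ _ u1 (X' (1, y) o1 yi).
  have [_ h3] := uw1 u pi pi u1 pin.
  rewrite -[u * _]/(u * ((a (s (1, y))).1 - (a (t (1, y))).1 - pi)).
  have : M%:R / 2 * (2 * pi) <= M%:R / 2 * (u * V.1) by rewrite ler_wpM2l ?divr_ge0.
  move: h1 h2 {X X' Y Y' uw1}; rewrite /s /t /=; lra.
- have [_ h1] := uw1 _ _ _ w1 (Y (x, 0) xi o0); have [_ h2] := uw1 _ _ _ w1 (Y' (x, 0) xi o0).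
  rewrite -[w * _]/(w * ((a (s (x, 0))).2 + (a (t (x, 0))).2 - M%:R * V.2)).
  have : M%:R / 2 * (2 * beta) <= M%:R / 2 * (w * V.2) by rewrite ler_wpM2l ?divr_ge0.
  move: h1 h2 {X X' Y Y' uw1}; rewrite /s /t /=; lra.
- have [h1 _] := uw1 _ _ _ w1 (Y (x, 1) xi o1); have [h2 _] := uw1 _ _ _ w1 (Y' (x, 1) xi o1).
  rewrite -[w * _]/(w * ((a (s (x, 1))).2 + (a (t (x, 1))).2 - M%:R * V.2)).
  have : M%:R / 2 * (2 * beta) <= M%:R / 2 * (w * V.2) by rewrite ler_wpM2l ?divr_ge0.
  move: h1 h2 {X X' Y Y' uw1}; rewrite /s /t /=; lra.
have un0 (v x : R) : `|v| = 1 -> v * x = 0 -> x = 0.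
  move=> v1 /eqP; rewrite mulf_eq0 => /orP[/eqP v0|/eqP//].
  by move: v1; rewrite v0 normr0 => /esym/eqP; rewrite oner_eq0.
have {Fz} Fz := un0 _ _ u1 Fz; have {Gz} Gz := un0 _ _ w1 Gz.
have [h1 h2] := s01 z z1 z2; have [h3 h4] := t01 z z1 z2.
have [i [r [r0 r1 _ ar]]] := ext_spec cV h1 h2.
have [j [r' [r'0 r'1 _ ar']]] := ext_spec cV h3 h4.
have E : c r = glide (c r') + lat beta (k *+ j - k *+ i) (n *+ M - n *+ j - n *+ i).
  have E1 : a (s z) = glide (a (t z)) + lat beta 0 (n *+ M).
    apply: pair_ext; first by move: Fz; rewrite /F0 /lat /=; lra.
    have nM : (n *+ M)%:~R = n%:~R * M%:R :> R by rewrite rmorphMn /= -mulr_natr.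
    by move: Gz; rewrite /G0 /V /lat /= nM; lra.
  move: E1; rewrite /a ar ar' /V !latMn glideD refl2_lat => E1.
  rewrite -[LHS](addrK (lat beta (k *+ i) (n *+ i))) E1 -!addrA -latN -!latD.
  by apply: (congr1 (fun v => glide (c r') + v)); apply: congr2; ring.
exists (c r); split; first by apply: le_trans ll; exact: (arc_shift cl cV r0 r1).
rewrite E [glide _ + _ + _]addrAC dist_lat -refl2_lat -glideD dist_glide.
by apply: le_trans ll; exact: (arc_shift cl cV r'0 r'1).
Qed.

End NearGeodesics.

(** * Calibrations and the systolic inequality *)

Section Calibration.
Context {R : realType}.
Variable beta : R.
Hypothesis beta0 : 0 < beta.
Variable K : kform beta.
Local Notation d := (dist K).
Local Notation lat := (lat beta).

Lemma dist_latN (k n : int) p : exists q, d p (p + lat (- k) (- n)) = d q (q + lat k n).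
Proof.
by exists (p + lat (- k) (- n)); rewrite dist_sym -addrA -latD !addNr lat00 addr0.
Qed.

(** For multiples of [hvec] this is [mul_le_dist]. Otherwise [mirror_meet] provides a point whose
    displacements in the classes [(k, n)] and [(k, - n)] both cost at most slightly more than
    [d p (p + lat k n)], and these compose to [2 k] times [hvec]. *)
Lemma le_dist_lat_h (L : R) : (forall p, L <= d p (p + hvec)) ->
  forall k n p, `|k|%:~R * L <= d p (p + lat k n).
Proof.
move=> LH.
have H1 (m : nat) p : m%:R * L <= d p (p + lat m 0).
  have <- : hvec *+ m = lat m 0 by rewrite -(lat10 beta) latMn mul0rn natz.
  apply: mul_le_dist => //; first by left; rewrite /= mulr_gt0// pi_gt0.
  by move=> n p' q'; rewrite -(lat10 beta) latMn dist_lat.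
have H2 (k : int) p : `|k|%:~R * L <= d p (p + lat k 0).
  case: k => m; first by rewrite -pmulrn; exact: H1.
  rewrite NegzE normrN -pmulrn -[X in lat _ X]oppr0.
  by have [q ->] := dist_latN m.+1 0 p; exact: H1.
move=> k n p; have [->|n0] := eqVneq n 0; first exact: H2.
have [->|k0] := eqVneq k 0; first by rewrite normr0 mul0r dist_ge0.
apply/ler_addgt0Pr => e e0.
have [|z [z1 z2]] := mirror_meet beta0 k0 n0 (_ : d p (p + lat k n) < d p (p + lat k n) + e).
  by rewrite ltrDl.
have := H2 (2 * k) z.
have E : z + lat (2 * k) 0 = z + lat k n + lat k (- n).
  by rewrite -addrA -latD subrr (_ : 2 * k = k + k)//; ring.
rewrite E normrM intrM -mulrA => h.
have h' : d z (z + lat k n + lat k (- n)) <= d z (z + lat k n) + d z (z + lat k (- n)).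
  apply: le_trans (dist_triangle K (z + lat k n) _ _) _.
  by rewrite lerD2l [z + lat k n + _]addrAC dist_lat.
move: h; rewrite -[`|2|%:~R]/(2 : R); lra.
Qed.

(** As for [hvec], except that the second of the two loops is reversed, so that they compose to
    [2 n] times [tvec]. *)
Lemma le_dist_lat_t (l : R) : (forall p, l <= d p (p + tvec beta)) ->
  forall k n p, `|n|%:~R * l <= d p (p + lat k n).
Proof.
move=> LT.
have H1 (m : nat) p : m%:R * l <= d p (p + lat 0 m).
  have <- : tvec beta *+ m = lat 0 m by rewrite -(lat01 beta) latMn mul0rn natz.
  apply: mul_le_dist => //; first by right; rewrite /= mulr_gt0.
  by move=> n p' q'; rewrite -(lat01 beta) latMn dist_lat.
have H2 (n : int) p : `|n|%:~R * l <= d p (p + lat 0 n).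
  case: n => m; first by rewrite -pmulrn; exact: H1.
  rewrite NegzE normrN -pmulrn -[X in lat X _]oppr0.
  by have [q ->] := dist_latN 0 m.+1 p; exact: H1.
move=> k n p; have [->|k0] := eqVneq k 0; first exact: H2.
have [->|n0] := eqVneq n 0; first by rewrite normr0 mul0r dist_ge0.
apply/ler_addgt0Pr => e e0.
have [|z [z1 z2]] := mirror_meet beta0 k0 n0 (_ : d p (p + lat k n) < d p (p + lat k n) + e).
  by rewrite ltrDl.
have := H2 (2 * n) z.
have E : z + lat 0 (2 * n) = z + lat k n - lat k (- n).
  by rewrite -addrA -latB subrr opprK (_ : 2 * n = n + n)//; ring.
rewrite E normrM intrM -mulrA => h.
have h' : d z (z + lat k n - lat k (- n)) <= d z (z + lat k n) + d z (z + lat k (- n)).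
  apply: le_trans (dist_triangle K (z + lat k n) _ _) _.
  rewrite lerD2l dist_sym -latN.
  rewrite -(dist_lat K k (- n) _ (z + lat k n)) latN addrNK [z + _ + _]addrAC.
  by rewrite -(dist_lat K k n z).
move: h; rewrite -[`|2|%:~R]/(2 : R); lra.
Qed.

(** The McShane extension of the function [k A + n B] from the lattice to the plane: the hypothesis
    says that this function is 1-Lipschitz there, which makes the infimum finite, and an infimum of
    1-Lipschitz functions is 1-Lipschitz. *)
Lemma calibration (A B : R) :
  (forall k n p, `|k%:~R * A + n%:~R * B| <= d p (p + lat k n)) ->
  exists u : R * R -> R, [/\ forall p, u (p + hvec) = u p + A,
    forall p, u (p + tvec beta) = u p + B & forall p q, `|u p - u q| <= d p q].
Proof.
move=> AB.
pose S p := [set r | exists k n, r = d p (lat k n) + (k%:~R * A + n%:~R * B)].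
have hS p : has_inf (S p).
  split; first by exists (d p (lat 0 0) + (0%:~R * A + 0%:~R * B)); exists 0, 0.
  exists (- d 0 p) => _ [k [n ->]].
  have := AB k n 0; rewrite add0r ler_norml => /andP[+ _].
  have := dist_triangle K p 0 (lat k n); lra.
have lbS p r : S p r -> inf (S p) <= r.
  by move=> Sr; apply: ge_inf => //; case: (hS p).
have geS p (x : R) : (forall r, S p r -> x <= r) -> x <= inf (S p).
  by move=> h; apply: lb_le_inf => //; case: (hS p).
have sh p k n : inf (S (p + lat k n)) = inf (S p) + (k%:~R * A + n%:~R * B).
  apply/eqP; rewrite eq_le; apply/andP; split.
    rewrite -lerBlDr; apply: geS => _ [k' [n' ->]]; rewrite lerBlDr.
    apply: lbS; exists (k' + k), (n' + n).
    by rewrite latD dist_lat !intrD; ring.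
  apply: geS => _ [k' [n' ->]]; rewrite -lerBrDr.
  apply: lbS; exists (k' - k), (n' - n).
  rewrite -(dist_lat K k n p) -latD !subrK !intrB; ring.
exists (fun p => inf (S p)); split.
- by move=> p; rewrite -(lat10 beta) sh; ring.
- by move=> p; rewrite -(lat01 beta) sh; ring.
have h p q : inf (S p) - inf (S q) <= d p q.
  rewrite lerBlDr addrC -lerBlDr; apply: geS => _ [k [n ->]]; rewrite lerBlDr.
  have := lbS p _ (ex_intro _ k (ex_intro _ n erefl)).
  by have := dist_triangle K q p (lat k n); lra.
move=> p q; rewrite ler_norml; apply/andP; split; last exact: h.
by rewrite lerNl opprB dist_sym.
Qed.

Lemma calibration_h (L : R) : (forall p, L <= d p (p + hvec)) -> 0 <= L ->
  exists u : R * R -> R, [/\ forall p, u (p + hvec) = u p + L,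
    forall p, u (p + tvec beta) = u p & forall p q, `|u p - u q| <= d p q].
Proof.
move=> LH L0; have [k n p|u [u1 u2 u3]] := @calibration L 0.
  by rewrite mulr0 addr0 normrM (ger0_norm L0) -intr_norm; exact: le_dist_lat_h.
by exists u; split => // p; rewrite u2 addr0.
Qed.

Lemma calibration_t (l : R) : (forall p, l <= d p (p + tvec beta)) -> 0 <= l ->
  exists u : R * R -> R, [/\ forall p, u (p + hvec) = u p,
    forall p, u (p + tvec beta) = u p + l & forall p q, `|u p - u q| <= d p q].
Proof.
move=> LT l0; have [k n p|u [u1 u2 u3]] := @calibration 0 l.
  by rewrite mulr0 add0r normrM (ger0_norm l0) -intr_norm; exact: le_dist_lat_t.
by exists u; split => // p; rewrite u1 addr0.
Qed.

End Calibration.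

(** * Discrete Stokes formula and block averages *)

Section DiscreteStokes.
Context {R : realType}.

Lemma telescope_ordN (V : zmodType) n (f : nat -> V) :
  \sum_(j < n) (f j - f j.+1) = f 0%N - f n.
Proof.
by rewrite -[RHS]opprB -(telescope_ord n f) -sumrN; apply: eq_bigr => j _; rewrite opprB.
Qed.

(* The cup product of the discrete 1-cochains dW and dU, summed over a        *)
(* [n] x [m] torus on which W has periods (L, 0) and U has periods (0, l).    *)
Lemma discrete_stokes (n m : nat) (W U : nat -> nat -> R) (L l : R) :
  (forall j, W n j = W 0%N j + L) -> (forall i, W i m = W i 0%N) ->
  (forall j, U n j = U 0%N j) -> (forall i, U i m = U i 0%N + l) ->
  \sum_(i < n) \sum_(j < m)
    ((W i.+1 j - W i j) * (U i.+1 j.+1 - U i.+1 j) -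
     (W i j.+1 - W i j) * (U i.+1 j.+1 - U i j.+1)) = L * l.
Proof.
move=> Wn Wm Un Um.
(* [v] and [h] are the vertical and horizontal parts of the cochain [W dU], whose coboundary is the
   summand. *)
pose v i j := W i j * (U i j.+1 - U i j).
pose h i j := W i j * (U i.+1 j - U i j).
have -> : \sum_(i < n) \sum_(j < m)
    ((W i.+1 j - W i j) * (U i.+1 j.+1 - U i.+1 j) -
     (W i j.+1 - W i j) * (U i.+1 j.+1 - U i j.+1)) =
    \sum_(i < n) \sum_(j < m) (v i.+1 j - v i j) + \sum_(i < n) \sum_(j < m) (h i j - h i j.+1).
  rewrite -big_split; apply: eq_bigr => i _ /=; rewrite -big_split.
  by apply: eq_bigr => j _ /=; rewrite /v /h; ring.
rewrite exchange_big /=.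
under eq_bigr => j _ do rewrite (telescope_ord n (fun i => v i j)).
under [X in _ + X]eq_bigr => i _ do rewrite (telescope_ordN m (h i)).
have -> : \sum_(i < n) (h i 0%N - h i m) = 0.
  by rewrite big1// => i _; rewrite /h Wm !Um; ring.
rewrite addr0 (_ : L * l = \sum_(j < m) L * (U 0%N j.+1 - U 0%N j)).
  by apply: eq_bigr => j _; rewrite /v Wn !Un; ring.
by rewrite -mulr_sumr (telescope_ord m (U 0%N)) Um addrAC subrr add0r.
Qed.

Section BlockAverage.
Variables (k : nat) (f : nat -> nat -> R) (c : R).
Hypothesis k0 : (0 < k)%N.
Hypothesis fc1 : forall i j, `|f i.+1 j - f i j| <= c.
Hypothesis fc2 : forall i j, `|f i j.+1 - f i j| <= c.

(** A discrete mollification: the bound [c] on first differences is kept, while second differences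
    drop to [2 c / k]. This takes the place of differentiability. *)
Definition bavg i j : R := (k%:R ^+ 2)^-1 * \sum_(a < k) \sum_(b < k) f (i + a)%N (j + b)%N.

Let kR0 : 0 < k%:R :> R. Proof. by rewrite ltr0n. Qed.

Lemma bavg_diff_le i j i' j' M :
  (forall a b, (a < k)%N -> (b < k)%N -> `|f (i' + a)%N (j' + b)%N - f (i + a)%N (j + b)%N| <= M) ->
  `|bavg i' j' - bavg i j| <= M.
Proof.
move=> h; rewrite /bavg -mulrBr normrM ger0_norm ?invr_ge0 ?sqr_ge0//.
rewrite mulrC ler_pdivrMr ?exprn_gt0// -sumrB.
apply: le_trans (ler_norm_sum _ _ _) _.
have -> : M * k%:R ^+ 2 = \sum_(a < k) \sum_(b < k) M.
  by rewrite !sumr_const !card_ord -mulrnA -[RHS]mulr_natr natrM expr2.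
apply: ler_sum => a _; rewrite -sumrB; apply: le_trans (ler_norm_sum _ _ _) _.
by apply: ler_sum => b _; exact: h.
Qed.

Lemma bavg_d1 i j : `|bavg i.+1 j - bavg i j| <= c.
Proof. by apply: bavg_diff_le => a b _ _; rewrite addSn. Qed.

Lemma bavg_d2 i j : `|bavg i j.+1 - bavg i j| <= c.
Proof. by apply: bavg_diff_le => a b _ _; rewrite addSn. Qed.

Lemma bavg_D1 i j : bavg i.+1 j - bavg i j =
  (k%:R ^+ 2)^-1 * \sum_(b < k) (f (i + k)%N (j + b)%N - f i (j + b)%N).
Proof.
rewrite /bavg -mulrBr -sumrB; congr (_ * _).
under eq_bigr => a _ do rewrite -sumrB.
rewrite exchange_big /=; apply: eq_bigr => b _.
rewrite -[X in _ = _ - f X _]addn0 -(telescope_ord k (fun a => f (i + a)%N (j + b)%N)).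
by apply: eq_bigr => a _; rewrite addSn addnS.
Qed.

Lemma bavg_D2 i j : bavg i j.+1 - bavg i j =
  (k%:R ^+ 2)^-1 * \sum_(a < k) (f (i + a)%N (j + k)%N - f (i + a)%N j).
Proof.
rewrite /bavg -mulrBr -sumrB; congr (_ * _); apply: eq_bigr => a _.
rewrite -[X in _ = _ - f _ X]addn0 -(telescope_ord k (fun b => f (i + a)%N (j + b)%N)) -sumrB.
by apply: eq_bigr => b _; rewrite addSn addnS.
Qed.

Let eta := 2 * c / k%:R.

Lemma bavg_aux (g : nat -> R) (M : R) : (forall b, (b < k)%N -> `|g b| <= M) ->
  `|(k%:R ^+ 2)^-1 * \sum_(b < k) g b| <= M / k%:R.
Proof.
move=> h; rewrite normrM ger0_norm ?invr_ge0 ?sqr_ge0// expr2 invfM -mulrA [M / _]mulrC.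
rewrite ler_pM2l ?invr_gt0// mulrC ler_pdivrMr//.
apply: le_trans (ler_norm_sum _ _ _) _.
have -> : M * k%:R = \sum_(b < k) M by rewrite sumr_const card_ord mulr_natr.
by apply: ler_sum => b _; exact: h.
Qed.

Lemma bavg_D11 i j : `|(bavg i.+2 j - bavg i.+1 j) - (bavg i.+1 j - bavg i j)| <= eta.
Proof.
rewrite !bavg_D1 -mulrBr -sumrB.
apply: (@bavg_aux (fun b => f (i.+1 + k)%N (j + b)%N - f i.+1 (j + b)%N - (f (i + k)%N (j + b)%N - f i (j + b)%N))) => b _.
rewrite addSn; have := fc1 (i + k) (j + b); have := fc1 i (j + b).
by rewrite !ler_norml => /andP[? ?] /andP[? ?]; apply/andP; split; lra.
Qed.

Lemma bavg_D22 i j : `|(bavg i j.+2 - bavg i j.+1) - (bavg i j.+1 - bavg i j)| <= eta.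
Proof.
rewrite !bavg_D2 -mulrBr -sumrB.
apply: (@bavg_aux (fun a => f (i + a)%N (j.+1 + k)%N - f (i + a)%N j.+1 - (f (i + a)%N (j + k)%N - f (i + a)%N j))) => a _.
rewrite addSn; have := fc2 (i + a) (j + k); have := fc2 (i + a) j.
by rewrite !ler_norml => /andP[? ?] /andP[? ?]; apply/andP; split; lra.
Qed.

(** Telescoping in the first index leaves two columns, on each of which the increment over [k] steps
    is at most [k * c]; the normalization by [k ^+ 2] turns this into [2 * c / k]. *)
Lemma bavg_D12 i j : `|(bavg i.+1 j.+1 - bavg i.+1 j) - (bavg i j.+1 - bavg i j)| <= eta.
Proof.
rewrite !bavg_D2 -mulrBr -sumrB.
have -> : \sum_(a < k) (f (i.+1 + a)%N (j + k)%N - f (i.+1 + a)%N j - (f (i + a)%N (j + k)%N - f (i + a)%N j)) =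
   (f (i + k)%N (j + k)%N - f (i + k)%N j) - (f (i + 0)%N (j + k)%N - f (i + 0)%N j).
  rewrite -(telescope_ord k (fun a => f (i + a)%N (j + k)%N - f (i + a)%N j)).
  by apply: eq_bigr => a _; rewrite addSn addnS.
have fk i' : `|f i' (j + k)%N - f i' j| <= k%:R * c.
  rewrite -[X in _ - f _ X]addn0 -(telescope_ord k (fun b => f i' (j + b)%N)).
  apply: le_trans (ler_norm_sum _ _ _) _.
  have -> : k%:R * c = \sum_(b < k) c by rewrite sumr_const card_ord mulr_natl.
  by apply: ler_sum => b _; rewrite addnS.
rewrite normrM ger0_norm ?invr_ge0 ?sqr_ge0// mulrC ler_pdivrMr ?exprn_gt0//.
have -> : eta * k%:R ^+ 2 = 2 * (k%:R * c) by rewrite /eta; field; rewrite gt_eqF.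
have := fk (i + k)%N; have := fk (i + 0)%N.
by rewrite !ler_norml => /andP[? ?] /andP[? ?]; apply/andP; split; lra.
Qed.

Let c0 : 0 <= c. Proof. exact: le_trans (fc1 0 0). Qed.
Let eta0 : 0 <= eta. Proof. by rewrite /eta divr_ge0 ?mulr_ge0// ltW. Qed.

Lemma bavg_D1_shift i j m n :
  `|(bavg (i + m).+1 (j + n) - bavg (i + m) (j + n)) - (bavg i.+1 j - bavg i j)|
    <= (m + n)%:R * eta.
Proof.
elim: m => [|m IH].
  rewrite addn0 add0n; elim: n => [|n IH]; first by rewrite addn0 subrr normr0 mul0r.
  have := bavg_D12 i (j + n); move: IH; rewrite addnS -natr1 mulrDl mul1r !ler_norml.
  by move=> /andP[? ?] /andP[? ?]; apply/andP; split; lra.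
have := bavg_D11 (i + m) (j + n); move: IH; rewrite addnS addSn -natr1 mulrDl mul1r !ler_norml.
by move=> /andP[? ?] /andP[? ?]; apply/andP; split; lra.
Qed.

Lemma bavg_D2_shift i j m n :
  `|(bavg (i + m) (j + n).+1 - bavg (i + m) (j + n)) - (bavg i j.+1 - bavg i j)|
    <= (m + n)%:R * eta.
Proof.
elim: m => [|m IH].
  rewrite addn0 add0n; elim: n => [|n IH]; first by rewrite addn0 subrr normr0 mul0r.
  have := bavg_D22 i (j + n); move: IH; rewrite addnS -natr1 mulrDl mul1r !ler_norml.
  by move=> /andP[? ?] /andP[? ?]; apply/andP; split; lra.
have := bavg_D12 (i + m) (j + n); move: IH; rewrite addnS addSn -natr1 mulrDl mul1r !ler_norml.
by move=> /andP[? ?] /andP[? ?]; apply/andP; split; lra.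
Qed.

Lemma bavg_line1 i j m n M : (m + n <= M)%N ->
  `|bavg (i + m) (j + n) - bavg i (j + n) - m%:R * (bavg i.+1 j - bavg i j)|
    <= m%:R * M%:R * eta.
Proof.
elim: m => [|m IH] mM; first by rewrite addn0 subrr !mul0r subrr normr0.
have mM' : (m + n <= M)%N by lia.
have : `|(bavg (i + m).+1 (j + n) - bavg (i + m) (j + n)) - (bavg i.+1 j - bavg i j)| <= M%:R * eta.
  apply: le_trans (bavg_D1_shift i j m n) _.
  by rewrite ler_wpM2r// ler_nat.
have := IH mM'; rewrite addnS -natr1 !mulrDl !mul1r !ler_norml.
by move=> /andP[? ?] /andP[? ?]; apply/andP; split; lra.
Qed.

Lemma bavg_line2 i j n M : (n <= M)%N ->
  `|bavg i (j + n) - bavg i j - n%:R * (bavg i j.+1 - bavg i j)|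
    <= n%:R * M%:R * eta.
Proof.
elim: n => [|n IH] mM; first by rewrite addn0 subrr !mul0r subrr normr0.
have : `|(bavg i (j + n).+1 - bavg i (j + n)) - (bavg i j.+1 - bavg i j)| <= M%:R * eta.
  have := bavg_D2_shift i j 0 n; rewrite addn0 add0n => h.
  by apply: le_trans h _; rewrite ler_wpM2r// ler_nat ltnW.
have := IH (ltnW mM); rewrite addnS -natr1 !mulrDl !mul1r !ler_norml.
by move=> /andP[? ?] /andP[? ?]; apply/andP; split; lra.
Qed.

(** Small second differences make the average nearly affine over [M] steps. The second bound treats
    the direction [(m, - n)]: indices being natural numbers, it compares the points [(i + m, j)] and
    [(i, j + n)]. *)
Lemma bavg_linear (M : nat) i j m n : (m <= M)%N -> (n <= M)%N ->
  `|m%:R * (bavg i.+1 j - bavg i j) + n%:R * (bavg i j.+1 - bavg i j)|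
    <= `|bavg (i + m) (j + n) - bavg i j| + 4 * M%:R ^+ 2 * eta /\
  `|m%:R * (bavg i.+1 j - bavg i j) - n%:R * (bavg i j.+1 - bavg i j)|
    <= `|bavg (i + m) j - bavg i (j + n)| + 4 * M%:R ^+ 2 * eta.
Proof.
move=> mM nM.
have mn2 : (m + n <= 2 * M)%N by lia.
have m2 : (m + 0 <= 2 * M)%N by lia.
have n2 : (n <= 2 * M)%N by lia.
have b (r : nat) : (r <= M)%N -> r%:R * (2 * M)%:R * eta <= 2 * M%:R ^+ 2 * eta.
  move=> rM; rewrite ler_wpM2r// natrM mulrCA ler_pM2l// expr2 ler_wpM2r// ler_nat//.
have h1 := le_trans (bavg_line1 i j mn2) (b m mM).
have h2 := le_trans (bavg_line1 i j m2) (b m mM).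
have h3 := le_trans (bavg_line2 i j n2) (b n nM).
rewrite addn0 in h2.
split.
- have : - `|bavg (i + m) (j + n) - bavg i j| <= bavg (i + m) (j + n) - bavg i j <= `|bavg (i + m) (j + n) - bavg i j|.
    by rewrite -ler_norml.
  move: h1 h3; rewrite !ler_norml => /andP[? ?] /andP[? ?] /andP[? ?].
  by apply/andP; split; lra.
- have : - `|bavg (i + m) j - bavg i (j + n)| <= bavg (i + m) j - bavg i (j + n) <= `|bavg (i + m) j - bavg i (j + n)|.
    by rewrite -ler_norml.
  move: h2 h3; rewrite !ler_norml => /andP[? ?] /andP[? ?] /andP[? ?].
  by apply/andP; split; lra.
Qed.

End BlockAverage.
End DiscreteStokes.

Lemma block_bound (i a k n M : nat) : (a < k)%N -> (n <= M)%N ->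
  (i <= i + n + a <= i + k + M)%N.
Proof. by move=> ak nM; apply/andP; split; lia. Qed.

(** * Discrete gradients of 1-Lipschitz functions *)

Section GradientBound.
Context {R : realType}.
Variable beta : R.
Hypothesis beta0 : 0 < beta.
Variable K : kform beta.

(** The horizontal mesh is [pi / N], half a period divided by [N], so that the grid is invariant
    under [glide]: the fundamental rectangle has [N] x [N] cells and the torus [2 N] x [N]. *)
Definition gpt (N i j : nat) : R * R := (pi * i%:R / N%:R, 2 * beta * j%:R / N%:R).

Lemma gptD (N i j m n : nat) :
  gpt N (i + m) (j + n) = gpt N i j + N%:R^-1 *: (pi * m%:R, 2 * beta * n%:R).
Proof. by apply: pair_ext; rewrite /= /GRing.scale /= natrD; ring. Qed.

Lemma gptB (N i j m n : nat) :
  gpt N (i + m) j = gpt N i (j + n) + N%:R^-1 *: (pi * m%:R, - (2 * beta * n%:R)).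
Proof. by apply: pair_ext; rewrite /= /GRing.scale /= natrD; ring. Qed.

Lemma dist_le1 (x y : R) : y <= x -> x - 1 <= y -> `|x - y| <= 1.
Proof. by move=> ? ?; rewrite ler_norml; apply/andP; split; lra. Qed.

Definition stepc : R := pi + 2 * beta.

Lemma stepc_gt0 : 0 < stepc.
Proof. by rewrite addr_gt0 ?pi_gt0// mulr_gt0. Qed.

Lemma norm_step (a b M : R) : `|a| <= M -> `|b| <= M -> `|(pi * a, 2 * beta * b)| <= M * stepc.
Proof.
move=> aM bM; have p0 := pi_gt0 R; have b20 : 0 < 2 * beta by rewrite mulr_gt0.
have M0 : 0 <= M by apply: le_trans aM.
rewrite prod_normE /= ge_max [`|pi * a|]normrM [`|2 * beta * b|]normrM (gtr0_norm p0) (gtr0_norm b20).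
have := ler_wpM2l (ltW p0) aM; have := ler_wpM2l (ltW b20) bM.
have := mulr_ge0 M0 (ltW p0); have := mulr_ge0 M0 (ltW b20).
by rewrite /stepc => *; apply/andP; split; lra.
Qed.

Lemma stepZ (s a b t : R) : t *: (pi * a, s * (2 * beta * b)) = (pi * (t * a), s * (2 * beta * (t * b))).
Proof. by apply: pair_ext; rewrite /= /GRing.scale /=; ring. Qed.

Lemma exists_nat_gt (x : R) : exists n : nat, (0 < n)%N /\ x <= n%:R.
Proof. by exists (Num.trunc x).+1; split => //; exact: ltW (truncnS_gt x). Qed.

Definition lip (u : R * R -> R) := forall p q, `|u p - u q| <= dist K p q.

Lemma gradient_const : exists2 C : R, 0 < C & forall N u, (0 < N)%N -> lip u ->
  (forall i j, `|u (gpt N i.+1 j) - u (gpt N i j)| <= C / N%:R) /\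
  (forall i j, `|u (gpt N i j.+1) - u (gpt N i j)| <= C / N%:R).
Proof.
have [C C0 CP] := dist_upper K beta0.
exists (C * stepc); first by rewrite mulr_gt0// stepc_gt0.
move=> N u N0 ul; have NR0 : 0 < N%:R :> R by rewrite ltr0n.
have aux i j m n : (m <= 1)%N -> (n <= 1)%N ->
    `|u (gpt N (i + m) (j + n)) - u (gpt N i j)| <= C * stepc / N%:R.
  move=> m1 n1; apply: le_trans (ul _ _) _; apply: le_trans (CP _ _) _.
  rewrite gptD addrAC subrr add0r normrZ gtr0_norm ?invr_gt0// -[leRHS]mulrA ler_pM2l// [leRHS]mulrC ler_pM2l ?invr_gt0//.
  rewrite -[stepc]mul1r; apply: norm_step; rewrite ger0_norm// ?(ler_nat R _ 1)//.
by split=> i j; [have := aux i j 1%N 0%N | have := aux i j 0%N 1%N]; rewrite ?addn1 !addn0; apply.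
Qed.

Definition gavg (N : nat) (u : R * R -> R) (k : nat) : nat -> nat -> R :=
  bavg k (fun i j => u (gpt N i j)).

(** The averaged gradient has dual norm at most 1 up to [kap]. The order of the choices matters:
    directions are rounded to multiples of [1 / M]; blocks of size [k], large with respect to [M],
    make the averages nearly affine over [M] steps; [N], chosen last, makes the metric nearly
    constant on a block. Then the Lipschitz bound over [M] steps in a rounded direction compares the
    gradient with the norm. *)
Lemma gradient_bound (kap : R) : 0 < kap ->
  exists k0 : nat, forall k : nat, (k0 <= k)%N -> exists N0 : nat,
  forall N : nat, (N0 <= N)%N -> forall u, lip u -> forall (i j : nat) (w : R * R),
  `|w.1| <= 1 -> `|w.2| <= 1 ->
  N%:R * (w.1 * (gavg N u k i.+1 j - gavg N u k i j) +
          w.2 * (gavg N u k i j.+1 - gavg N u k i j)) <=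
    nrm K (gpt N i j) (pi * w.1, 2 * beta * w.2) + kap.
Proof.
move=> kap0.
have [C1 C10 C1P] := gradient_const.
have [C C0 CP] := nrm_upper K beta0.
have s0 := stepc_gt0.
(* Before division by [M], rounding a direction costs at most [C * stepc] in the norm and [2 * C1]
   in the gradient. *)
pose C2 := C * stepc + 2 * C1.
have C20 : 0 < C2 by rewrite addr_gt0// mulr_gt0.
have [M [M0 MP]] := exists_nat_gt (4 * C2 / kap).
have MR0 : 0 < M%:R :> R by rewrite ltr0n.
rewrite ler_pdivrMr// in MP.
have [k0 [k00 k0P]] := exists_nat_gt (32 * M%:R * C1 / kap).
exists k0 => k k0k.
have k1 : (0 < k)%N by exact: leq_trans k0k.
have kR0 : 0 < k%:R :> R by rewrite ltr0n.
have kP : 32 * M%:R * C1 <= k%:R * kap.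
  by rewrite -ler_pdivrMr//; apply: le_trans k0P _; rewrite ler_nat.
pose kap1 := kap / 4 / stepc.
have kap10 : 0 < kap1 by rewrite !divr_gt0.
have [del del0 delP] := nrm_unif K beta0 kap10.
have [N0 [N00 N0P]] := exists_nat_gt ((k + 3 * M)%:R * stepc / del + 1).
exists N0 => N N0N u ul i j w w1 w2.
pose U := gavg N u k; rewrite -/U.
have N1 : (0 < N)%N by exact: leq_trans N0N.
have NR0 : 0 < N%:R :> R by rewrite ltr0n.
have NP : (k + 3 * M)%:R * stepc < N%:R * del.
  rewrite -ltr_pdivrMr//; apply: lt_le_trans (_ : N0%:R <= _); last by rewrite ler_nat.
  by apply: lt_le_trans N0P; rewrite ltrDl.
have [f1 f2] := C1P N u N1 ul.
set c := C1 / N%:R in f1 f2.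
pose f i j := u (gpt N i j).
set p := gpt N i j.
(* The Lipschitz bound between two grid points [V / N] apart near the block, with the norm frozen at
   [p]. *)
have key (s : R) (m n : nat) i1 j1 i2 j2 : `|s| = 1 -> (m <= M)%N -> (n <= M)%N ->
   (i <= i1 <= i + k + M)%N -> (j <= j1 <= j + k + M)%N ->
   gpt N i2 j2 = gpt N i1 j1 + N%:R^-1 *: (pi * m%:R, s * (2 * beta * n%:R)) ->
   N%:R * `|f i2 j2 - f i1 j1| <=
     nrm K p (pi * m%:R, s * (2 * beta * n%:R)) + kap1 * (M%:R * stepc).
  move=> s1 mM nM i1P j1P e.
  set V := (pi * m%:R, _) in e *.
  have VM : `|V| <= M%:R * stepc.
    have := @norm_step m%:R (s * n%:R) M%:R.
    rewrite normrM s1 mul1r !ger0_norm// !ler_nat => /(_ mM nM).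
    by rewrite /V mulrCA.
  rewrite -ler_pdivlMl//; apply: le_trans (ul _ _) _; rewrite e dist_sym.
  apply: le_trans (dist_seg _ _ _) _; apply: seg_le => t.
  rewrite in_itv /= => /andP[t0 t1].
  rewrite addrAC subrr add0r nrmZ gtr0_norm ?invr_gt0// ler_pM2l ?invr_gt0//.
  apply: le_trans (delP _ p V _) _; last by rewrite lerD2l ler_pM2l.
  rewrite -[i1](subnKC (proj1 (andP i1P))) -[j1](subnKC (proj1 (andP j1P))) gptD -/p.
  rewrite -(addrA p) [p + _]addrC addrK scalerA.
  apply: le_lt_trans (ler_normD _ _) _.
  rewrite !normrZ (ger0_norm t0) [`|N%:R^-1|]gtr0_norm ?invr_gt0//.
  rewrite -(ltr_pM2l NR0); apply: le_lt_trans NP.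
  set x := `|_|; have -> : N%:R * (N%:R^-1 * x + t * N%:R^-1 * `|V|) = x + t * `|V|.
    by field; rewrite gt_eqF.
  have h1 : `|(pi * (i1 - i)%:R, 2 * beta * (j1 - j)%:R)| <= (k + M)%:R * stepc :> R.
    by apply: norm_step; rewrite ger0_norm// ler_nat leq_subLR addnA; case/andP: (i1P); case/andP: (j1P).
  have h2 : t * `|V| <= M%:R * stepc.
    by apply: le_trans VM; rewrite ler_piMl.
  apply: le_trans (lerD h1 h2) _.
  by rewrite -mulrDl -natrD ler_pM2r// ler_nat -addnA leq_add2l mulSn mul2n -addnn leq_add2l leq_addl.
have bound (s a b : R) : s = 1 \/ s = -1 -> 0 <= a <= 1 -> 0 <= b <= 1 ->
    N%:R * `|a * (U i.+1 j - U i j) + s * (b * (U i j.+1 - U i j))| <=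
    nrm K p (pi * a, s * (2 * beta * b)) + kap.
  move=> s1 /andP[a0 a1] /andP[b0 b1].
  have sn : `|s| = 1 by case: s1 => ->; rewrite ?normrN normr1.
  pose m := Num.trunc (M%:R * a); pose n := Num.trunc (M%:R * b).
  have tr x : 0 <= x -> x <= 1 -> [/\ (Num.trunc (M%:R * x : R) <= M)%N,
       (Num.trunc (M%:R * x : R))%:R <= M%:R * x & M%:R * x - 1 <= (Num.trunc (M%:R * x : R))%:R].
    move=> x0 x1; have Mx0 : 0 <= M%:R * x by rewrite mulr_ge0.
    have h1 := truncn_le (M%:R * x); rewrite Mx0 in h1.
    have h2 := truncnS_gt (M%:R * x).
    split => //; last by rewrite lerBlDr natr1 ltW.
    rewrite -(ler_nat R); apply: le_trans h1 _; by rewrite ler_piMr.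
  have [mM m1 m2] := tr a a0 a1; have [nM n1 n2] := tr b b0 b1.
  rewrite -/m -/n in mM m1 m2 nM n1 n2.
  have [L1 L2] := bavg_linear k1 f1 f2 i j mM nM.
  have D1 := bavg_d1 k1 f1 i j; have D2 := bavg_d2 k1 f2 i j.
  rewrite -/U in L1 L2 D1 D2.
  have main : N%:R * `|m%:R * (U i.+1 j - U i j) + s * (n%:R * (U i j.+1 - U i j))| <=
      nrm K p (pi * m%:R, s * (2 * beta * n%:R)) + kap1 * (M%:R * stepc) + M%:R * (kap / 4).
    have eta_le : N%:R * (4 * M%:R ^+ 2 * (2 * c / k%:R)) <= M%:R * (kap / 4).
      have -> : N%:R * (4 * M%:R ^+ 2 * (2 * c / k%:R)) = M%:R * (8 * M%:R * C1 / k%:R).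
        by rewrite /c; field; rewrite !gt_eqF.
      by rewrite ler_pM2l// ler_pdivrMr//; move: kP; clear; lra.
    have b1' : `|U (i + m)%N (j + n)%N - U i j| <= N%:R^-1 * (nrm K p (pi * m%:R, 1 * (2 * beta * n%:R)) + kap1 * (M%:R * stepc)).
      apply: bavg_diff_le => // a' b' a'k b'k; rewrite ler_pdivlMl//.
      apply: key => //; rewrite ?normr1//.
      + by have := block_bound i a'k (leq0n M); rewrite addn0.
      + by have := block_bound j b'k (leq0n M); rewrite addn0.
      + by rewrite addnAC [(j + n + b')%N]addnAC gptD mul1r.
    have b2' : `|U (i + m)%N j - U i (j + n)%N| <= N%:R^-1 * (nrm K p (pi * m%:R, -1 * (2 * beta * n%:R)) + kap1 * (M%:R * stepc)).
      apply: bavg_diff_le => // a' b' a'k b'k; rewrite ler_pdivlMl//.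
      apply: key => //; rewrite ?normrN1//.
      + by have := block_bound i a'k (leq0n M); rewrite addn0.
      + by exact: block_bound.
      + by rewrite addnAC [(j + n + b')%N]addnAC (gptB N _ _ m n) mulN1r.
    rewrite ler_pdivlMl// in b1'; rewrite ler_pdivlMl// in b2'.
    have N0' := ltW NR0.
    case: s1 => ->.
      rewrite mul1r; apply: le_trans (ler_wpM2l N0' L1) _.
      by move: b1' eta_le; clear; lra.
    rewrite !mulN1r in b2' *; apply: le_trans (ler_wpM2l N0' L2) _.
    by move: b2' eta_le; clear; lra.
  have nv : nrm K p (pi * m%:R, s * (2 * beta * n%:R)) <=
      M%:R * nrm K p (pi * a, s * (2 * beta * b)) + C * stepc.
    rewrite -[X in X * nrm _ _ _](gtr0_norm MR0) -nrmZ stepZ.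
    have -> : (pi * m%:R, s * (2 * beta * n%:R)) =
       (pi * (M%:R * a), s * (2 * beta * (M%:R * b))) +
       (pi * (m%:R - M%:R * a), 2 * beta * (s * (n%:R - M%:R * b))).
      by apply: pair_ext; rewrite /=; ring.
    apply: le_trans (nrm_triangle _ _ _ _) _; rewrite lerD2l.
    apply: le_trans (CP _ _) _; rewrite ler_pM2l//.
    rewrite -[leRHS]mul1r; apply: norm_step.
      by rewrite distrC dist_le1.
    by rewrite normrM sn mul1r distrC dist_le1.
  have NC (x : R) : `|x| <= c -> N%:R * `|x| <= C1.
    by move=> h; rewrite -ler_pdivlMl// mulrC.
  have E1 := NC _ D1; have E2 := NC _ D2.
  set d1 := U i.+1 j - U i j in main E1 *; set d2 := U i j.+1 - U i j in main E2 *.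
  rewrite -(ler_pM2l MR0).
  have -> : M%:R * (N%:R * `|a * d1 + s * (b * d2)|) =
      N%:R * `|(m%:R * d1 + s * (n%:R * d2)) + ((M%:R * a - m%:R) * d1 + s * ((M%:R * b - n%:R) * d2))|.
    rewrite mulrCA -{1}(gtr0_norm MR0) -normrM; congr (_ * `|_|); ring.
  have N0' := ltW NR0.
  apply: le_trans (ler_wpM2l N0' (ler_normD _ _)) _.
  have r1 : N%:R * `|(M%:R * a - m%:R) * d1 + s * ((M%:R * b - n%:R) * d2)| <= 2 * C1.
    apply: le_trans (ler_wpM2l N0' (ler_normD _ _)) _.
    rewrite !normrM sn mul1r mulrDr.
    have g1 : `|M%:R * a - m%:R| <= 1 by exact: dist_le1.
    have g2 : `|M%:R * b - n%:R| <= 1 by exact: dist_le1.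
    have : N%:R * (`|M%:R * a - m%:R| * `|d1|) <= N%:R * `|d1| by rewrite ler_pM2l// ler_piMl.
    have : N%:R * (`|M%:R * b - n%:R| * `|d2|) <= N%:R * `|d2| by rewrite ler_pM2l// ler_piMl.
    by move: E1 E2; clear; lra.
  have e1 : kap1 * (M%:R * stepc) = M%:R * (kap / 4) by rewrite /kap1; field; rewrite gt_eqF.
  rewrite e1 in main.
  move: main nv r1 MP C20; rewrite -/C2.
  set x3 := `|m%:R * d1 + _|; set x4 := `|(M%:R * a - _) * _ + _|; move: x3 x4 => x3 x4.
  move: (nrm K p _) (nrm K p _) => x1 x2.
  rewrite /C2; clear; lra.
have le_abs (x : R) : N%:R * x <= N%:R * `|x| by rewrite ler_pM2l// ler_norm.
have [/andP[lo1 hi1] /andP[lo2 hi2]] : (-1 <= w.1 <= 1) /\ (-1 <= w.2 <= 1) by rewrite -!ler_norml.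
apply: le_trans (le_abs _) _; rewrite -/p.
set d1 := U i.+1 j - U i j; set d2 := U i j.+1 - U i j.
have [p1|n1] := leP 0 w.1; have [p2|n2] := leP 0 w.2.
- have := bound 1 w.1 w.2 (or_introl erefl); rewrite p1 hi1 p2 hi2 !mul1r.
  exact.
- have := bound (-1) w.1 (- w.2) (or_intror erefl); rewrite p1 hi1 oppr_ge0 (ltW n2) lerNl lo2.
  by rewrite !(mulrN, mulNr, mul1r, opprK); exact.
- have := bound (-1) (- w.1) w.2 (or_intror erefl); rewrite p2 hi2 oppr_ge0 (ltW n1) lerNl lo1.
  rewrite !(mulrN, mulNr, mul1r) -opprD normrN.
  by rewrite -[(- _, - _)]/(- (pi * w.1, 2 * beta * w.2)) nrmN; exact.
- have := bound 1 (- w.1) (- w.2) (or_introl erefl); rewrite !oppr_ge0 (ltW n1) (ltW n2) lerNl lo1 lerNl lo2.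
  rewrite !(mulrN, mulNr, mul1r) -opprD normrN.
  by rewrite -[(- _, - _)]/(- (pi * w.1, 2 * beta * w.2)) nrmN; exact.
Qed.

End GradientBound.

(** * Integrals over rectangles and Riemann sums *)

Section PlaneIntegral.
Context {R : realType}.
Local Notation mu := (@lebesgue_measure R).
Local Notation mu2 := (mu \x mu)%E.
Local Notation TR := (measurableTypeR R).

(** The squares with rational centres and half-sides [1 / n.+1] that are contained in [U] form a
    countable cover of it. *)
Lemma open_measurable_prod (U : set (R * R)) : open U -> measurable (U : set (TR * TR)).
Proof.
move=> oU.
pose sq (q r : rat) (n : nat) : set (TR * TR) :=
  `]ratr q - n.+1%:R^-1, ratr q + n.+1%:R^-1[ `*` `]ratr r - n.+1%:R^-1, ratr r + n.+1%:R^-1[.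
pose F q r n := if `[< sq q r n `<=` U >] then sq q r n else set0.
have -> : U = \bigcup_q \bigcup_r \bigcup_n F q r n.
  apply/seteqP; split => [p Up|p [q _ [r _ [n _]]]]; last first.
    by rewrite /F; case: asboolP => // h; exact: h.
  have /nbhs_ballP[e /= e0 eU] := open_nbhs_nbhs (conj oU Up).
  pose n := Num.trunc (2 / e).
  have ne : 2 / n.+1%:R < e.
    by rewrite ltr_pdivrMr// mulrC -ltr_pdivrMr//; exact: truncnS_gt.
  set h : R := n.+1%:R^-1 in ne *.
  have h0 : 0 < h by rewrite invr_gt0.
  have rq (x : R) : exists q : rat, x - h < ratr q < x + h.
    have xh : x - h < x + h by move: h0; clear; lra.
    by have [q] := rat_in_itvoo xh; rewrite in_itv => qh; exists q.
  have [q /andP[q1 q2]] := rq p.1; have [r /andP[r1 r2]] := rq p.2.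
  exists q => //; exists r => //; exists n => //.
  have sU : sq q r n `<=` U.
    move=> [x y] [/=]; rewrite !in_itv /= => /andP[x1 x2] /andP[y1 y2].
    apply: eU; rewrite -ball_normE /= prod_normE /= gt_max !ltr_norml.
    move: q1 q2 r1 r2 x1 x2 y1 y2 ne; rewrite -/h; clear => *.
    by rewrite -!andbA; apply/and4P; split; lra.
  rewrite /F asboolT//; split; rewrite /= in_itv /= -/h.
    by move: q1 q2; clear => *; apply/andP; split; lra.
  by move: r1 r2; clear => *; apply/andP; split; lra.
apply: bigcupT_measurable_rat => q; apply: bigcupT_measurable_rat => r.
apply: bigcupT_measurable => n; rewrite /F; case: ifP => // _.
by apply: measurableX; exact: measurable_itv.
Qed.

Lemma continuous_measurable_prod (f : R * R -> R) : continuous f ->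
  measurable_fun setT (f : TR * TR -> TR).
Proof.
move=> /continuousP cf; apply: (measurability _ (RGenOpens.measurableE R)).
move=> _ [_ [a [b ->] <-]]; rewrite setTI; apply: open_measurable_prod.
by apply: cf; exact: interval_open.
Qed.

Variables A B : R.
Hypothesis A0 : 0 < A.
Hypothesis B0 : 0 < B.
Local Notation rect := (`[0, A] `*` `[0, B] : set (TR * TR)).

Lemma measurable_rect : measurable rect.
Proof. by apply: measurableX; exact: measurable_itv. Qed.

Lemma product_itvE (a b c d : R) b1 b2 b3 b4 : a <= b -> c <= d ->
  mu2 ([set` Interval (BSide b1 a) (BSide b2 b)] `*`
       [set` Interval (BSide b3 c) (BSide b4 d)]) = ((b - a) * (d - c))%:E.
Proof.
move=> ab cd; rewrite product_measure1E; [|exact: measurable_itv..].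
have aux x y b5 b6 : x <= y ->
    mu [set` Interval (BSide b5 x) (BSide b6 y)] = (y - x)%:E.
  move=> xy; rewrite lebesgue_measure_itv /= lte_fin.
  by case: ltgtP xy => // ->; rewrite subrr.
by rewrite [X in (X * _)%E](aux a b b1 b2 ab) [X in (_ * X)%E](aux c d b3 b4 cd).
Qed.

Lemma rect_bounded_integrable (f : R * R -> R) (M : R) :
  measurable_fun rect (f : TR * TR -> TR) -> (forall p, rect p -> `|f p| <= M) ->
  mu2.-integrable rect (EFin \o f).
Proof.
move=> mf fM; apply: measurable_bounded_integrable => //.
- exact: measurable_rect.
- exact: (eq_ind_r (fun x => x < +oo)%E (ltry _) (product_itvE true false true false (ltW A0) (ltW B0))).
- by exists M; split; rewrite ?num_real// => x Mx y /= ry; exact: le_trans (fM _ ry) (ltW Mx).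
Qed.

Lemma rect_integrable (f : R * R -> R) : continuous f -> mu2.-integrable rect (EFin \o f).
Proof.
move=> cf.
have cn : continuous (fun p => `|f p|) by move=> p; apply: cvg_norm; exact: cf.
have [z _ zP] := EVT_rect_max (ltW A0) (ltW B0) cn.
apply: (@rect_bounded_integrable f `|f z|).
  by apply: measurable_funS (continuous_measurable_prod cf) => //; exact: measurableT.
by move=> p [p1 p2]; exact: zP.
Qed.

Variable N : nat.
Hypothesis N0 : (0 < N)%N.

Let NR : 0 < N%:R :> R. Proof. by rewrite ltr0n. Qed.

(** Half-open, so that distinct cells are disjoint. The far sides of the rectangle then lie in no
    cell, which explains the first alternative in [cell_sum1] and [cell_sum2]. *)
Definition cellx (C : R) (i : nat) : set R := `[C * i%:R / N%:R, C * i.+1%:R / N%:R[%classic.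

Lemma cellx_near C i x : cellx C i x -> C * i%:R / N%:R <= x < C * i%:R / N%:R + C / N%:R.
Proof.
rewrite /cellx /= in_itv /=; have -> // : C * i%:R / N%:R + C / N%:R = C * i.+1%:R / N%:R.
by rewrite -natr1; ring.
Qed.

Lemma cellx_inj C i j x : 0 < C -> cellx C i x -> cellx C j x -> i = j.
Proof.
move=> C0.
wlog: i j / (i < j)%N => [h|].
  case: (ltngtP i j) => // ij hi hj; first exact: h.
  by apply/esym; exact: h.
rewrite /cellx /= !in_itv /= => ij /andP[_ xi] /andP[jx _].
have := le_lt_trans jx xi.
by rewrite ltr_pM2r ?invr_gt0// ltr_pM2l// ltr_nat ltnS leqNgt ij.
Qed.

Lemma cell_sum1 C (g : nat -> R) x : 0 < C ->
  \sum_(i < N) g i * \1_(cellx C i) x = 0 \/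
  exists i, [/\ (i < N)%N, cellx C i x & \sum_(i < N) g i * \1_(cellx C i) x = g i].
Proof.
move=> C0; have [[i iN ix]|none] := pselect (exists2 i, (i < N)%N & cellx C i x); last first.
  left; rewrite big1// => i _; rewrite indicE memNset ?mulr0// => ix.
  by apply: none; exists i.
right; exists i; split => //.
rewrite (bigD1 (Ordinal iN))//= big1 ?addr0; first by rewrite indicE mem_set// mulr1.
move=> j jN; rewrite indicE memNset ?mulr0// => jx; move/negP: jN; apply.
by apply/eqP/val_inj; rewrite /= (cellx_inj C0 jx ix).
Qed.

Definition cell i j : set (TR * TR) := cellx A i `*` cellx B j.

Lemma cell_sum2 (c : nat -> nat -> R) (p : R * R) :
  \sum_(i < N) \sum_(j < N) c i j * \1_(cell i j) p = 0 \/
  exists i j, [/\ (i < N)%N, (j < N)%N, cellx A i p.1, cellx B j p.2 &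
    \sum_(i < N) \sum_(j < N) c i j * \1_(cell i j) p = c i j].
Proof.
have -> : \sum_(i < N) \sum_(j < N) c i j * \1_(cell i j) p =
    \sum_(i < N) (\sum_(j < N) c i j * \1_(cellx B j) p.2) * \1_(cellx A i) p.1.
  apply: eq_bigr => i _; rewrite mulr_suml; apply: eq_bigr => j _.
  rewrite -mulrA; congr (_ * _); rewrite !indicE /cell in_setX.
  by case: (_ \in _); case: (_ \in _); rewrite /= ?mulr1 ?mulr0.
have [->|[i [iN ix ->]]] := cell_sum1 (fun i => \sum_(j < N) c i j * \1_(cellx B j) p.2) p.1 A0.
  by left.
have [->|[j [jN jy ->]]] := cell_sum1 (c i) p.2 B0; first by left.
by right; exists i, j.
Qed.

Lemma Rintegral_sum_ord n (h : nat -> R * R -> R) :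
  (forall i, (i < n)%N -> mu2.-integrable rect (EFin \o h i)) ->
  mu2.-integrable rect (EFin \o (fun p => \sum_(i < n) h i p)) /\
  \int[mu2]_(p in rect) (\sum_(i < n) h i p) = \sum_(i < n) \int[mu2]_(p in rect) h i p.
Proof.
elim: n => [|n IH] hi.
  split.
    rewrite (_ : _ \o _ = EFin \o cst 0); first by apply: rect_integrable => p; exact: cvg_cst.
    by apply/funext => p /=; rewrite big_ord0.
  rewrite big_ord0 (_ : (fun p => _) = cst 0); last by apply/funext => p; rewrite big_ord0.
  by rewrite Rintegral_cst ?mul0r//; exact: measurable_rect.
have [I1 I2] := IH (fun i iN => hi i (ltnW iN)).
have E : (fun p => \sum_(i < n.+1) h i p) = (fun p => \sum_(i < n) h i p + h n p).
  by apply/funext => p; rewrite big_ord_recr.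
rewrite E big_ord_recr /= -I2 -RintegralD//; [split => //|exact: measurable_rect|exact: hi].
exact: (integrableD measurable_rect I1 (hi n (leqnn _))).
Qed.

Lemma cell_integral (c : R) i j : (i < N)%N -> (j < N)%N ->
  mu2.-integrable rect (EFin \o (fun p => c * \1_(cell i j) p)) /\
  \int[mu2]_(p in rect) (c * \1_(cell i j) p) = c * (A / N%:R * (B / N%:R)).
Proof.
move=> iN jN.
have mc : measurable (cell i j) by apply: measurableX; exact: measurable_itv.
have i1 : mu2.-integrable rect (EFin \o \1_(cell i j)).
  apply: (@rect_bounded_integrable _ 1).
    exact: measurable_indic.
  by move=> p _; rewrite indicE; case: (_ \in _); rewrite ?normr1 ?normr0.
split.
  apply: (@rect_bounded_integrable _ `|c|).
    by apply: measurable_funM => //; exact: measurable_indic.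
  by move=> p _; rewrite indicE; case: (_ \in _); rewrite ?mulr1 ?mulr0 ?normr0.
rewrite RintegralZl//; last exact: measurable_rect.
congr (_ * _); rewrite /Rintegral integral_indic//; last exact: measurable_rect.
have sub (C : R) k : 0 < C -> (k < N)%N -> cellx C k `<=` `[0, C]%classic.
  move=> C0 kN x; rewrite /cellx /= !in_itv /= => /andP[h1 h2]; apply/andP; split.
    by apply: le_trans h1; rewrite divr_ge0// mulr_ge0// ltW.
  apply: ltW; apply: lt_le_trans h2 _.
  by rewrite ler_pdivrMr// ler_pM2l// ler_nat.
rewrite classical_sets.setIidl; last by move=> p [h1 h2]; split; [exact: (sub A i)|exact: (sub B j)].
have le (C : R) k : 0 < C -> C * k%:R / N%:R <= C * k.+1%:R / N%:R.
  by move=> C0; rewrite ler_pM2r ?invr_gt0// ler_pM2l// ler_nat.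
rewrite (congr1 fine (product_itvE true true true true (le A i A0) (le B j B0))) /=.
by rewrite -[i.+1%:R]natr1 -[j.+1%:R]natr1; congr (_ * _); ring.
Qed.

Lemma cell_sum_integral (c : nat -> nat -> R) :
  mu2.-integrable rect (EFin \o (fun p => \sum_(i < N) \sum_(j < N) c i j * \1_(cell i j) p)) /\
  \int[mu2]_(p in rect) (\sum_(i < N) \sum_(j < N) c i j * \1_(cell i j) p) =
  \sum_(i < N) \sum_(j < N) c i j * (A / N%:R * (B / N%:R)).
Proof.
have row i : (i < N)%N -> _ := fun iN => @Rintegral_sum_ord N
  (fun j p => c i j * \1_(cell i j) p) (fun j jN => proj1 (cell_integral (c i j) iN jN)).
have [I1 I2] := @Rintegral_sum_ord N (fun i p => \sum_(j < N) c i j * \1_(cell i j) p)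
  (fun i iN => proj1 (row i iN)).
split => //; rewrite I2; apply: eq_bigr => i _; rewrite (proj2 (row i _))//.
by apply: eq_bigr => j _; rewrite (proj2 (cell_integral _ _ _)).
Qed.

End PlaneIntegral.

Section RiemannSum.
Context {R : realType}.
Local Notation mu := (@lebesgue_measure R).
Local Notation mu2 := (mu \x mu)%E.
Variables A B : R.
Hypothesis A0 : 0 < A.
Hypothesis B0 : 0 < B.

Lemma riemann_sum_le (f : R * R -> R) (k : R) : continuous f -> (forall p, 0 <= f p) -> 0 < k ->
  exists N0 : nat, forall N : nat, (0 < N)%N -> (N0 <= N)%N ->
  \sum_(i < N) \sum_(j < N) f (A * i%:R / N%:R, B * j%:R / N%:R) * (A / N%:R * (B / N%:R))
   <= \int[mu2]_(p in `[0, A] `*` `[0, B]) f p + k.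
Proof.
move=> cf f0 k0.
pose k1 := k / (A * B).
have k10 : 0 < k1 by rewrite divr_gt0// mulr_gt0.
have [d d0 dP] := unif_cont_compact (@rect_compact R 0 A 0 B) cf k10.
exists (Num.trunc ((A + B) / d)).+1 => N N1 N2.
have NR : 0 < N%:R :> R by rewrite ltr0n.
have Nd : (A + B) / N%:R < d.
  rewrite ltr_pdivrMr// mulrC -ltr_pdivrMr//; apply: lt_le_trans (truncnS_gt _) _.
  by rewrite ler_nat.
pose c i j := f (A * i%:R / N%:R, B * j%:R / N%:R).
have [I1 <-] := cell_sum_integral A0 B0 N1 c.
have -> : k = \int[mu2]_(p in `[0, A] `*` `[0, B]) k1.
  rewrite Rintegral_cst; last exact: measurable_rect.
  rewrite (congr1 fine (product_itvE true false true false (ltW A0) (ltW B0))) /=.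
  by rewrite !subr0 /k1 divfK// gt_eqF// mulr_gt0.
have If := rect_integrable A0 B0 cf.
have Ik : mu2.-integrable (`[0, A] `*` `[0, B]) (EFin \o (fun=> k1)).
  by apply: rect_integrable => // p; exact: cvg_cst.
rewrite -RintegralD//; last exact: measurable_rect.
apply: le_Rintegral => //; first exact: measurable_rect.
  exact: (integrableD (@measurable_rect R A B) If Ik).
move=> p [p1 p2] /=.
(* Where no cell contains the point, the sum vanishes and [f >= 0] suffices. *)
have [->|[i [j [iN jN ip jp ->]]]] := cell_sum2 A0 B0 N1 c p.
  by rewrite addr_ge0// ltW.
have gi (C : R) m : 0 < C -> (m < N)%N -> `[0, C]%classic (C * m%:R / N%:R).
  move=> C0 mN; rewrite /= in_itv /= divr_ge0 ?mulr_ge0 ?(ltW C0)//=.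
  by rewrite ler_pdivrMr// ler_pM2l// ler_nat ltnW.
have : `|c i j - f p| < k1.
  apply: dP => //; first by split; exact: gi.
  have /andP[a1 a2] := cellx_near ip; have /andP[b1 b2] := cellx_near jp.
  have AB1 : A / N%:R <= (A + B) / N%:R by rewrite ler_pM2r ?invr_gt0// lerDl ltW.
  have AB2 : B / N%:R <= (A + B) / N%:R by rewrite ler_pM2r ?invr_gt0// lerDr ltW.
  rewrite prod_normE /= gt_max !ltr_norml.
  move: a1 a2 b1 b2 Nd AB1 AB2; clear => *.
  by rewrite -!andbA; apply/and4P; split; lra.
rewrite ltr_norml => /andP[_]; clear; lra.
Qed.

Lemma rect_integral_lt (f g : R * R -> R) : continuous f -> continuous g ->
  (forall p, f p <= g p) -> (exists p : R * R, [/\ p.1 \in `[0, A], p.2 \in `[0, B] & f p < g p]) ->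
  \int[mu2]_(p in `[0, A] `*` `[0, B]) f p < \int[mu2]_(p in `[0, A] `*` `[0, B]) g p.
Proof.
move=> cf cg fg [p [p1 p2 fgp]].
pose h q := g q - f q.
have ch : continuous h by move=> q; apply: cvgB; [exact: cg|exact: cf].
have h0 q : 0 <= h q by rewrite subr_ge0.
have hp : 0 < h p by rewrite subr_gt0.
have hp2 : 0 < h p / 2 by rewrite divr_gt0.
have Ig := rect_integrable A0 B0 cg; have If := rect_integrable A0 B0 cf.
have Ih := rect_integrable A0 B0 ch.
rewrite -subr_gt0 -RintegralB//; last exact: measurable_rect.
have [d d0 dP] := unif_cont_compact (@rect_compact R 0 A 0 B) ch hp2.
have itv (C x : R) : 0 < C -> x \in `[0, C] -> exists a b : R, [/\ a < b, 0 <= a, b <= C & forall y, a <= y <= b -> `|x - y| < d].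
  rewrite in_itv /= => C0 /andP[x0 xC].
  pose a := Num.max 0 (x - d / 2); pose b := Num.min C (x + d / 2).
  have a1 : 0 <= a by rewrite le_max lexx.
  have a2 : x - d / 2 <= a by rewrite le_max lexx orbT.
  have b1 : b <= C by rewrite ge_min lexx.
  have b2 : b <= x + d / 2 by rewrite ge_min lexx orbT.
  have ab : a < b.
    rewrite lt_min !gt_max; move: C0 x0 xC d0; clear => *.
    by rewrite -!andbA; apply/and4P; split; lra.
  exists a, b; split => // y /andP[ay yb].
  by move: d0 a2 b2 ay yb; clear => *; rewrite ltr_norml; apply/andP; split; lra.
have [a [b [ab a0 bA xab]]] := itv A p.1 A0 p1.
have [c [e [ce c0 eB yce]]] := itv B p.2 B0 p2.
have near_p (q : R * R) : a <= q.1 <= b -> c <= q.2 <= e -> `|p - q| < d.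
  by move=> q1 q2; rewrite prod_normE /= gt_max; apply/andP; split; [exact: xab|exact: yce].
pose S : set (measurableTypeR R * measurableTypeR R) := `[a, b] `*` `[c, e].
have mS : measurable S by apply: measurableX; exact: measurable_itv.
have IS : mu2.-integrable (`[0, A] `*` `[0, B]) (EFin \o (fun q => h p / 2 * \1_S q)).
  apply: (@rect_bounded_integrable _ A B A0 B0 _ `|h p / 2|).
    by apply: measurable_funM => //; exact: measurable_indic.
  by move=> q _; rewrite indicE; case: (_ \in _); rewrite ?mulr1 ?mulr0 ?normr0.
have I1 : mu2.-integrable (`[0, A] `*` `[0, B]) (EFin \o \1_S).
  apply: (@rect_bounded_integrable _ A B A0 B0 _ 1); first exact: measurable_indic.
  by move=> q _; rewrite indicE; case: (_ \in _); rewrite ?normr1 ?normr0.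
have : 0 < \int[mu2]_(q in `[0, A] `*` `[0, B]) (h p / 2 * \1_S q).
  rewrite RintegralZl//; last exact: measurable_rect.
  rewrite mulr_gt0// /Rintegral integral_indic//; last exact: measurable_rect.
  rewrite classical_sets.setIidl.
    rewrite (congr1 fine (product_itvE true false true false (ltW ab) (ltW ce))) /=.
    by rewrite mulr_gt0// subr_gt0.
  move=> q [/=]; rewrite !in_itv /= => /andP[q1 q2] /andP[q3 q4].
  by split; rewrite /= ?in_itv /=; apply/andP; split;
    [exact: (le_trans a0 q1)|exact: (le_trans q2 bA)|exact: (le_trans c0 q3)|exact: (le_trans q4 eB)].
move=> h1; apply: lt_le_trans h1 _; apply: le_Rintegral => //; first exact: measurable_rect.
move=> /= q rq; rewrite indicE; have [|_] := boolP (q \in S); last by rewrite mulr0 h0.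
rewrite inE => -[q1 q2]; rewrite mulr1 -/(h q).
have : `|h p - h q| < h p / 2.
  apply: (dP p q); [by split|exact: rq|apply: near_p].
    by move: q1; rewrite /= in_itv.
  by move: q2; rewrite /= in_itv.
by rewrite ltr_norml => /andP[_]; clear; lra.
Qed.

End RiemannSum.

(** * Wedge products of almost unit covectors *)

Section WedgeBound.
Context {R : realType}.

Lemma quad_le (X r c : R) : 0 < r -> 0 <= c -> X ^+ 2 <= r * X + c -> X <= r + c / r.
Proof.
move=> r0 c0 h; have [Xr|rX] := leP X r.
  by apply: le_trans Xr _; rewrite lerDl divr_ge0// ltW.
have X0 : 0 < X by exact: lt_trans rX.
rewrite -lerBlDl ler_pdivlMr// -(lerD2l (r * X)).
apply: le_trans h; rewrite expr2.
have : 0 <= (X - r) * (X - r) by rewrite -expr2 sqr_ge0.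
by clear; lra.
Qed.

Variables (E F G : R) (rho kap C1 C2 : R) (xi zeta : R * R).
Hypothesis E0 : 0 < E.
Hypothesis D0 : 0 < E * G - F ^+ 2.
Hypothesis rho0 : 0 < rho.
Hypothesis kap0 : 0 < kap.
Hypothesis C10 : 0 < C1.
Hypothesis C20 : 0 < C2.
Local Notation q := (qf E F G).
Hypothesis xiP : forall w : R * R, `|w.1| <= 1 -> `|w.2| <= 1 ->
  w.1 * xi.1 + w.2 * xi.2 <= Num.sqrt (q w) + kap.
Hypothesis zetaP : forall w : R * R, `|w.1| <= 1 -> `|w.2| <= 1 ->
  w.1 * zeta.1 + w.2 * zeta.2 <= rho * Num.sqrt (q w) + kap.
Hypothesis z1 : `|zeta.1| <= C1.
Hypothesis z2 : `|zeta.2| <= C1.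
Hypothesis a1 : `|G * zeta.1 - F * zeta.2| <= C2.
Hypothesis a2 : `|E * zeta.2 - F * zeta.1| <= C2.

Lemma qf_scale (s : R) (w : R * R) : 0 <= s ->
  Num.sqrt (q (s * w.1, s * w.2)) = s * Num.sqrt (q w).
Proof.
move=> s0; rewrite -[X in _ = X * _](ger0_norm s0) -sqrtr_sqr -sqrtrM ?sqr_ge0//; congr Num.sqrt.
by rewrite /qf /=; ring.
Qed.

(** Rescaling to vectors of size [S]; the additive error is not homogeneous and picks up the factor
    [S]. *)
Lemma covector_scale (eta : R * R) (r S : R) (v : R * R) : 0 < S ->
  (forall w : R * R, `|w.1| <= 1 -> `|w.2| <= 1 ->
    w.1 * eta.1 + w.2 * eta.2 <= r * Num.sqrt (q w) + kap) ->
  `|v.1| <= S -> `|v.2| <= S ->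
  v.1 * eta.1 + v.2 * eta.2 <= r * Num.sqrt (q v) + kap * S.
Proof.
move=> S0 h v1 v2.
have n1 (x : R) : `|x| <= S -> `|S^-1 * x| <= 1.
  by move=> xS; rewrite normrM gtr0_norm ?invr_gt0// ler_pdivrMl// mulr1.
have := h (S^-1 * v.1, S^-1 * v.2) (n1 _ v1) (n1 _ v2).
rewrite /= qf_scale ?invr_ge0 ?(ltW S0)// -(ler_pM2l S0).
have -> : S * (S^-1 * v.1 * eta.1 + S^-1 * v.2 * eta.2) = v.1 * eta.1 + v.2 * eta.2.
  by field; rewrite gt_eqF.
suff -> : S * (r * (S^-1 * Num.sqrt (q v)) + kap) = r * Num.sqrt (q v) + kap * S by [].
by field; rewrite gt_eqF.
Qed.

(* With J zeta = (- zeta.2, zeta.1) and v = adj(q) zeta one has               *)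
(* q v = det(q) q(J zeta) and zeta(v) = q(J zeta), so the bound on zeta gives *)
(* sqrt (q (J zeta)) <= rho sqrt(det q), and the bound on xi concludes.       *)
Lemma wedge_bound :
  zeta.1 * xi.2 - zeta.2 * xi.1 <=
  rho * Num.sqrt (E * G - F ^+ 2) +
  kap * (C1 + C2 / (rho * Num.sqrt (E * G - F ^+ 2))).
Proof.
set D := E * G - F ^+ 2; have D0' : 0 < D := D0.
pose J : R * R := (- zeta.2, zeta.1).
pose v : R * R := (G * zeta.1 - F * zeta.2, E * zeta.2 - F * zeta.1).
set X := Num.sqrt (q J).
have sD0 : 0 < Num.sqrt D by rewrite sqrtr_gt0.
have r0 : 0 < rho * Num.sqrt D by rewrite mulr_gt0.
have XX : X ^+ 2 = q J by rewrite sqr_sqrtr// qf_ge0.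
have qv : Num.sqrt (q v) = Num.sqrt D * X.
  rewrite -sqrtrM ?(ltW D0')//; congr Num.sqrt.
  by rewrite /qf /v /J /D /=; ring.
have zv : v.1 * zeta.1 + v.2 * zeta.2 = X ^+ 2 by rewrite XX /qf /v /J /=; ring.
have h1 : X <= rho * Num.sqrt D + kap * C2 / (rho * Num.sqrt D).
  apply: quad_le => //; first by rewrite mulr_ge0 ?ltW.
  rewrite -zv -mulrA -qv; exact: (@covector_scale zeta rho C2 v C20 zetaP a1 a2).
have xiP' w : `|w.1| <= 1 -> `|w.2| <= 1 -> w.1 * xi.1 + w.2 * xi.2 <= 1 * Num.sqrt (q w) + kap.
  by rewrite mul1r; exact: xiP.
have := covector_scale (v := J) C10 xiP'.
rewrite /= normrN -/X mul1r => /(_ z2 z1) h2.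
have -> : kap * (C1 + C2 / (rho * Num.sqrt D)) = kap * C1 + kap * C2 / (rho * Num.sqrt D) by ring.
by move: h1 h2; lra.
Qed.

End WedgeBound.

(** * The inequality weighted by a conformal factor *)

Section MainInequality.
Context {R : realType}.
Variable beta : R.
Hypothesis beta0 : 0 < beta.
Local Notation mu := (@lebesgue_measure R).
Local Notation mu2 := (mu \x mu)%E.

Definition kscale_E (K : kform beta) (rho : R * R -> R) (p : R * R) := rho p ^+ 2 * kE K p.
Definition kscale_F (K : kform beta) (rho : R * R -> R) (p : R * R) := rho p ^+ 2 * kF K p.
Definition kscale_G (K : kform beta) (rho : R * R -> R) (p : R * R) := rho p ^+ 2 * kG K p.

Lemma cvgM_sqr (f g : R * R -> R) : continuous f -> continuous g ->
  continuous (fun p => f p ^+ 2 * g p).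
Proof.
move=> cf cg p; apply: cvgM; last exact: cg.
by rewrite expr2; apply: cvgM; exact: cf.
Qed.

Lemma kscale_exists (K : kform beta) (rho : R * R -> R) :
  continuous rho -> (forall p, 0 < rho p) -> (forall p, rho (glide p) = rho p) ->
  (forall p, rho (vtrans beta p) = rho p) ->
  exists K2 : kform beta, forall p v, nrm K2 p v = rho p * nrm K p v.
Proof.
move=> cr r0 rg rv.
have r2 p : 0 < rho p ^+ 2 by rewrite exprn_gt0.
exists (@KForm R beta (kscale_E K rho) (kscale_F K rho) (kscale_G K rho)
  (cvgM_sqr cr (@kE_cont _ _ K)) (cvgM_sqr cr (@kF_cont _ _ K)) (cvgM_sqr cr (@kG_cont _ _ K))
  (fun p => ltac:(by rewrite /kscale_E rg kE_glide))
  (fun p => ltac:(by rewrite /kscale_F rg kF_glide mulrN))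
  (fun p => ltac:(by rewrite /kscale_G rg kG_glide))
  (fun p => ltac:(by rewrite /kscale_E rv kE_vtrans))
  (fun p => ltac:(by rewrite /kscale_F rv kF_vtrans))
  (fun p => ltac:(by rewrite /kscale_G rv kG_vtrans))
  (fun p => ltac:(by rewrite mulr_gt0 ?kE_gt0))
  (fun p => ltac:(by rewrite /kscale_E /kscale_F /kscale_G exprMn mulrACA -expr2 -mulrBr mulr_gt0 ?kD_gt0// exprn_gt0))).
move=> p v; rewrite /nrm /= /kscale_E /kscale_F /kscale_G.
rewrite -[X in _ = X * _](gtr0_norm (r0 p)) -sqrtr_sqr -sqrtrM ?sqr_ge0//; congr Num.sqrt.
by rewrite /qf; ring.
Qed.

Variables (K K2 : kform beta) (rho : R * R -> R).
Hypothesis rho_cont : continuous rho.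
Hypothesis rho_gt0 : forall p, 0 < rho p.
Hypothesis rho_glide : forall p, rho (glide p) = rho p.
Hypothesis rho_vtrans : forall p, rho (vtrans beta p) = rho p.
Hypothesis K2E : forall p v, nrm K2 p v = rho p * nrm K p v.
Variables (L l : R).
Hypothesis L0 : 0 <= L.
Hypothesis l0 : 0 <= l.
Hypothesis LP : forall p, L <= dist K2 p (p + hvec).
Hypothesis lP : forall p, l <= dist K p (p + tvec beta).

Definition area_density (p : R * R) : R := Num.sqrt (kE K p * kG K p - kF K p ^+ 2).

Lemma area_density_cont : continuous area_density.
Proof.
move=> p; apply: (@continuous_comp _ _ _ (fun p => kE K p * kG K p - kF K p ^+ 2)); last exact: sqrt_continuous.
apply: cvgB; first by apply: cvgM; [exact: kE_cont|exact: kG_cont].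
by rewrite expr2; apply: cvgM; exact: kF_cont.
Qed.

Lemma area_density_gt0 p : 0 < area_density p.
Proof. by rewrite sqrtr_gt0 kD_gt0. Qed.

Lemma area_density_glide p : area_density (glide p) = area_density p.
Proof. by rewrite /area_density kE_glide kF_glide kG_glide sqrrN. Qed.

Lemma area_density_vtrans p : area_density (vtrans beta p) = area_density p.
Proof. by rewrite /area_density kE_vtrans kF_vtrans kG_vtrans. Qed.

(** With respect to [K], [du] has norm at most 1 and [dw] at most [rho], as [w] is calibrated for
    [K2]. Hence a single factor [rho], whereas the area of [K2] carries [rho ^+ 2]. *)
Let dens p := rho p * area_density p.

Let dens_h p : dens (p + hvec) = dens p.
Proof. by rewrite /dens -glide_glide !rho_glide !area_density_glide. Qed.

Let dens_t p : dens (p + tvec beta) = dens p.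
Proof. by rewrite /dens -vtransE rho_vtrans area_density_vtrans. Qed.

Let dens_gt0 p : 0 < dens p.
Proof. by rewrite mulr_gt0 ?area_density_gt0. Qed.

Let dens_cont : continuous dens.
Proof. by move=> p; apply: cvgM; [exact: rho_cont|exact: area_density_cont]. Qed.

Lemma nrm_step (p w : R * R) : nrm K p (pi * w.1, 2 * beta * w.2) =
  Num.sqrt (qf (pi ^+ 2 * kE K p) (pi * (2 * beta) * kF K p) ((2 * beta) ^+ 2 * kG K p) w).
Proof. by congr Num.sqrt; rewrite /qf /=; ring. Qed.

Lemma step_det p : (pi ^+ 2 * kE K p) * ((2 * beta) ^+ 2 * kG K p) -
    (pi * (2 * beta) * kF K p) ^+ 2 = (pi * (2 * beta)) ^+ 2 * (kE K p * kG K p - kF K p ^+ 2).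
Proof. by ring. Qed.

Definition cup_cell (W U : nat -> nat -> R) (i j : nat) : R :=
  (W i.+1 j - W i j) * (U i.+1 j.+1 - U i.+1 j) -
  (W i j.+1 - W i j) * (U i.+1 j.+1 - U i j.+1).

(** Up to mixed second differences, which averaging makes of order [1 / (k N)], the cup product on a
    cell is the wedge product of the two discrete gradients at its corner, and [wedge_bound] applies
    to these. *)
Lemma grid_cell_bound (kap : R) : 0 < kap ->
  exists k : nat, (0 < k)%N /\ exists N0 : nat, forall N : nat, (0 < N)%N -> (N0 <= N)%N ->
  forall u w, lip K u -> lip K2 w -> forall i j : nat,
  N%:R ^+ 2 * cup_cell (gavg beta N w k) (gavg beta N u k) i j <=
  pi * (2 * beta) * dens (gpt beta N i j) + kap.
Proof.
move=> kap0.
have [CU CU0 CUP] := gradient_const beta0 K.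
have [CW CW0 CWP] := gradient_const beta0 K2.
have p0 := pi_gt0 R; have b20 : 0 < 2 * beta by rewrite mulr_gt0.
have pb0 : 0 < pi * (2 * beta) :> R by rewrite mulr_gt0.
have [r0 r00 r0P] := periodic_min_gt0 beta0 dens_cont dens_h dens_t dens_gt0.
pose m p := pi ^+ 2 * kE K p + pi * (2 * beta) * `|kF K p| + (2 * beta) ^+ 2 * kG K p.
have cm : continuous m.
  move=> p; apply: cvgD; first apply: cvgD.
  - by apply: cvgM; [exact: cvg_cst|exact: kE_cont].
  - by apply: cvgM; [exact: cvg_cst|apply: cvg_norm; exact: kF_cont].
  - by apply: cvgM; [exact: cvg_cst|exact: kG_cont].
have [|| M MP] := periodic_max beta0 cm.
- by move=> p; rewrite /m kE_h kF_h kG_h.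
- by move=> p; rewrite /m kE_t kF_t kG_t.
have m0 p : [/\ 0 < pi ^+ 2 * kE K p, 0 <= pi * (2 * beta) * `|kF K p| & 0 < (2 * beta) ^+ 2 * kG K p].
  by rewrite !mulr_gt0 ?exprn_gt0 ?kE_gt0 ?kG_gt0// mulr_ge0 ?(ltW pb0).
have M0 : 0 < M.
  by apply: lt_le_trans (MP 0); have [h1 h2 h3] := m0 0; rewrite /m; move: h1 h2 h3; lra.
pose C2 := M * CW.
have C20 : 0 < C2 by rewrite mulr_gt0.
(* An upper bound, uniform in the point, for the factor of [kap] in [wedge_bound], as [r0] bounds
   [dens] from below. *)
pose c := CW + C2 / (pi * (2 * beta) * r0).
have c0 : 0 < c by rewrite addr_gt0// divr_gt0// mulr_gt0.
pose kap1 := kap / 2 / c.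
have kap10 : 0 < kap1 by rewrite !divr_gt0.
have [k1 k1P] := gradient_bound beta0 K kap10.
have [k2 k2P] := gradient_bound beta0 K2 kap10.
have [k3 [k30 k3P]] := exists_nat_gt (8 * CU * CW / kap).
pose k := maxn k1 (maxn k2 k3).
have k0 : (0 < k)%N by rewrite !leq_max k30 !orbT.
have [N1 N1P] := k1P k (leq_maxl _ _).
have [N2 N2P] := k2P k (leq_trans (leq_maxl _ _) (leq_maxr _ _)).
have kR0 : 0 < k%:R :> R by rewrite ltr0n.
have kP : 8 * CU * CW <= k%:R * kap.
  by rewrite -ler_pdivrMr//; apply: le_trans k3P _; rewrite ler_nat !leq_max leqnn !orbT.
exists k; split => //; exists (maxn N1 N2) => N N0; rewrite geq_max => /andP[NN1 NN2].
move=> u w ul wl i j; set U := gavg beta N u k; set W := gavg beta N w k.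
rewrite /cup_cell.
have NR0 : 0 < N%:R :> R by rewrite ltr0n.
have [fu1 fu2] := CUP N u N0 ul; have [fw1 fw2] := CWP N w N0 wl.
set p := gpt beta N i j.
have gU := N1P N NN1 u ul i j; have gW := N2P N NN2 w wl i j.
rewrite -/U -/p in gU; rewrite -/W -/p in gW.
pose xi : R * R := (N%:R * (U i.+1 j - U i j), N%:R * (U i j.+1 - U i j)).
pose zeta : R * R := (N%:R * (W i.+1 j - W i j), N%:R * (W i j.+1 - W i j)).
have NC (C x : R) : `|x| <= C / N%:R -> `|N%:R * x| <= C.
  by move=> h; rewrite normrM gtr0_norm// -ler_pdivlMl// mulrC.
have z1 : `|zeta.1| <= CW by apply: NC; exact: bavg_d1 k0 fw1 i j.
have z2 : `|zeta.2| <= CW by apply: NC; exact: bavg_d2 k0 fw2 i j.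
have [e1 e2 e3] := m0 p; have Mp := MP p.
have nF : `|pi * (2 * beta) * kF K p| = pi * (2 * beta) * `|kF K p|.
  by rewrite normrM gtr0_norm.
have bnd (A B x y : R) : `|x| <= CW -> `|y| <= CW -> `|A| + `|B| <= M -> `|A * x - B * y| <= C2.
  move=> xC yC AB; apply: le_trans (ler_normB _ _) _; rewrite !normrM.
  apply: le_trans (lerD (ler_wpM2l (normr_ge0 _) xC) (ler_wpM2l (normr_ge0 _) yC)) _.
  by rewrite -mulrDl ler_pM2r.
have wb := @wedge_bound R (pi ^+ 2 * kE K p) (pi * (2 * beta) * kF K p) ((2 * beta) ^+ 2 * kG K p)
  (rho p) kap1 CW C2 xi zeta e1 _ (rho_gt0 p) kap10 CW0 C20 _ _ z1 z2 _ _.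
have {wb} wb : zeta.1 * xi.2 - zeta.2 * xi.1 <= pi * (2 * beta) * dens p + kap / 2.
  have E : rho p * Num.sqrt ((pi ^+ 2 * kE K p) * ((2 * beta) ^+ 2 * kG K p) -
      (pi * (2 * beta) * kF K p) ^+ 2) = pi * (2 * beta) * dens p.
    rewrite step_det sqrtrM ?sqr_ge0// sqrtr_sqr gtr0_norm// /dens /area_density; ring.
  rewrite E in wb; apply: le_trans (wb _ _ _ _ _) _.
  - by rewrite step_det mulr_gt0 ?exprn_gt0 ?kD_gt0.
  - move=> v v1 v2; rewrite -nrm_step; apply: le_trans (gU v v1 v2).
    by rewrite le_eqVlt /xi /=; apply/orP; left; apply/eqP; ring.
  - move=> v v1 v2; rewrite -nrm_step -K2E; apply: le_trans (gW v v1 v2).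
    by rewrite le_eqVlt /zeta /=; apply/orP; left; apply/eqP; ring.
  - apply: bnd => //; rewrite nF gtr0_norm//; apply: le_trans Mp.
    by rewrite /m; move: e1 e2 e3; lra.
  - apply: bnd => //; rewrite nF gtr0_norm//; apply: le_trans Mp.
    by rewrite /m; move: e1 e2 e3; lra.
  rewrite lerD2l; have -> : kap / 2 = kap1 * c by rewrite /kap1; field; rewrite gt_eqF.
  rewrite ler_pM2l// lerD2l ler_pM2l// lef_pV2 ?posrE ?mulr_gt0 ?area_density_gt0//.
  by rewrite ler_pM2l.
have cw : `|W i.+1 j - W i j| <= CW / N%:R by exact: bavg_d1 k0 fw1 i j.
have cw2 : `|W i j.+1 - W i j| <= CW / N%:R by exact: bavg_d2 k0 fw2 i j.
have d1 : `|(U i.+1 j.+1 - U i.+1 j) - (U i j.+1 - U i j)| <= 2 * (CU / N%:R) / k%:R.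
  exact: bavg_D12 k0 fu2 i j.
have d2 : `|(U i.+1 j.+1 - U i j.+1) - (U i.+1 j - U i j)| <= 2 * (CU / N%:R) / k%:R.
  by apply: le_trans d1; rewrite le_eqVlt; apply/orP; left; apply/eqP; congr `|_|; ring.
have e4 : N%:R ^+ 2 * (CW / N%:R * (2 * (CU / N%:R) / k%:R)) <= kap / 4.
  have -> : N%:R ^+ 2 * (CW / N%:R * (2 * (CU / N%:R) / k%:R)) = 2 * CU * CW / k%:R.
    by field; rewrite !gt_eqF.
  by rewrite ler_pdivrMr//; move: kP; lra.
have prod (x y : R) : `|x| <= CW / N%:R -> `|y| <= 2 * (CU / N%:R) / k%:R ->
    `|N%:R ^+ 2 * (x * y)| <= kap / 4.
  move=> hx hy; apply: le_trans e4; rewrite normrM ger0_norm ?sqr_ge0// normrM.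
  by rewrite ler_pM2l ?exprn_gt0// ler_pM.
have := prod _ _ cw d1; have := prod _ _ cw2 d2; rewrite !ler_norml => /andP[h1 _] /andP[_ h2].
have -> : N%:R ^+ 2 * ((W i.+1 j - W i j) * (U i.+1 j.+1 - U i.+1 j) -
     (W i j.+1 - W i j) * (U i.+1 j.+1 - U i j.+1)) =
   (zeta.1 * xi.2 - zeta.2 * xi.1) +
   N%:R ^+ 2 * ((W i.+1 j - W i j) * (U i.+1 j.+1 - U i.+1 j - (U i j.+1 - U i j))) -
   N%:R ^+ 2 * ((W i j.+1 - W i j) * (U i.+1 j.+1 - U i j.+1 - (U i.+1 j - U i j))).
  by rewrite /zeta /xi /=; ring.
by move: h1 h2 wb; lra.
Qed.

Lemma gavg_shift1 N u k (c : R) i j : (0 < N)%N -> (0 < k)%N -> (forall p, u (p + hvec) = u p + c) ->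
  gavg beta N u k (i + 2 * N) j = gavg beta N u k i j + c.
Proof.
move=> N0 k0 uc; rewrite /gavg /bavg.
have NR0 : N%:R != 0 :> R by rewrite pnatr_eq0 -lt0n.
have kR0 : k%:R != 0 :> R by rewrite pnatr_eq0 -lt0n.
have -> : \sum_(a < k) \sum_(b < k) u (gpt beta N (i + 2 * N + a) (j + b)) =
   \sum_(a < k) \sum_(b < k) u (gpt beta N (i + a) (j + b)) + k%:R ^+ 2 * c.
  have -> : k%:R ^+ 2 * c = \sum_(a < k) \sum_(b < k) c.
    by rewrite !sumr_const !card_ord -mulrnA -[RHS]mulr_natl natrM expr2.
  rewrite -big_split; apply: eq_bigr => a _ /=; rewrite -big_split; apply: eq_bigr => b _ /=.
  rewrite -uc; congr u; apply: pair_ext; rewrite /= ?addr0//.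
  have -> : (i + 2 * N + a)%:R = i%:R + 2 * N%:R + a%:R :> R by rewrite natrD natrD natrM.
  by rewrite natrD; field.
by field.
Qed.

Lemma gavg_shift2 N u k (c : R) i j : (0 < N)%N -> (0 < k)%N -> (forall p, u (p + tvec beta) = u p + c) ->
  gavg beta N u k i (j + N) = gavg beta N u k i j + c.
Proof.
move=> N0 k0 uc; rewrite /gavg /bavg.
have NR0 : N%:R != 0 :> R by rewrite pnatr_eq0 -lt0n.
have kR0 : k%:R != 0 :> R by rewrite pnatr_eq0 -lt0n.
have -> : \sum_(a < k) \sum_(b < k) u (gpt beta N (i + a) (j + N + b)) =
   \sum_(a < k) \sum_(b < k) u (gpt beta N (i + a) (j + b)) + k%:R ^+ 2 * c.
  have -> : k%:R ^+ 2 * c = \sum_(a < k) \sum_(b < k) c.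
    by rewrite !sumr_const !card_ord -mulrnA -[RHS]mulr_natl natrM expr2.
  rewrite -big_split; apply: eq_bigr => a _ /=; rewrite -big_split; apply: eq_bigr => b _ /=.
  rewrite -uc; congr u; apply: pair_ext; rewrite /= ?addr0//.
  by rewrite !natrD; field.
by field.
Qed.

(* The glide reflection maps the second half of the torus to the first one.   *)
Lemma sum_torus_dens N : (0 < N)%N ->
  \sum_(i < 2 * N) \sum_(j < N) dens (gpt beta N i j) =
  2 * \sum_(i < N) \sum_(j < N) dens (gpt beta N i j).
Proof.
move=> N0; have NR0 : N%:R != 0 :> R by rewrite pnatr_eq0 -lt0n.
rewrite mul2n -addnn big_split_ord /= mulr2n mulrDl !mul1r; congr (_ + _).
apply: eq_bigr => i _.
have E (j : nat) : (j <= N)%N -> dens (gpt beta N (N + i) j) = dens (gpt beta N i (N - j)).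
  move=> jN; rewrite -[LHS]dens_t -[in RHS]/(dens _).
  have -> : gpt beta N (N + i) j + tvec beta = gpt beta N (N + i) (j + N).
    by apply: pair_ext; rewrite /= ?addr0// !natrD; field.
  rewrite -[RHS]dens_t.
  have -> : dens (gpt beta N (N + i) (j + N)) = dens (glide (gpt beta N (N + i) (j + N))).
    by rewrite /dens rho_glide area_density_glide.
  rewrite -dens_t -dens_t -dens_t -[RHS]dens_h.
  congr dens; apply: pair_ext; rewrite /= !natrD ?natrB//; field => //.
rewrite (eq_bigr (fun j : 'I_N => dens (gpt beta N i (N - j)%N))); last first.
  by move=> j _; rewrite -E// ltnW.
(* The reflected index [N - j] runs over [1 .. N] instead of [0 .. N - 1]; a telescoping sum
   exchanges the two ends, where the periodic density takes the same value. *)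
have := telescope_ordN N (fun j => dens (gpt beta N i (N - j)%N)).
rewrite sumrB subn0 subnn.
have -> : dens (gpt beta N i N) = dens (gpt beta N i 0).
  rewrite -[RHS]dens_t; congr dens; apply: pair_ext; rewrite /= ?addr0//.
  by rewrite mulr0n mulr0 mul0r add0r; field.
rewrite subrr => /eqP; rewrite subr_eq0 => /eqP ->.
rewrite (reindex_inj rev_ord_inj) /=; apply: eq_bigr => j _.
by congr (dens (gpt beta N i _)); rewrite subnSK// subKn// ltnW.
Qed.

Lemma main_inequality : L * l <= 2 * \int[mu2]_(p in `[0, pi] `*` `[0, 2 * beta]) dens p.
Proof.
apply/ler_addgt0Pr => e e0.
have p0 := pi_gt0 R; have b20 : 0 < 2 * beta by rewrite mulr_gt0.
(* Each of the [2 N ^ 2] cells costs [e / 4], and the Riemann sum is used twice; after division by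
   [N ^ 2] the errors add up to [e]. *)
have e4 : 0 < e / 4 by rewrite divr_gt0.
have [k [k0 [N1 N1P]]] := grid_cell_bound e4.
have [N2 N2P] := riemann_sum_le p0 b20 dens_cont (fun p => ltW (dens_gt0 p)) e4.
pose N := (maxn N1 N2).+1.
have N0 : (0 < N)%N by [].
have NR0 : 0 < N%:R :> R by rewrite ltr0n.
have [w [w1 w2 w3]] := calibration_h beta0 LP L0.
have [u [u1 u2 u3]] := calibration_t beta0 lP l0.
pose U := gavg beta N u k; pose W := gavg beta N w k.
have cell := N1P N N0 (leq_trans (leq_maxl _ _) (leqnSn _)) u w u3 w3.
have S := @discrete_stokes R (2 * N) N W U L l.
have {}S := S (fun j => gavg_shift1 0 j N0 k0 w1) _ _ (fun i => gavg_shift2 i 0 N0 k0 u2).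
rewrite -{}S; last 2 first.
- by move=> i; rewrite /W -[N in gavg _ _ _ _ _ N]add0n (gavg_shift2 (c := 0)) ?addr0// => p; rewrite w2 addr0.
- by move=> j; rewrite /U -[(2 * N)%N]add0n (gavg_shift1 (c := 0)) ?addr0// => p; rewrite u1 addr0.
rewrite -(ler_pM2l (exprn_gt0 2 NR0)) mulr_sumr.
apply: le_trans (_ : \sum_(i < 2 * N) \sum_(j < N) (pi * (2 * beta) * dens (gpt beta N i j) + e / 4) <= _).
  by apply: ler_sum => i _; rewrite mulr_sumr; apply: ler_sum => j _; exact: cell.
have -> : \sum_(i < 2 * N) \sum_(j < N) (pi * (2 * beta) * dens (gpt beta N i j) + e / 4) =
    pi * (2 * beta) * \sum_(i < 2 * N) \sum_(j < N) dens (gpt beta N i j) + N%:R ^+ 2 * (e / 2).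
  rewrite mulr_sumr (_ : N%:R ^+ 2 * (e / 2) = \sum_(i < 2 * N) \sum_(j < N) (e / 4)).
    rewrite -big_split; apply: eq_bigr => i _ /=; rewrite mulr_sumr -big_split.
    by apply: eq_bigr => j _.
  by rewrite !sumr_const !card_ord -mulrnA -[RHS]mulr_natl !natrM; field.
have := N2P N N0 (leq_trans (leq_maxr _ _) (leqnSn _)).
have T := sum_torus_dens N0; rewrite {}T.
have -> : \sum_(i < N) \sum_(j < N) dens (pi * i%:R / N%:R, 2 * beta * j%:R / N%:R) * (pi / N%:R * (2 * beta / N%:R)) =
  pi * (2 * beta) / N%:R ^+ 2 * \sum_(i < N) \sum_(j < N) dens (gpt beta N i j).
  rewrite mulr_sumr; apply: eq_bigr => i _; rewrite mulr_sumr; apply: eq_bigr => j _.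
  by rewrite /gpt; field; rewrite gt_eqF.
set S := \sum_(i < N) _; set I := Rintegral _ _ _ => h.
have N20 : 0 < N%:R ^+ 2 :> R by rewrite exprn_gt0.
have := ler_wpM2l (ltW N20) h.
have -> : N%:R ^+ 2 * (pi * (2 * beta) / N%:R ^+ 2 * S) = pi * (2 * beta) * S.
  by field; rewrite gt_eqF.
by move: N20; lra.
Qed.

End MainInequality.

(** * The strict inequality *)

Section LoopLength.
Context {R : realType}.

Lemma lipschitz_cont (V : normedModType R) (f : V -> R) (C : R) :
  (forall p q, `|f p - f q| <= C * `|p - q|) -> continuous f.
Proof.
move=> fC p; apply/cvgrPdist_lt => /= e e0.
have C0 : 0 < `|C| + 1 by rewrite ltr_wpDl.
apply/nbhs_ballP; exists (e / (`|C| + 1)); first by rewrite /= divr_gt0.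
move=> q; rewrite -ball_normE /= ltr_pdivlMr// mulrC => pq.
apply: le_lt_trans (fC p q) _; apply: le_lt_trans pq.
by rewrite ler_wpM2r// (le_trans (ler_norm _))// lerDl.
Qed.

Variable beta : R.
Hypothesis beta0 : 0 < beta.
Variable K : kform beta.
Local Notation d := (dist K).

Definition hdisp (p : R * R) : R := d p (p + hvec).

Lemma hvec_shift p q : d (p + hvec) (q + hvec) = d p q.
Proof. by rewrite -(lat10 beta) dist_lat. Qed.

Lemma tvec_shift p q : d (p + tvec beta) (q + tvec beta) = d p q.
Proof. by rewrite -(lat01 beta) dist_lat. Qed.

Lemma glide_hvec (p : R * R) : glide (p + hvec) = glide p + hvec.
Proof. by apply: pair_ext; rewrite /=; lra. Qed.

Lemma hdisp_glide p : hdisp (glide p) = hdisp p.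
Proof. by rewrite /hdisp -glide_hvec dist_glide. Qed.

Lemma hdisp_vtrans p : hdisp (vtrans beta p) = hdisp p.
Proof. by rewrite /hdisp vtransE addrAC tvec_shift. Qed.

Lemma hdisp_lip p q : hdisp p <= hdisp q + 2 * d p q.
Proof.
have := dist_triangle K q p (p + hvec); have := dist_triangle K (q + hvec) q (p + hvec).
by rewrite /hdisp hvec_shift (dist_sym K q p); lra.
Qed.

Lemma hdisp_cont : continuous hdisp.
Proof.
have [C C0 CP] := dist_upper K beta0.
have lipC p q : `|hdisp p - hdisp q| <= 2 * C * `|p - q|.
  have h := CP p q; have h3 := hdisp_lip p q; have h4 := hdisp_lip q p.
  by rewrite (dist_sym K q p) in h4; rewrite ler_norml; apply/andP; split; lra.
exact: lipschitz_cont lipC.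
Qed.

Variables (L : R) (K2 : kform beta).
Hypothesis L0 : 0 < L.
Hypothesis LP : forall p, L <= hdisp p.
Hypothesis K2E : forall p v, nrm K2 p v = L / hdisp p * nrm K p v.

(* Every point of a loop of class [hvec] is moved by [hvec] at most as far as *)
(* the length of the loop.                                                    *)
Lemma plen_scaled (p0 p : R * R) (s : seq (R * R)) (a lam : R) :
  d p0 p <= a -> a + plen K p s <= lam -> last p s = p0 + hvec ->
  L / lam * plen K p s <= plen K2 p s.
Proof.
elim: s p a => [|q s IH] p a pa al sl; first by rewrite /= mulr0.
rewrite /= in al sl *.
have qa : d p0 q <= a + seg K p q.
  by apply: le_trans (dist_triangle K p _ _) _; rewrite lerD// dist_seg.
rewrite mulrDr lerD//; last by apply: IH qa _ sl; rewrite -addrA.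
(* From [z] the rest of the polygon leads to [p0 + hvec], and the translate of the part from [p0] to
   [z] leads on to [z + hvec]. *)
have e_le t : t \in `[0, 1] -> hdisp (p + t *: (q - p)) <= lam.
  rewrite in_itv /= => /andP[t0 t1]; set z := p + _.
  have sp := seg_split K p q t0 t1; rewrite -segE -/z in sp.
  have zp : seg K (p + 0 *: (q - p)) z = seg K p z by rewrite scale0r addr0.
  have zq : seg K z (p + 1 *: (q - p)) = seg K z q by rewrite scale1r [p + _]addrC subrK.
  rewrite zp zq in sp.
  have h1 := dist_seg K p z; have h2 := dist_seg K z q.
  have h3 := dist_le_plen K q s; rewrite sl in h3.
  have h4 := dist_triangle K (p0 + hvec) z (z + hvec); rewrite hvec_shift in h4.
  have h5 := dist_triangle K q z (p0 + hvec); have h6 := dist_triangle K p p0 z.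
  rewrite /hdisp; lra.
have lam0 : 0 < lam.
  by apply: lt_le_trans (e_le 0 _); [exact: lt_le_trans (LP _)|rewrite in_itv /= lexx ler01].
rewrite /seg -RintegralZl//; last exact: seg_int.
apply: le_Rintegral_itv.
- apply: (@continuous_integrable R (fun t => L / lam * nrm K (p + t *: (q - p)) (q - p))) => t.
  by apply: cvgM; [exact: cvg_cst|exact: nrm_line_cont].
- exact: seg_int.
move=> t t01; rewrite K2E ler_wpM2r ?nrm_ge0// ler_pM2l//.
by rewrite lef_pV2 ?posrE ?e_le//; exact: lt_le_trans (LP _).
Qed.

(** Taking for [lam] the full [K]-length of the loop, [plen_scaled] bounds its [K2]-length below by
    [L / lam * lam]. *)
Lemma scaled_loop p : L <= dist K2 p (p + hvec).
Proof.
apply: dist_lb => s sl.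
have h := @plen_scaled p p s 0 (plen K p s).
rewrite dist_refl add0r in h; have {}h := h (lexx _) (lexx _) sl.
have s0 : 0 < plen K p s.
  apply: lt_le_trans L0 _; apply: le_trans (LP p) _; rewrite /hdisp -sl.
  exact: dist_le_plen.
by rewrite divfK ?gt_eqF in h.
Qed.

End LoopLength.

Section StrictInequality.
Context {R : realType}.
Variable beta : R.
Hypothesis beta0 : 0 < beta.
Variable K : kform beta.
Local Notation d := (dist K).
Local Notation mu := (@lebesgue_measure R).
Local Notation mu2 := (mu \x mu)%E.
Variables (L l : R).
Hypothesis L0 : 0 < L.
Hypothesis l0 : 0 <= l.
Hypothesis LP : forall p, L <= d p (p + hvec).
Hypothesis lP : forall p, l <= d p (p + tvec beta).

Lemma strict_or_constant :
  L * l < 2 * (\int[mu2]_(p in `[0, pi] `*` `[0, 2 * beta]) area_density K p) \/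
  forall p, d p (p + hvec) = L.
Proof.
have p0 := pi_gt0 R; have b20 : 0 < 2 * beta by rewrite mulr_gt0.
pose rho p := L / hdisp K p.
have h0 p : 0 < hdisp K p by exact: lt_le_trans (LP p).
have cr : continuous rho.
  move=> p; apply: cvgM; first exact: cvg_cst.
  by apply: cvgV; [rewrite gt_eqF|exact: hdisp_cont].
have r0 p : 0 < rho p by rewrite divr_gt0.
have rg p : rho (glide p) = rho p by rewrite /rho hdisp_glide.
have rv p : rho (vtrans beta p) = rho p by rewrite /rho hdisp_vtrans.
have [K2 K2E] := kscale_exists K cr r0 rg rv.
have MI := main_inequality beta0 cr r0 rg rv K2E (ltW L0) l0 (scaled_loop L0 LP K2E) lP.
have cf : continuous (fun p => rho p * area_density K p).
  by move=> p; apply: cvgM; [exact: cr|exact: area_density_cont].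
have [[p pP]|none] := pselect (exists p : R * R, [/\ p.1 \in `[0, pi], p.2 \in `[0, 2 * beta] &
   rho p * area_density K p < area_density K p]).
  left; apply: le_lt_trans MI _; rewrite ltr_pM2l//.
  apply: rect_integral_lt => //; first exact: area_density_cont.
    by move=> q; rewrite ler_piMl ?(ltW (area_density_gt0 K q))// ler_pdivrMr// mul1r; exact: LP.
  by exists p.
right.
have base q : q.1 \in `[0, pi] -> q.2 \in `[0, 2 * beta] -> hdisp K q = L.
  move=> q1 q2; apply/eqP; rewrite eq_le LP andbT leNgt; apply/negP => Lq.
  apply: none; exists q; split => //.
  by rewrite gtr_pMl ?area_density_gt0// ltr_pdivrMr// mul1r.
have hh q : hdisp K (q + hvec) = hdisp K q by rewrite -glide_glide !hdisp_glide.
have ht q : hdisp K (q + tvec beta) = hdisp K q by rewrite -vtransE hdisp_vtrans.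
move=> p; rewrite -/(hdisp K p).
have [k [n [p1 p2]]] := lat_reduce beta0 p.
rewrite -(periodic_lat hh ht k n p).
move: (p + _) p1 p2 => {}p; rewrite !in_itv /= => /andP[p1 p1'] /andP[p2 p2'].
have [le|gt] := leP p.1 pi.
  by apply: base; rewrite in_itv /=; apply/andP.
(* The right half of the torus is carried to the fundamental rectangle by
   [(x, y) -> (x - pi, 2 beta - y)]. *)
rewrite -hdisp_glide -hh -(periodic_lat hh ht (-2) 1).
by apply: base; rewrite in_itv /=; apply/andP; split; lra.
Qed.

End StrictInequality.

(** * Infinitesimal comparison with Euclidean planes *)

Section Tripod.
Context {R : realType}.
Variable beta : R.
Hypothesis beta0 : 0 < beta.
Variable K : kform beta.
Local Notation d := (dist K).

Lemma nrm_compare (kap : R) : 0 < kap -> exists2 del : R, 0 < del &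
  forall p q v, `|p - q| < del -> nrm K p v <= (1 + kap) * nrm K q v.
Proof.
move=> kap0; have [c c0 cP] := nrm_lower K beta0.
have kc : 0 < kap * c by rewrite mulr_gt0.
have [del del0 dP] := nrm_unif K beta0 kc; exists del => // p q v pq.
apply: le_trans (dP _ _ _ pq) _; by rewrite mulrDl mul1r lerD2l -mulrA ler_pM2l.
Qed.

Lemma seg_chain (a b : R * R) (n : nat) : (0 < n)%N ->
  \sum_(i < n) seg K (a + (i%:R / n%:R) *: (b - a)) (a + (i.+1%:R / n%:R) *: (b - a)) = seg K a b.
Proof.
move=> n0.
have h (m : nat) : (m <= n)%N ->
    \sum_(i < m) seg K (a + (i%:R / n%:R) *: (b - a)) (a + (i.+1%:R / n%:R) *: (b - a)) =
    seg K (a + 0 *: (b - a)) (a + (m%:R / n%:R) *: (b - a)).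
  elim: m => [|m IH] mn.
    rewrite big_ord0 mul0r; have := seg_split K a b (lexx 0) (lexx 0); lra.
  rewrite big_ord_recr /= IH ?(ltnW mn)// -seg_split ?divr_ge0//.
  by rewrite ler_pM2r ?invr_gt0 ?ltr0n// ler_nat.
by rewrite h// divff ?pnatr_eq0 -?lt0n// -segE.
Qed.

(** The norm at [x] of [q - x], truncated at the level [r], increases along a segment by at most
    [1 + kap] times its length: near [x] the norms are comparable, and far away the truncated
    function is constant. So polygons that leave the neighbourhood of [x] need no separate
    treatment. *)
Lemma dist_local_lower (kap : R) : 0 < kap -> kap <= 1 -> exists2 eta : R, 0 < eta &
  forall x y, d x y < eta -> nrm K x (y - x) <= (1 + kap) * d x y.
Proof.
move=> kap0 kap1.
have [del del0 delP] := nrm_compare kap0.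
have [c c0 cP] := nrm_lower K beta0.
pose r := c * (del / 2).
have r0 : 0 < r by rewrite mulr_gt0// divr_gt0.
have k10 : 0 < 1 + kap by rewrite addr_gt0.
exists (r / 2); first by rewrite divr_gt0.
move=> x y xy.
pose f q := Num.min (nrm K x (q - x)) r.
have small a b : `|b - a| < del / 2 -> f b - f a <= (1 + kap) * seg K a b.
  move=> ab; have [ra|ar] := leP r (nrm K x (a - x)).
    rewrite {2}/f (min_idPr ra); apply: le_trans (_ : 0 <= _); first by rewrite subr_le0 ge_min lexx orbT.
    by rewrite mulr_ge0 ?seg_ge0// ltW.
  have ax : `|x - a| < del / 2.
    by rewrite -(ltr_pM2l c0) distrC; apply: le_lt_trans (cP x _) ar.
  rewrite {2}/f (min_idPl (ltW ar)).
  apply: le_trans (_ : nrm K x (b - a) <= _).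
    rewrite lerBlDr; apply: le_trans (_ : nrm K x (b - x) <= _); first by rewrite ge_min lexx.
    by rewrite -(subrKA a b (- x)); exact: nrm_triangle.
  rewrite -ler_pdivrMl//; apply: seg_ge => t; rewrite in_itv /= => /andP[t0 t1].
  rewrite ler_pdivrMl//; apply: delP.
  rewrite opprD addrA; apply: le_lt_trans (ler_normB _ _) _.
  rewrite normrZ (ger0_norm t0) (splitr del) ltr_leD//.
  by apply: le_trans (ltW ab); rewrite ler_piMl.
have big a b : f b - f a <= (1 + kap) * seg K a b.
  have [n [n0 nP]] := exists_nat_gt (`|b - a| / (del / 2) + 1).
  have nR0 : 0 < n%:R :> R by rewrite ltr0n.
  have nd : `|b - a| / n%:R < del / 2.
    rewrite ltr_pdivrMr// mulrC -ltr_pdivrMr ?divr_gt0//.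
    by apply: lt_le_trans nP; rewrite ltrDl.
  rewrite -(seg_chain a b n0) mulr_sumr.
  have -> : f b - f a = \sum_(i < n) (f (a + (i.+1%:R / n%:R) *: (b - a)) - f (a + (i%:R / n%:R) *: (b - a))).
    rewrite (telescope_ord n (fun i => f (a + (i%:R / n%:R) *: (b - a)))) mul0r scale0r addr0.
    by rewrite divff ?gt_eqF// scale1r [a + _]addrC subrK.
  apply: ler_sum => i _; apply: small.
  rewrite opprD addrACA subrr add0r -scalerBl -mulrBl -natr1 [_ + 1]addrC addrK.
  by rewrite normrZ mul1r gtr0_norm ?invr_gt0// mulrC.
have fx : f x = 0 by rewrite /f subrr -(scale0r 0) nrmZ normr0 mul0r (min_idPl (ltW r0)).
have fy : f y <= (1 + kap) * d x y.
  rewrite mulrC -ler_pdivrMr//; apply: dist_lb => s <-; rewrite ler_pdivrMr// mulrC.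
  rewrite -[f _]subr0 -fx; elim: s (x) => [|q s IH] z /=; first by rewrite subrr mulr0.
  by rewrite -(subrKA (f q)) addrC mulrDr lerD.
have lt_r : (1 + kap) * d x y < r.
  apply: le_lt_trans (_ : 2 * d x y < _); first by rewrite ler_wpM2r ?dist_ge0//; lra.
  by lra.
move: fy; rewrite {1}/f; case: (leP (nrm K x (y - x)) r) => // rn.
by rewrite leNgt lt_r.
Qed.

(* In a Euclidean plane three vectors of norm at most 1 cannot be pairwise at *)
(* distance nearly 2.                                                         *)
Lemma no_tripod : exists2 eta0 : R, 0 < eta0 & forall eta, 0 < eta -> eta < eta0 ->
  forall x y1 y2 y3, d x y1 = eta -> d x y2 = eta -> d x y3 = eta ->
  49 / 25 * eta <= d y1 y2 -> 49 / 25 * eta <= d y2 y3 -> 49 / 25 * eta <= d y1 y3 -> False.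
Proof.
pose kap : R := 1 / 100.
have kap0 : 0 < kap by rewrite /kap; lra.
have kap1 : kap <= 1 by rewrite /kap; lra.
have [del del0 delP] := nrm_compare kap0.
have [e1 e10 e1P] := dist_local_lower kap0 kap1.
have [c c0 cP] := dist_lower K beta0.
exists (Num.min e1 (c * del)); first by rewrite lt_min e10 mulr_gt0.
move=> eta eta0; rewrite lt_min => /andP[ee1 ecd] x y1 y2 y3 h1 h2 h3 h12 h23 h13.
have near y : d x y = eta -> `|y - x| < del /\ nrm K x (y - x) <= (1 + kap) * eta.
  move=> xy; split; last by rewrite -xy; apply: e1P; rewrite xy.
  rewrite -(ltr_pM2l c0) distrC; apply: le_lt_trans (cP x y) _; rewrite xy//.
have far y z : d x y = eta -> d x z = eta -> 49 / 25 * eta <= d y z ->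
    49 / 25 * eta <= (1 + kap) * nrm K x (y - z).
  move=> xy xz yz; apply: le_trans yz _; apply: le_trans (dist_seg K y z) _.
  apply: seg_le => t; rewrite in_itv /= => /andP[t0 t1].
  rewrite -[y - z]opprB nrmN; apply: delP.
  have -> : y + t *: (z - y) - x = (1 - t) *: (y - x) + t *: (z - x).
    by apply: pair_ext; rewrite /= /GRing.scale /=; ring.
  apply: le_lt_trans (ler_normD _ _) _; rewrite !normrZ ger0_norm ?subr_ge0// (ger0_norm t0).
  have [[yd _] [zd _]] := (near _ xy, near _ xz).
  have [->|t00] := eqVneq t 0; first by rewrite subr0 mul1r mul0r addr0.
  have tp : 0 < t by rewrite lt_neqAle eq_sym t00.
  have a1 : t * `|z - x| < t * del by rewrite ltr_pM2l.
  have a2 : (1 - t) * `|y - x| <= (1 - t) * del by rewrite ler_wpM2l ?subr_ge0// ltW.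
  lra.
have [[_ n1] [_ n2] [_ n3]] := And3 (near _ h1) (near _ h2) (near _ h3).
have f12 := far _ _ h1 h2 h12; have f23 := far _ _ h2 h3 h23; have f13 := far _ _ h1 h3 h13.
have sq1 y : nrm K x (y - x) <= (1 + kap) * eta -> nrm K x (y - x) ^+ 2 <= ((1 + kap) * eta) ^+ 2.
  by move=> h; rewrite ler_pXn2r ?nnegrE ?nrm_ge0// mulr_ge0 ?(ltW eta0)// /kap; lra.
have sq2 v : 49 / 25 * eta <= (1 + kap) * nrm K x v -> (49 / 25 * eta) ^+ 2 <= (1 + kap) ^+ 2 * nrm K x v ^+ 2.
  move=> h; rewrite -exprMn ler_pXn2r ?nnegrE//; first by rewrite mulr_ge0 ?(ltW eta0).
  by rewrite mulr_ge0 ?nrm_ge0// /kap; lra.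
have := sq1 _ n1; have := sq1 _ n2; have := sq1 _ n3.
have := sq2 _ f12; have := sq2 _ f23; have := sq2 _ f13.
rewrite !nrm_sqr.
set q := qf _ _ _.
(* For three vectors of norm [eta] this identity forces some pairwise distance to be at most
   [sqrt 3 * eta]. The bound 49/25 lies above [sqrt 3], with room for the factors [1 + kap], and
   below 2, so that almost minimizing curves reach it. *)
have E : q (y1 - y2) + q (y2 - y3) + q (y1 - y3) + q ((y1 - x) + (y2 - x) + (y3 - x)) =
    3 * (q (y1 - x) + q (y2 - x) + q (y3 - x)) by rewrite /q /qf /=; ring.
have q0 : 0 <= q ((y1 - x) + (y2 - x) + (y3 - x)) by rewrite qf_ge0 ?kE_gt0 ?kD_gt0.
have ee : 0 < eta ^+ 2 by rewrite exprn_gt0.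
move: E q0 ee; rewrite /kap !exprMn.
move: (q (y1 - y2)) (q (y2 - y3)) (q (y1 - y3)) (q (_ + _ + _)) (q (y1 - x)) (q (y2 - x)) (q (y3 - x)) (eta ^+ 2).
by move=> A B C D a b e E; lra.
Qed.

End Tripod.

(** * Almost minimizing loops and their mirror images *)

Section CrossingLoops.
Context {R : realType}.
Variable beta : R.
Hypothesis beta0 : 0 < beta.
Variable K : kform beta.
Local Notation d := (dist K).
Variable L : R.
Hypothesis L0 : 0 < L.
Hypothesis Lh : forall p, L <= d p (p + hvec).
Hypothesis Lg : forall p, L <= d p (glide p).
Local Notation lat := (lat beta).

Lemma glide_lat (p : R * R) (m : int) : glide (p + lat m 0) = glide p + lat m 0.
Proof. by rewrite glideD refl2_lat oppr0. Qed.

Lemma glide_lat_glide (p : R * R) (m : int) :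
  glide (glide p + lat m 0) = p + lat (m + 1) 0.
Proof. by rewrite glide_lat glide_glide -(lat10 beta) -addrA -latD addr0 [1 + m]addrC. Qed.

(** The displacement is that of the power [2 m + 1] of [glide]. Unless the exponent is 1 or -1, the
    square of this power is the translation by [2 m + 1] times [hvec] with [|2 m + 1| >= 3], so
    twice the distance is at least [3 L]. *)
Lemma odd_power_lower p (m : int) : L <= d p (glide p + lat m 0).
Proof.
have [->|m0] := eqVneq m 0; first by rewrite lat00 addr0.
have [->|m1] := eqVneq m (-1).
  rewrite -dist_glide glide_lat_glide addNr lat00 addr0 dist_sym; exact: Lg.
have h1 := le_dist_lat_h beta0 Lh (m + m + 1) 0 p.
have E : d p (p + lat (m + m + 1) 0) <= 2 * d p (glide p + lat m 0).
  apply: le_trans (dist_triangle K (glide p + lat m 0) _ _) _.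
  have -> : p + lat (m + m + 1) 0 = glide (glide p + lat m 0) + lat m 0.
    by rewrite glide_lat_glide -(addrA p) -latD addr0; congr (_ + lat _ _); lia.
  by rewrite -(dist_glide K p) (dist_lat K m 0 (glide p)) mulr2n mulrDl !mul1r.
have h2 : (3 : R) <= `|m + m + 1|%:~R.
  have h3 : 3 <= `|m + m + 1|.
    have : (m < -1 \/ 0 < m) by move: m0 m1; clear; lia.
    by case=> ?; [rewrite ler0_norm|rewrite ger0_norm]; lia.
  by rewrite -(ler_int R) in h3.
have h3 := le_trans (le_trans (ler_wpM2r (ltW L0) h2) h1) E.
by move: L0 h3; lra.
Qed.

Definition loop (len : R) (p : R * R) (c : R -> R * R) (l : R -> R) : Prop :=
  [/\ arc K c l, c 0 = p, c 1 = p + hvec & l 1 - l 0 <= len].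

Lemma loop_near len p c l s : loop len p c l -> 0 <= s -> s <= 1 ->
  d (c 0) (c s) <= len.
Proof.
move=> [[_ cl] c0 c1 ll] s0 s1.
have h1 := cl _ _ (lexx 0) s0 s1; have h2 := cl _ _ s0 s1 (lexx 1).
by have := dist_ge0 K (c s) (c 1); lra.
Qed.

(** A meeting point would be at distance at least [L - e] from both ends of the loop, by
    [odd_power_lower]; but the loop has length at most [L + e], which is less than [2 L - 2 e]. *)
Lemma loop_avoids_mirror (e : R) p c l z s (m : int) : loop (L + e) p c l -> 3 * e < L ->
  d p z <= e -> 0 <= s -> s <= 1 -> c s <> glide z + lat m 0.
Proof.
move=> [[_ cl] c0 c1 ll] eL pz s0 s1 cs.
have h1 := cl _ _ (lexx 0) s0 s1; have h2 := cl _ _ s0 s1 (lexx 1).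
have gz (m' : int) : d (glide z + lat m' 0) (glide p + lat m' 0) <= e.
  by rewrite dist_lat dist_glide dist_sym.
have a1 := odd_power_lower p m.
have a2 := odd_power_lower p (m - 1).
have b1 := dist_triangle K (c s) p (glide p + lat m 0).
have b2 : d p (glide p + lat (m - 1) 0) <= d (c s) (c 1) + e.
  have -> : d p (glide p + lat (m - 1) 0) = d (c 1) (glide p + lat m 0).
    rewrite -(dist_lat K 1 0 p) -addrA -latD addr0 subrK c1 lat10//.
  apply: le_trans (dist_triangle K (c s) _ _) _; rewrite (dist_sym K (c 1)) lerD2l cs.
  exact: gz.
have := gz m; rewrite -cs c0 in h1 *; lra.
Qed.

Lemma dist_cont (x : R * R) : continuous (fun y => d x y).
Proof.
have [C C0 CP] := dist_upper K beta0.
have lipC p q : `|d x p - d x q| <= C * `|p - q|.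
  by apply: le_trans (CP p q); rewrite !(dist_sym K x); exact: dist_lip.
exact: lipschitz_cont lipC.
Qed.

Lemma arc_at_distance c l x eta a b : arc K c l -> a <= b -> x = c a \/ x = c b ->
  eta <= d (c a) (c b) -> 0 <= eta -> exists2 t, a <= t <= b & d x (c t) = eta.
Proof.
move=> [cc _] ab xab etal eta0.
have cf : {within `[a, b], continuous (fun t => d x (c t))}.
  apply: continuous_subspaceT => t.
  by apply: (@continuous_comp _ _ _ c (fun y => d x y)); [exact: cc|exact: dist_cont].
have [|t tab tE] := @IVT R (fun t => d x (c t)) a b eta ab cf.
  case: xab => ->; rewrite dist_refl ge_min le_max ?(dist_sym K (c b) (c a)).
    by rewrite eta0 etal orbT.
  by rewrite eta0 etal orbT.
by exists t => //; rewrite in_itv in tab.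
Qed.

Variable eta0 : R.
Hypothesis tripod : forall eta, 0 < eta -> eta < eta0 ->
  forall x y1 y2 y3, d x y1 = eta -> d x y2 = eta -> d x y3 = eta ->
  49 / 25 * eta <= d y1 y2 -> 49 / 25 * eta <= d y2 y3 -> 49 / 25 * eta <= d y1 y3 -> False.

(* At a common point x of c1 and of the mirror image of c2, the two branches  *)
(* of c1 and one branch of the mirror image of c2 pairwise form almost        *)
(* minimizing curves.                                                         *)
Lemma loops_avoid_mirror (eta : R) p1 c1 l1 p2 c2 l2 s t (m : int) :
  0 < eta -> eta < eta0 -> 4 * eta < L ->
  loop (L + eta / 1000) p1 c1 l1 -> loop (L + eta / 1000) p2 c2 l2 ->
  d p1 p2 <= eta / 1000 ->
  0 <= s -> s <= 1 -> 0 <= t -> t <= 1 -> c1 s <> glide (c2 t) + lat m 0.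
Proof.
move=> eta_gt0 etaE etaL [a1 c10 c11 ll1] [a2 c20 c21 ll2] pp s0 s1 t0 t1 xE.
set e := eta / 1000 in ll1 ll2 pp; have eE : eta = 1000 * e by rewrite /e; field.
have [cc1 cl1] := a1; have [cc2 cl2] := a2.
set x := c1 s in xE.
have A := cl1 _ _ (lexx 0) s0 s1; have A' := cl1 _ _ s0 s1 (lexx 1).
have B := cl2 _ _ (lexx 0) t0 t1; have B' := cl2 _ _ t0 t1 (lexx 1).
rewrite -/x in A A'.
have glat u v : d (glide u + lat m 0) (glide v + lat m 0) = d u v by rewrite dist_lat dist_glide.
have far1 : L - e <= d (c1 0) (glide (c2 0) + lat m 0).
  have h := odd_power_lower p1 m; rewrite c10 c20.
  have := dist_triangle K (glide p2 + lat m 0) p1 (glide p1 + lat m 0).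
  by rewrite (glat p2 p1) (dist_sym K p2); lra.
have far2 : L - e <= d (c1 0) (glide (c2 1) + lat m 0).
  have h := odd_power_lower p1 (m + 1); rewrite c10 c21.
  have -> : glide (p2 + hvec) + lat m 0 = glide p2 + lat (m + 1) 0.
    by rewrite glide_hvec -(lat10 beta) -addrA -latD add0r [1 + m]addrC.
  have := dist_triangle K (glide p2 + lat (m + 1) 0) p1 (glide p1 + lat (m + 1) 0).
  by rewrite dist_lat dist_glide (dist_sym K p2); lra.
have far3 : L - e <= d (c1 1) (glide (c2 0) + lat m 0).
  have h := odd_power_lower p1 (m - 1); rewrite c11 c20.
  have -> : d (p1 + hvec) (glide p2 + lat m 0) = d p1 (glide p2 + lat (m - 1) 0).
    by rewrite -(dist_lat K 1 0 p1) -addrA -latD addr0 subrK lat10.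
  have := dist_triangle K (glide p2 + lat (m - 1) 0) p1 (glide p1 + lat (m - 1) 0).
  by rewrite dist_lat dist_glide (dist_sym K p2); lra.
have far4 : L - e <= d (c1 1) (glide (c2 1) + lat m 0).
  have h := odd_power_lower p1 m; rewrite c11 c21 glide_hvec addrAC hvec_shift.
  have := dist_triangle K (glide p2 + lat m 0) p1 (glide p1 + lat m 0).
  by rewrite (glat p2 p1) (dist_sym K p2); lra.
have via (u v : R * R) : d u (glide v + lat m 0) <= d u x + d (c2 t) v.
  by rewrite -(glat (c2 t) v) -xE; exact: dist_triangle.
(* The two halves of [c1] cut at [x] have total length at most [L + e], likewise for [c2], whereas a
   half of [c1] and a half of [c2] together always span at least [L - e]. So each half spans at
   least [(L - 3 e) / 2], which exceeds [eta], and changing from one curve to the other at [x] is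
   almost minimizing too. *)
have v1 := via (c1 0) (c2 0); have v2 := via (c1 0) (c2 1).
have v3 := via (c1 1) (c2 0); have v4 := via (c1 1) (c2 1).
rewrite (dist_sym K (c1 1) x) in v3 v4; rewrite (dist_sym K (c2 t) (c2 0)) in v1 v3.
have [s1' /andP[s1'0 s1's] y1E] : exists2 u, 0 <= u <= s & d x (c1 u) = eta.
  by apply: (arc_at_distance a1) => //; [right|rewrite -/x; lra|exact: ltW].
have [s2' /andP[ss2' s2'1] y2E] : exists2 u, s <= u <= 1 & d x (c1 u) = eta.
  by apply: (arc_at_distance a1) => //; [left|rewrite -/x; lra|exact: ltW].
have [t1' /andP[t1'0 t1't] z1E] : exists2 u, 0 <= u <= t & d (c2 t) (c2 u) = eta.
  by apply: (arc_at_distance a2) => //; [right|lra|exact: ltW].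
have P1 := cl1 _ _ (lexx 0) s1'0 (le_trans s1's s1); have P2 := cl1 _ _ s1'0 s1's s1.
have P3 := cl1 _ _ s0 ss2' s2'1; have P4 := cl1 _ _ (le_trans s0 ss2') s2'1 (lexx 1).
have P5 := cl2 _ _ (lexx 0) t1'0 (le_trans t1't t1); have P6 := cl2 _ _ t1'0 t1't t1.
rewrite -/x (dist_sym K _ x) y1E in P2; rewrite -/x y2E in P3.
rewrite (dist_sym K _ (c2 t)) z1E in P6.
pose z := glide (c2 t1') + lat m 0.
have zE : d x z = eta by rewrite xE glat.
have zb : d z (glide (c2 0) + lat m 0) = d (c2 0) (c2 t1') by rewrite glat dist_sym.
have Q12 := dist_triangle K (c1 s1') (c1 0) (c1 1).
have Q12' := dist_triangle K (c1 s2') (c1 s1') (c1 1).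
have Q1z := dist_triangle K (c1 s1') (c1 0) (glide (c2 0) + lat m 0).
have Q1z' := dist_triangle K z (c1 s1') (glide (c2 0) + lat m 0).
have Q2z := dist_triangle K (c1 s2') (c1 1) (glide (c2 0) + lat m 0).
have Q2z' := dist_triangle K z (c1 s2') (glide (c2 0) + lat m 0).
rewrite (dist_sym K (c1 1) (c1 s2')) in Q2z.
have full : L <= d (c1 0) (c1 1) by rewrite c10 c11.
rewrite zb in Q1z' Q2z'.
apply: (tripod eta_gt0 etaE y1E y2E zE).
- by move: full Q12 Q12' P1 P2 P3 P4 ll1 eE; lra.
- by lra.
- by lra.
Qed.

End CrossingLoops.

(** * Homotopies of arcs in the punctured plane *)

Section NonvanishingHomotopies.
Context {R : realType}.

Lemma pair_cont (T : topologicalType) (f g : T -> R) : continuous f -> continuous g ->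
  continuous (fun x => (f x, g x)).
Proof. by move=> cf cg x; exact: (cvg_pair (cf x) (cg x)). Qed.

Variable N : R.

(** Homotopies of arcs which start in the left half-plane, end in the right one and avoid the
    origin. In the application the values are differences of two moving points, and 0 means that
    these points meet. *)
Definition crosses (G : R * R -> R * R) : Prop :=
  [/\ continuous G,
      forall t : R, 0 <= t -> t <= 1 -> (G (t, - N)).1 < 0 /\ 0 < (G (t, N)).1 &
      forall t r : R, 0 <= t -> t <= 1 -> - N <= r -> r <= N -> G (t, r) <> 0].

(** Passing below the origin is taken up to homotopy: the arc itself may rise above 0, but it can be
    deformed in the punctured plane into the lower half-plane. *)
Definition passes_below (f : R -> R * R) : Prop := exists2 G, crosses G &
  forall r : R, - N <= r -> r <= N -> (G (0, r)).2 < 0 /\ G (1, r) = f r.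

Lemma passes_below_homotopy f H : passes_below f -> crosses H ->
  (forall r : R, - N <= r -> r <= N -> H (0, r) = f r) -> 0 <= N ->
  passes_below (fun r => H (1, r)).
Proof.
move=> [G [cG Gs G0] Gf] [cH Hs H0] Hf N0.
(* The two homotopies run one after the other; subtracting [H (0, z.2)] removes the arc that both
   have in common. *)
pose G' (z : R * R) := G (clamp (2 * z.1 + 0), z.2) + H (clamp (2 * z.1 + (-1)), z.2) - H (0, z.2).
have low t r : t <= 1 / 2 -> 0 <= t -> - N <= r -> r <= N -> G' (t, r) = G (2 * t, r).
  move=> t2 t0 r1 r2; rewrite /G' /= addr0 (@clamp_id _ (2 * t)); [|lra|lra].
  by rewrite clamp_le0 ?addrK//; lra.
have high t r : 1 / 2 <= t -> t <= 1 -> - N <= r -> r <= N -> G' (t, r) = H (2 * t + (-1), r).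
  move=> t2 t1 r1 r2; rewrite /G' /= clamp_ge1 ?clamp_id; [|lra|lra|lra].
  by rewrite (Gf _ r1 r2).2 Hf// addrAC subrr add0r.
have NN : - N <= N by lra.
exists G'; last first.
  move=> r r1 r2; have -> := low 0 r ltac:(lra) (lexx 0) r1 r2.
  have -> := high 1 r ltac:(lra) (lexx 1) r1 r2.
  rewrite mulr0; split; first exact: (Gf _ r1 r2).1.
  by congr (H (_, _)); lra.
have cl (a : R) : continuous (fun z : R * R => clamp (2 * z.1 + a)).
  move=> z; apply: (@continuous_comp _ _ _ (fun z : R * R => 2 * z.1 + a) clamp); last exact: clamp_cont.
  by apply: cvgD; [apply: cvgM; [exact: cvg_cst|exact: cvg_fst]|exact: cvg_cst].
have pairc (F : R * R -> R * R) (h : R * R -> R) : continuous F -> continuous h ->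
    continuous (fun z : R * R => F (h z, z.2)).
  move=> cF ch z; apply: (@continuous_comp _ _ _ (fun z : R * R => (h z, z.2)) F); last exact: cF.
  by apply: pair_cont => // w; exact: cvg_snd.
split.
- move=> z; apply: cvgB; first apply: cvgD.
  + exact: (pairc G _ cG (cl 0)).
  + exact: (pairc H _ cH (cl (-1))).
  + by apply: (pairc H (fun=> 0) cH) => w; exact: cvg_cst.
- move=> t t0 t1; have [t2|/ltW t2] := leP t (1 / 2).
    by rewrite !low//; apply: Gs; lra.
  by rewrite !high//; apply: Hs; lra.
- move=> t r t0 t1 r1 r2; have [t2|/ltW t2] := leP t (1 / 2).
    by rewrite low//; apply: G0 => //; lra.
  by rewrite high//; apply: H0 => //; lra.
Qed.

(** A homotopy from an arc below the origin to one above it, with ends kept on the left and on the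
    right, has a zero by [poincare_miranda]. *)
Lemma not_passes_below f : 0 < N -> passes_below f ->
  ~ (forall r : R, - N <= r -> r <= N -> 0 < (f r).2).
Proof.
move=> N0 [G [cG Gs G0] Gf] f0.
pose q (z : R * R) := (z.1, - N + z.2 * (2 * N)).
have cq : continuous q.
  apply: pair_cont => z; first exact: cvg_fst.
  by apply: cvgD; [exact: cvg_cst|apply: cvgM; [exact: cvg_snd|exact: cvg_cst]].
have cGq : continuous (G \o q) by move=> z; apply: continuous_comp; [exact: cq|exact: cG].
have bd t : t \in `[0, 1] -> - N <= - N + t * (2 * N) /\ - N + t * (2 * N) <= N.
  rewrite in_itv /= => /andP[t0 t1].
  by have := mulr_ge0 t0 (ltW N0); have := mulr_ge0 (ltac:(lra) : 0 <= 1 - t) (ltW N0); lra.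
have [||t t01|t t01|t t01|t t01|z [z1 z2 F0 F1]] :=
  @poincare_miranda _ (fun z => (G (q z)).2) (fun z => (G (q z)).1).
- by move=> z; apply: (@continuous_comp _ _ _ (G \o q) snd); [exact: cGq|exact: cvg_snd].
- by move=> z; apply: (@continuous_comp _ _ _ (G \o q) fst); [exact: cGq|exact: cvg_fst].
- by have [b1 b2] := bd _ t01; exact: ltW (Gf _ b1 b2).1.
- by have [b1 b2] := bd _ t01; rewrite /q /= (Gf _ b1 b2).2 ltW// f0.
- by move: t01; rewrite in_itv /q /= mul0r addr0 => /andP[t0 t1]; exact: ltW (Gs _ t0 t1).1.
- move: t01; rewrite in_itv /q /= => /andP[t0 t1].
  have -> : - N + 1 * (2 * N) = N by lra.
  exact: ltW (Gs _ t0 t1).2.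
have [b1 b2] := bd _ z2; move: z1; rewrite in_itv /= => /andP[z10 z11].
by case: (G0 _ _ z10 z11 b1 b2); exact: pair_ext.
Qed.

End NonvanishingHomotopies.

(** * Excluding a constant displacement *)

Section NoConstantDisplacement.
Context {R : realType}.
Variable beta : R.
Hypothesis beta0 : 0 < beta.
Variable K : kform beta.
Local Notation d := (dist K).
Local Notation lat := (lat beta).

(** The loop repeated over [- N <= r <= N], one turn per unit of [r], and placed so that [r = 0]
    gives [c 0]. *)
Definition line (N : nat) (c : R -> R * R) (r : R) : R * R :=
  ext c (N + N) (r + N%:R) - hvec *+ N.

Lemma line_continuous N c : continuous c -> continuous (line N c).
Proof.
move=> cc r; apply: cvgB; last exact: cvg_cst.
apply: (@continuous_comp _ _ _ (fun r : R => r + N%:R) (ext c (N + N))); last exact: ext_cont.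
by apply: cvgD; [exact: cvg_id|exact: cvg_cst].
Qed.

Lemma line0 N c : c 1 = c 0 + hvec -> line N c 0 = c 0.
Proof. by move=> c1; rewrite /line add0r (ext_nat c1) ?leq_addl// addrK. Qed.

Lemma line_spec N (c : R -> R * R) (r B : R) : c 1 = c 0 + hvec ->
  (forall s : R, 0 <= s -> s <= 1 -> `|c s - c 0| <= B) ->
  - N%:R <= r -> r <= N%:R ->
  (exists (s : R) (m : int), [/\ 0 <= s, s <= 1 & line N c r = c s + lat m 0]) /\
  `|(line N c r - c 0 - r *: hvec).1| <= B + 2 * pi /\ `|(line N c r - c 0).2| <= B.
Proof.
move=> c1 cB r1 r2.
have [||j [s [s0 s1 rE eE]]] := @ext_spec _ c hvec (N + N) (r + N%:R) c1.
- by lra.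
- by rewrite natrD; lra.
have lE : line N c r = c s + lat (j%:Z - N%:Z) 0.
  rewrite /line eE -addrA; congr (_ + _).
  by rewrite -(lat10 beta) !latMn !mul0rn !natz -latB subrr.
have latE : lat (j%:Z - N%:Z) 0 = ((j%:R - N%:R) * (2 * pi), 0) :> R * R.
  by rewrite /lat mulr0 intrB mulrC -!pmulrn.
have [b1 b2] := coord_le_norm (c s - c 0); have b3 := cB s s0 s1.
split; first by exists s, (j%:Z - N%:Z).
rewrite lE latE; split; last by rewrite /= in b2 *; rewrite addr0; lra.
have -> : (c s + ((j%:R - N%:R) * (2 * pi), 0) - c 0 - r *: hvec).1 =
    (c s - c 0).1 - s * (2 * pi).
  have -> : r = j%:R - N%:R + s by lra.
  by rewrite /= /GRing.scale /=; ring.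
apply: le_trans (ler_normB _ _) _; rewrite lerD ?(le_trans b1)//.
have p0 := pi_ge0 R; rewrite ger0_norm ?mulr_ge0//.
by rewrite ler_piMl// mulr_ge0.
Qed.

Variable L : R.
Hypothesis L0 : 0 < L.
Hypothesis Lh : forall p, d p (p + hvec) = L.
Hypothesis Lg : forall p, L <= d p (glide p).

Opaque line.

(** The property [Q y] says that some almost minimizing loop through [(0, y)] passes below the
    mirror image of its base point. It holds for very negative [y], where the whole line stays
    below, and it survives small steps of [y] although the loops are chosen anew each time. For
    large [y] the line stays above the mirror image, a contradiction. *)
Theorem no_constant_displacement : False.
Proof.
have p0 := pi_gt0 R.
have [eta0 eta00 tri] := no_tripod beta0 K.
have Lh' p : L <= d p (p + hvec) by rewrite Lh.
have [eta [eta_gt0 etaE etaL]] : exists eta : R, [/\ 0 < eta, eta < eta0 & 4 * eta < L].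
  exists (Num.min (eta0 / 2) (L / 8)); split.
  - by rewrite lt_min !divr_gt0.
  - by rewrite gt_min ltr_pdivrMr// ltr_pMr// ltr1n.
  - have h : Num.min (eta0 / 2) (L / 8) <= L / 8 by rewrite ge_min lexx orbT.
    by move: L0 h; lra.
pose e := eta / 1000; have e0 : 0 < e by rewrite /e; move: eta_gt0; lra.
have eL : 3 * e < L by move: etaL eta_gt0; rewrite /e; lra.
have [C C0 CP] := dist_upper K beta0.
have [cl cl0 clP] := dist_lower K beta0.
pose B := (L + e) / cl + 2 * pi.
have B0 : 0 < B.
  have h : 0 < (L + e) / cl by rewrite divr_gt0// addr_gt0.
  by rewrite /B; move: h p0; lra.
pose P (y : R) : R * R := (0, y).
have Pd y z : d (P y) (P z) <= C * `|y - z|.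
  apply: le_trans (CP _ _) _; rewrite ler_wpM2l ?(ltW C0)// prod_normE /= subrr normr0.
  by rewrite ge_max normr_ge0 lexx.
have loops p : exists c l, loop K (L + e) p c l.
  have [c [l [cl' c0 c1 ll]]] := near_geodesic K p (p + hvec) e0.
  by exists c, l; split=> //; rewrite -(Lh p) ltW.
(* The length [2 pi N] of half a line exceeds the two excursions [B] and the shift [pi] of [glide],
   so the ends stay on the two sides of the mirror image. *)
have [N [N0 NB]] := exists_nat_gt ((2 * B + pi + 1) / (2 * pi)).
rewrite ler_pdivrMr ?mulr_gt0// in NB.
have N0' : 0 < N%:R :> R by rewrite ltr0n.
have near (y : R) (c : R -> R * R) (l : R -> R) (r : R) : loop K (L + e) (P y) c l -> - N%:R <= r -> r <= N%:R ->
    [/\ exists (s : R) (m : int), [/\ 0 <= s, s <= 1 & line N c r = c s + lat m 0],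
       2 * pi * r - B <= (line N c r).1, (line N c r).1 <= 2 * pi * r + B,
       y - B <= (line N c r).2 & (line N c r).2 <= y + B].
  move=> lo r1 r2; have [[cc _] c0 c1 ll] := lo.
  have cB s : 0 <= s -> s <= 1 -> `|c s - c 0| <= (L + e) / cl.
    move=> s0 s1; rewrite ler_pdivlMr// mulrC distrC.
    by apply: le_trans (clP _ _) _; exact: loop_near lo s0 s1.
  have c1' : c 1 = c 0 + hvec by rewrite c0.
  have [h [h1 h2]] := line_spec c1' cB r1 r2; split => //.
  - by move: h1; rewrite c0 /= subr0 ler_norml /GRing.scale /= => /andP[]; rewrite /B [r * _]mulrC; lra.
  - by move: h1; rewrite c0 /= subr0 ler_norml /GRing.scale /= => /andP[]; rewrite /B [r * _]mulrC; lra.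
  - by move: h2; rewrite c0 /= ler_norml => /andP[]; rewrite /B; lra.
  - by move: h2; rewrite c0 /= ler_norml => /andP[]; rewrite /B; lra.
have NN : - N%:R <= N%:R :> R by lra.
have opp (r : R) : - N%:R <= r -> r <= N%:R -> - N%:R <= - r /\ - r <= N%:R.
  by rewrite lerN2 lerNl.
have shrink (t r : R) : 0 <= t -> t <= 1 -> - N%:R <= r -> r <= N%:R ->
    (- N%:R <= t * r /\ t * r <= N%:R) /\ (- N%:R <= (1 - t) * r /\ (1 - t) * r <= N%:R).
  move=> t0 t1 r1 r2; have h1 := ler_wpM2l t0 r1; have h2 := ler_wpM2l t0 r2.
  have t1' : 0 <= 1 - t by rewrite subr_ge0.
  have h3 := ler_wpM2l t1' r1; have h4 := ler_wpM2l t1' r2.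
  have h5 := ler_wpM2r (ltW N0') t1; have h6 := mulr_ge0 t0 (ltW N0').
  by move: h1 h2 h3 h4 h5 h6 N0' r1 r2; clear => h1 h2 h3 h4 h5 h6 h7 r1 r2; lra.
pose Q (y : R) := exists c l, loop K (L + e) (P y) c l /\
  passes_below N%:R (fun r => line N c r - glide (c 0)).
have Qstart : Q (- (B + 1)).
  have [c [l lo]] := loops (P (- (B + 1))); exists c, l; split => //.
  have [[cc _] c0 _ _] := lo.
  have neg (r : R) : - N%:R <= r -> r <= N%:R -> (line N c r - glide (c 0)).2 < 0.
    by move=> r1 r2; have [_ _ _ _] := near _ _ _ _ lo r1 r2; rewrite c0 /=; lra.
  exists (fun z => line N c z.2 - glide (c 0)); last by move=> r r1 r2; split => //; exact: neg.
  split.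
  - move=> z; apply: cvgB; last exact: cvg_cst.
    by apply: (@continuous_comp _ _ _ snd (line N c)); [exact: cvg_snd|exact: line_continuous].
  - move=> t _ _ /=; have [_ _ h1 _ _] := near _ _ _ _ lo (lexx _) NN.
    by have [_ h2 _ _ _] := near _ _ _ _ lo NN (lexx _); rewrite c0 /=; split; lra.
  - by move=> t r _ _ r1 r2 /= h; have := neg r r1 r2; rewrite h ltxx.
have Qstep (y y' : R) : y <= y' -> C * (y' - y) <= e -> Q y -> Q y'.
  move=> yy ye [c1 [l1 [lo1 pb]]]; have [c2 [l2 lo2]] := loops (P y'); exists c2, l2; split=> //.
  have [[cc1 _] c10 c11 _] := lo1; have [[cc2 _] c20 c21 _] := lo2.
  have l10 : line N c1 0 = P y by rewrite line0 ?c10.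
  have l20 : line N c2 0 = P y' by rewrite line0 ?c20.
  pose z (t : R) := P (y + t * (y' - y)).
  have z1 (t : R) : 0 <= t -> t <= 1 -> d (P y) (z t) <= e.
    move=> t0 t1; apply: le_trans (Pd _ _) _; apply: le_trans ye; rewrite ler_wpM2l ?(ltW C0)//.
    rewrite opprD addrA subrr add0r normrN ger0_norm ?mulr_ge0 ?subr_ge0//.
    by rewrite ler_piMl ?subr_ge0.
  have z2 (t : R) : 0 <= t -> t <= 1 -> d (P y') (z t) <= e.
    move=> t0 t1; apply: le_trans (Pd _ _) _; apply: le_trans ye; rewrite ler_wpM2l ?(ltW C0)//.
    have -> : y' - (y + t * (y' - y)) = (1 - t) * (y' - y) by ring.
    by rewrite ger0_norm ?mulr_ge0 ?subr_ge0// ler_piMl ?subr_ge0//; lra.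
  have d12 : d (P y) (P y') <= eta / 1000.
    by have := z1 1 ler01 (lexx 1); rewrite /z mul1r addrC subrK.
  have d22 : d (P y') (P y') <= eta / 1000 by rewrite dist_refl ltW.
  have cz (f : R * R -> R) : continuous f -> continuous (fun w => z (f w)).
    move=> cf w; apply: (pair_cont (f := fun=> 0)) => w'; first exact: cvg_cst.
    by apply: cvgD; [exact: cvg_cst|apply: cvgM; [exact: cf|exact: cvg_cst]].
  have cline c (f : R * R -> R) : continuous c -> continuous f -> continuous (fun w => line N c (f w)).
    by move=> cc cf w; apply: (@continuous_comp _ _ _ f (line N c)); [exact: cf|exact: line_continuous].
  have cglide (f : R * R -> R * R) : continuous f -> continuous (fun w => glide (f w)).
    move=> cf; apply: pair_cont => w.
      apply: cvgD; last exact: cvg_cst.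
      by apply: (@continuous_comp _ _ _ f fst); [exact: cf|exact: cvg_fst].
    by apply: cvgN; apply: (@continuous_comp _ _ _ f snd); [exact: cf|exact: cvg_snd].
  have c1s : continuous (fun w : R * R => (1 - w.1) * w.2).
    move=> w; apply: cvgM; last exact: cvg_snd.
    by apply: cvgB; [exact: cvg_cst|exact: cvg_fst].
  have c2s : continuous (fun w : R * R => - w.1 * w.2).
    move=> w; apply: cvgM; last exact: cvg_snd.
    by apply: cvgN; exact: cvg_fst.
  have c3s : continuous (fun w : R * R => w.1 * w.2).
    by move=> w; apply: cvgM; [exact: cvg_fst|exact: cvg_snd].
  have c4s : continuous (fun w : R * R => - (1 - w.1) * w.2).
    move=> w; apply: cvgM; last exact: cvg_snd.
    by apply: cvgN; apply: cvgB; [exact: cvg_cst|exact: cvg_fst].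
  have c5s : continuous (fun w : R * R => - w.2) by move=> w; apply: cvgN; exact: cvg_snd.
  (* In turn: move the base point of the mirror image, slide along both lines  *)
  (* at once, move the base point of the first line, slide along both lines.   *)
  have H1 : crosses N%:R (fun w => line N c1 w.2 - glide (z w.1)).
    split.
    - move=> w; apply: cvgB; first by apply: cline => // ?; exact: cvg_snd.
      by apply: cglide; apply: cz => ?; exact: cvg_fst.
    - move=> t t0 t1 /=; have [_ _ h1 _ _] := near _ _ _ _ lo1 (lexx _) NN.
      have [_ h2 _ _ _] := near _ _ _ _ lo1 NN (lexx _).
      by move: h1 h2 NB B0 p0; clear => h1 h2 NB B0 p0; split; lra.
    - move=> t r t0 t1 r1 r2 /= /eqP; rewrite subr_eq0 => /eqP h.
      have [[s [m [s0 s1 sE]]] _ _ _ _] := near _ _ _ _ lo1 r1 r2.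
      apply: (loop_avoids_mirror (m := - m) beta0 L0 Lh' Lg lo1 eL (z1 t t0 t1) s0 s1).
      by rewrite -h sE -addrA -latD subrr addr0 lat00 addr0.
  (* The two parameters have opposite signs, so that at the ends the horizontal gap stays [2 pi N]
     up to [2 B + pi] while the motion passes from one line to the other. *)
  have H2 : crosses N%:R (fun w => line N c1 ((1 - w.1) * w.2) - glide (line N c2 (- w.1 * w.2))).
    split.
    - by move=> w; apply: cvgB; [exact: (cline c1 _ cc1 c1s)|exact: (cglide _ (cline c2 _ cc2 c2s))].
    - move=> t t0 t1 /=.
      have [[b1 b2] [a1 a2]] := shrink t N%:R t0 t1 NN (lexx _).
      have [[b1' b2'] [a1' a2']] := shrink t (- N%:R) t0 t1 (lexx _) NN.
      have [e1 e2] := opp _ b1 b2; have [e1' e2'] := opp _ b1' b2'.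
      rewrite -!mulNr in e1 e2 e1' e2'.
      have [_ h1 _ _ _] := near _ _ _ _ lo1 a1 a2.
      have [_ _ h2 _ _] := near _ _ _ _ lo2 e1 e2.
      have [_ _ h3 _ _] := near _ _ _ _ lo1 a1' a2'.
      have [_ h4 _ _ _] := near _ _ _ _ lo2 e1' e2'.
      by move: h1 h2 h3 h4 NB B0 p0; clear => h1 h2 h3 h4 NB B0 p0; split; lra.
    - move=> t r t0 t1 r1 r2 /= /eqP; rewrite subr_eq0 => /eqP h.
      have [[b1 b2] [a1 a2]] := shrink t r t0 t1 r1 r2.
      have [e1 e2] := opp _ b1 b2; rewrite -!mulNr in e1 e2.
      have [[s [m [s0 s1 sE]]] _ _ _ _] := near _ _ _ _ lo1 a1 a2.
      have [[s' [m' [s0' s1' sE']]] _ _ _ _] := near _ _ _ _ lo2 e1 e2.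
      apply: (loops_avoid_mirror (m := m' - m) beta0 L0 Lh' Lg tri eta_gt0 etaE etaL lo1 lo2 d12 s0 s1 s0' s1').
      by rewrite -[c1 s](addrK (lat m 0)) -sE h sE' glide_lat -addrA -latB subrr.
  have H3 : crosses N%:R (fun w => z w.1 - glide (line N c2 (- w.2))).
    split.
    - move=> w; apply: cvgB; first by apply: cz => ?; exact: cvg_fst.
      exact: (cglide _ (cline c2 _ cc2 c5s)).
    - move=> t t0 t1 /=; rewrite opprK; have [_ _ h1 _ _] := near _ _ _ _ lo2 (lexx _) NN.
      have [_ h2 _ _ _] := near _ _ _ _ lo2 NN (lexx _).
      by move: h1 h2 NB B0 p0; clear => h1 h2 NB B0 p0; split; lra.
    - move=> t r t0 t1 r1 r2 /= /eqP; rewrite subr_eq0 => /eqP h.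
      have [r1' r2'] := opp _ r1 r2.
      have [[s [m [s0 s1 sE]]] _ _ _ _] := near _ _ _ _ lo2 r1' r2'.
      apply: (loop_avoids_mirror (m := - (m + 1)) beta0 L0 Lh' Lg lo2 eL (z2 t t0 t1) s0 s1).
      by rewrite h sE glide_lat glide_lat_glide -addrA -latD addrN addr0 lat00 addr0.
  have H4 : crosses N%:R (fun w => line N c2 (w.1 * w.2) - glide (line N c2 (- (1 - w.1) * w.2))).
    split.
    - by move=> w; apply: cvgB; [exact: (cline c2 _ cc2 c3s)|exact: (cglide _ (cline c2 _ cc2 c4s))].
    - move=> t t0 t1 /=.
      have [[b1 b2] [a1 a2]] := shrink t N%:R t0 t1 NN (lexx _).
      have [[b1' b2'] [a1' a2']] := shrink t (- N%:R) t0 t1 (lexx _) NN.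
      have [e1 e2] := opp _ a1 a2; have [e1' e2'] := opp _ a1' a2'.
      rewrite -!mulNr in e1 e2 e1' e2'.
      have [_ h1 _ _ _] := near _ _ _ _ lo2 b1 b2.
      have [_ _ h2 _ _] := near _ _ _ _ lo2 e1 e2.
      have [_ _ h3 _ _] := near _ _ _ _ lo2 b1' b2'.
      have [_ h4 _ _ _] := near _ _ _ _ lo2 e1' e2'.
      by move: h1 h2 h3 h4 NB B0 p0; clear => h1 h2 h3 h4 NB B0 p0; split; lra.
    - move=> t r t0 t1 r1 r2 /= /eqP; rewrite subr_eq0 => /eqP h.
      have [[b1 b2] [a1 a2]] := shrink t r t0 t1 r1 r2.
      have [e1 e2] := opp _ a1 a2; rewrite -!mulNr in e1 e2.
      have [[s [m [s0 s1 sE]]] _ _ _ _] := near _ _ _ _ lo2 b1 b2.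
      have [[s' [m' [s0' s1' sE']]] _ _ _ _] := near _ _ _ _ lo2 e1 e2.
      apply: (loops_avoid_mirror (m := m' - m) beta0 L0 Lh' Lg tri eta_gt0 etaE etaL lo2 lo2 d22 s0 s1 s0' s1').
      by rewrite -[c2 s](addrK (lat m 0)) -sE h sE' glide_lat -addrA -latB subrr.
  have N1 := ltW N0'.
  have z0E : z 0 = P y by rewrite /z mul0r addr0.
  have z1E : z 1 = P y' by rewrite /z mul1r addrC subrK.
  have pb1 := passes_below_homotopy pb H1 (ltac:(by move=> r _ _ /=; rewrite z0E c10)) N1.
  have pb2 := passes_below_homotopy pb1 H2
    (ltac:(by move=> r _ _ /=; rewrite subr0 mul1r oppr0 mul0r l20 z1E)) N1.
  have pb3 := passes_below_homotopy pb2 H3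
    (ltac:(by move=> r _ _ /=; rewrite z0E subrr mul0r l10 mulN1r)) N1.
  have pb4 := passes_below_homotopy pb3 H4
    (ltac:(by move=> r _ _ /=; rewrite mul0r l20 z1E subr0 mulN1r)) N1.
  move: pb4 => /= [G cG GE]; exists G => // r r1 r2; have [g1 g2] := GE r r1 r2; split => //.
  by rewrite g2 mul1r subrr oppr0 mul0r l20 c20.
pose step := e / C; have st0 : 0 < step by rewrite divr_gt0.
have Qn (n : nat) : Q (- (B + 1) + n%:R * step).
  elim: n => [|n IH]; first by rewrite mul0r addr0.
  apply: Qstep IH; rewrite -natr1; first by lra.
  have -> : - (B + 1) + (n%:R + 1) * step - (- (B + 1) + n%:R * step) = step by ring.
  by rewrite /step mulrCA mulfV ?mulr1// gt_eqF.
have [n [_ nP]] := exists_nat_gt ((2 * B + 2) / step).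
rewrite ler_pdivrMr// in nP.
have [c [l [lo pb]]] := Qn n; have [_ c0 _ _] := lo.
apply: (not_passes_below N0' pb) => r r1 r2.
by have [_ _ _ h _] := near _ _ _ _ lo r1 r2; rewrite c0 /= opprK; lra.
Qed.

End NoConstantDisplacement.

(** * Curves, polygons and free homotopy classes *)

Section PiecewiseIntegrals.
Context {R : realType}.
Local Notation mu := (@lebesgue_measure R).

Lemma integrable_cat (f : R -> R) (a b c : R) : a <= b -> b <= c ->
  mu.-integrable `[a, b] (EFin \o f) -> mu.-integrable `[b, c] (EFin \o f) ->
  mu.-integrable `[a, c] (EFin \o f).
Proof.
move=> ab bc fi1 fi2.
have {}fi2 : mu.-integrable `]b, c] (EFin \o f).
  by apply: integrableS fi2 => //; apply: subset_itv; rewrite bnd_simp.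
have E : `[a, c]%classic = `[a, b] `|` `]b, c] by rewrite -itv_bndbnd_setU ?bnd_simp.
have [m1 i1] := integrableP _ _ _ fi1; have [m2 i2] := integrableP _ _ _ fi2.
rewrite E; apply/integrableP; split; first by apply/measurable_funU.
rewrite ge0_integral_setU//.
- exact: lte_add_pinfty.
- by apply: measurableT_comp => //; apply/measurable_funU.
- apply/disj_setPS => x [] /=; rewrite !in_itv /= => /andP[_ xb] /andP[bx _].
  by move: (le_lt_trans xb bx); rewrite ltxx.
Qed.

Variables (s : nat -> R) (n : nat).
Hypothesis s_lt : forall i, (i < n)%N -> s i < s i.+1.

Lemma breakpoints_le i j : (i <= j)%N -> (j <= n)%N -> s i <= s j.
Proof.
elim: j => [|j IH]; first by rewrite leqn0 => /eqP->.
rewrite leq_eqVlt => /orP[/eqP->//|ij] jn.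
by apply: le_trans (IH ij (ltnW jn)) _; exact: ltW (s_lt jn).
Qed.

Lemma piecewise_integral (g : R -> R) (h : nat -> R -> R) :
  (forall i, (i < n)%N -> continuous (h i)) ->
  (forall i, (i < n)%N -> {in `]s i, s i.+1[, g =1 h i}) ->
  mu.-integrable `[s 0, s n] (EFin \o g) /\
  \int[mu]_(t in `[s 0, s n]) g t = \sum_(i < n) \int[mu]_(t in `[s i, s i.+1]) h i t.
Proof.
move=> ch gh.
have H (m : nat) : (m <= n)%N -> mu.-integrable `[s 0, s m] (EFin \o g) /\
    \int[mu]_(t in `[s 0, s m]) g t = \sum_(i < m) \int[mu]_(t in `[s i, s i.+1]) h i t.
  elim: m => [|m IH] mn.
    rewrite big_ord0; split; last by rewrite set_itv1 Rintegral_set1.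
    apply: (@eq_oo_integrable _ (fun=> 0)); first by apply: continuous_integrable => x; exact: cvg_cst.
    by move=> t; rewrite in_itv /= => /andP[a b]; move: (lt_trans a b); rewrite ltxx.
  have [i1 e1] := IH (ltnW mn).
  have hi : mu.-integrable `[s m, s m.+1] (EFin \o h m) by apply: continuous_integrable; exact: ch.
  have s0m : s 0 <= s m by apply: breakpoints_le => //; exact: ltnW.
  have smS : s m <= s m.+1 by exact: ltW (s_lt mn).
  have i2 : mu.-integrable `[s 0, s m.+1] (EFin \o g).
    by apply: integrable_cat i1 _ => //; exact: eq_oo_integrable hi (gh _ mn).
  split => //; rewrite big_ord_recr /= -e1 (Rintegral_cut s0m smS i2); congr +%R.
  exact: eq_oo_Rintegral hi (gh _ mn).
exact: H.
Qed.

Lemma piecewise_variation (h g : R -> R) (d : nat -> R -> R) :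
  {within `[s 0, s n], continuous h} ->
  (forall i, (i < n)%N -> continuous (d i)) ->
  (forall i, (i < n)%N -> forall t, t \in `]s i, s i.+1[ -> is_derive t 1 h (d i t)) ->
  mu.-integrable `[s 0, s n] (EFin \o g) ->
  (forall i, (i < n)%N -> forall t, t \in `]s i, s i.+1[ -> `|d i t| <= g t) ->
  forall x y : R, s 0 <= x -> x <= y -> y <= s n ->
  `|h y - h x| <= \int[mu]_(t in `[x, y]) g t.
Proof.
move=> ch cd dh gi dg.
have piece i (x y : R) : (i < n)%N -> s i <= x -> x <= y -> y <= s i.+1 ->
    `|h y - h x| <= \int[mu]_(t in `[x, y]) g t.
  move=> iN ix; rewrite le_eqVlt => /orP[/eqP<- _|xy yi].
    by rewrite subrr normr0 set_itv1 Rintegral_set1.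
  have sub t : t \in `]x, y[ -> t \in `]s i, s i.+1[.
    rewrite !in_itv /= => /andP[xt ty].
    by rewrite (le_lt_trans ix xt) (lt_le_trans ty yi).
  have x0 : s 0 <= x by apply: le_trans ix; apply: breakpoints_le => //; exact: ltnW.
  have yn : y <= s n by apply: le_trans yi _; exact: breakpoints_le.
  have chxy : {within `[x, y], continuous h}.
    by apply: continuous_subspaceW ch; apply: subset_itv; rewrite bnd_simp.
  have [ch1 ch2 ch3] := (continuous_within_itvP h xy).1 chxy.
  have FTC := @continuous_FTC2 R (d i) h x y xy.
  have E : h y - h x = \int[mu]_(t in `[x, y]) d i t.
    rewrite /Rintegral FTC//.
    - by apply: continuous_subspaceT => t; exact: cd.
    - by split => // t txy; case: (dh _ iN _ (sub _ txy)).
    - by move=> t txy; rewrite derive1E; case: (dh _ iN _ (sub _ txy)).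
  have dint : mu.-integrable `[x, y] (EFin \o d i) by apply: continuous_integrable; exact: cd.
  have gint : mu.-integrable `[x, y] (EFin \o g) by exact: integrable_sub_itv gi.
  (* [g] is controlled only inside the piece, so at the end points it is replaced by a dominating
     value, without effect on the integral. *)
  pose g2 t := if t \in `]x, y[ then g t else `|d i t|.
  have g2g : {in `]x, y[, g2 =1 g} by move=> t txy; rewrite /g2 txy.
  rewrite E -(eq_oo_Rintegral gint g2g); apply: le_trans (le_normr_Rintegral _ dint) _ => //.
  apply: le_Rintegral_itv; [|exact: eq_oo_integrable gint g2g|].
    by apply: (@continuous_integrable _ (fun t => `|d i t|)) => t; apply: cvg_norm; exact: cd.
  by move=> t _; rewrite /g2; case: ifPn => // /sub; exact: dg.
have H (m : nat) : (m <= n)%N -> forall x y : R, s 0 <= x -> x <= y -> y <= s m ->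
    `|h y - h x| <= \int[mu]_(t in `[x, y]) g t.
  elim: m => [|m IH] mn x y x0 xy ym.
    have -> : y = x by apply/eqP; rewrite eq_le xy (le_trans ym).
    by rewrite subrr normr0 set_itv1 Rintegral_set1.
  have [ym'|/ltW my] := leP y (s m); first by apply: IH => //; exact: ltnW.
  have [xm|/ltW mx] := leP x (s m); last exact: (piece m).
  have ysn : y <= s n by apply: le_trans ym _; exact: breakpoints_le.
  rewrite (Rintegral_cut xm my); last exact: integrable_sub_itv gi.
  rewrite -(subrKA (h (s m))) addrC; apply: le_trans (ler_normD _ _) _.
  by apply: lerD; [apply: IH => //; exact: ltnW|exact: (piece m)].
by move=> x y; exact: H.
Qed.

End PiecewiseIntegrals.

(** * Polygons as closed curves in a free homotopy class *)

Section FreeHomotopy.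
Context {R : realType}.
Variable beta : R.

Lemma klein_proj_continuous : continuous (@klein_proj R beta).
Proof. exact: pi_continuous. Qed.

(** The straight-line homotopy in the plane from [c] to the segment from 0 to [f 0]: as [f] is
    affine, the two ends are related by [f] at every stage, so the projected curves stay closed. *)
Lemma affine_lift_in_free_class (f : R * R -> R * R) (c : R -> R * R) :
  deck beta f ->
  (forall (r : R) (p q : R * R), f ((1 - r) *: p + r *: q) = (1 - r) *: f p + r *: f q) ->
  continuous c -> piecewise_C1 c -> c 1 = f (c 0) -> in_free_class beta f c.
Proof.
move=> df af cc pc c1; split => //.
  by apply/klein_projE; exists f.
pose H (z : R * R) := klein_proj beta ((1 - z.1) *: c z.2 + z.1 *: (z.2 *: f 0)).
exists H; split.
- apply: continuous_subspaceT => z.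
  apply: (@continuous_comp _ _ _ (fun z : R * R => (1 - z.1) *: c z.2 + z.1 *: (z.2 *: f 0)) (klein_proj beta)).
    apply: cvgD; apply: cvgZ.
    + by apply: cvgB; [exact: cvg_cst|exact: cvg_fst].
    + by apply: (@continuous_comp _ _ _ snd c); [exact: cvg_snd|exact: cc].
    + exact: cvg_fst.
    + by apply: cvgZr_tmp; exact: cvg_snd.
  exact: klein_proj_continuous.
- by move=> s _; rewrite /H /= subr0 scale1r scale0r addr0.
- by move=> s _; rewrite /H /= subrr scale1r scale0r add0r.
- move=> r _; rewrite /H /= !scale0r scaler0 addr0 c1 scale1r.
  by apply/klein_projE; exists f => //; rewrite -af scaler0 addr0.
Qed.

End FreeHomotopy.

Section Polygons.
Context {R : realType}.

Lemma is_derive_line (V : normedModType R) (q v : V) (t : R) :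
  is_derive t 1 (fun t : R => q + t *: v) v.
Proof.
have h : (fun h : R => h^-1 *: (q + (h *: 1 + t) *: v - (q + t *: v))) @ 0^' --> v.
  apply: (cvg_trans _ (@cvg_cst _ v _ ((0 : R)^') _)); apply: near_eq_cvg; near=> h.
  have h0 : h != 0 by near: h; exact: nbhs_dnbhs_neq.
  have -> : (h *: 1 + t) *: v = h *: v + t *: v by rewrite scalerDl -[h *: 1]/(h * 1) mulr1.
  by rewrite opprD addrACA subrr add0r addrK scalerA mulVf// scale1r.
by apply: DeriveDef; [apply/cvg_ex; exists v|exact: cvg_lim h].
Unshelve. all: by end_near. Qed.

Variables (p : R * R) (s : seq (R * R)).
Local Notation n := (size s).

Definition vertex (i : nat) : R * R := nth 0 (p :: s) i.

Definition side (i : nat) : R * R := vertex i.+1 - vertex i.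

(** Each side takes time [1 / n]. Written as a sum of clamped increments, the curve is continuous on
    the whole line and constant outside [[0, 1]]. *)
Definition polygon (t : R) : R * R :=
  p + \sum_(i < n) clamp (n%:R * t - i%:R) *: side i.

Lemma vertex0 : vertex 0 = p. Proof. by []. Qed.

Lemma vertexn : vertex n = last p s.
Proof. by rewrite /vertex -[n]/((size (p :: s)).-1) nth_last. Qed.

Lemma clamp_sum_full (x : R) m : m%:R <= x ->
  \sum_(i < m) clamp (x - i%:R) *: side i = vertex m - p.
Proof.
elim: m => [|m IH] mx; first by rewrite big_ord0 subrr.
rewrite big_ord_recr /= IH ?clamp_ge1 ?scale1r; last 2 first.
- by rewrite lerBrDr -natr1 addrC in mx *.
- by apply: le_trans mx; rewrite ler_nat.
by rewrite /side addrC addrA subrK.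
Qed.

Lemma clamp_sum_piece (x : R) i m : (i < m)%N -> i%:R <= x -> x <= i.+1%:R ->
  \sum_(j < m) clamp (x - j%:R) *: side j = vertex i - p + (x - i%:R) *: side i.
Proof.
elim: m => // m IH; rewrite ltnS leq_eqVlt => /orP[/eqP<-|im] ix xi.
  rewrite big_ord_recr /= clamp_sum_full// clamp_id ?subr_ge0//.
  by rewrite lerBlDl natr1.
rewrite big_ord_recr /= (IH im ix xi) clamp_le0 ?scale0r ?addr0// subr_le0.
by apply: le_trans xi _; rewrite ler_nat.
Qed.

Lemma polygon_cont : continuous polygon.
Proof.
suff H m : continuous (fun t : R => \sum_(i < m) clamp (n%:R * t - i%:R) *: side i).
  by move=> t; apply: cvgD; [exact: cvg_cst|exact: H].
elim: m => [|m IH] t.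
  by rewrite (_ : (fun t => _) = fun=> 0); [exact: cvg_cst|apply/funext => u; rewrite big_ord0].
rewrite (_ : (fun t => _) = fun t : R => \sum_(i < m) clamp (n%:R * t - i%:R) *: side i +
    clamp (n%:R * t - m%:R) *: side m); last by apply/funext => u; rewrite big_ord_recr.
apply: cvgD; first exact: IH.
apply: cvgZr_tmp.
apply: (@continuous_comp _ _ _ (fun t : R => n%:R * t - m%:R) clamp); last exact: clamp_cont.
by apply: cvgB; [apply: cvgM; [exact: cvg_cst|exact: cvg_id]|exact: cvg_cst].
Qed.

Hypothesis n0 : (0 < n)%N.
Let nR0 : 0 < n%:R :> R. Proof. by rewrite ltr0n. Qed.

Lemma polygon0 : polygon 0 = p.
Proof.
rewrite /polygon (@clamp_sum_piece _ 0)// ?mulr0 ?subr0 ?scale0r ?vertex0 ?subrr ?addr0//.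
Qed.

Lemma polygon1 : polygon 1 = last p s.
Proof. by rewrite /polygon mulr1 clamp_sum_full// vertexn addrC subrK. Qed.

Lemma polygon_piece i (t : R) : (i < n)%N -> t \in `[i%:R / n%:R, i.+1%:R / n%:R] ->
  polygon t = vertex i + (n%:R * t - i%:R) *: side i.
Proof.
move=> iN; rewrite in_itv /= => /andP[].
rewrite ler_pdivrMr// ler_pdivlMr// ![t * _]mulrC => it ti.
by rewrite /polygon (clamp_sum_piece iN)// addrA [p + _]addrC subrK.
Qed.

Lemma polygon_derive i (t : R) : (i < n)%N -> t \in `]i%:R / n%:R, i.+1%:R / n%:R[ ->
  is_derive t 1 polygon (n%:R *: side i).
Proof.
move=> iN ti.
apply: (@near_eq_is_derive _ _ _ (fun t : R => (vertex i - i%:R *: side i) + t *: (n%:R *: side i))).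
  have : \forall u \near t, u \in `]i%:R / n%:R, i.+1%:R / n%:R[.
    exact: near_in_itvoo.
  apply: filterS => u; rewrite in_itv /= => /andP[u1 u2].
  rewrite (polygon_piece iN) ?in_itv/= ?ltW//.
  by rewrite scalerBl scalerA [u * _]mulrC addrAC addrA.
exact: is_derive_line.
Qed.

Lemma polygon_piecewise_C1 : piecewise_C1 polygon.
Proof.
split; first exact: continuous_subspaceT polygon_cont.
exists n, (fun i => i%:R / n%:R); rewrite mul0r divff ?gt_eqF//; split => // i iN.
split; first by rewrite ltr_pM2r ?invr_gt0// ltr_nat.
exists (fun=> n%:R *: side i); first by move=> t; exact: cvg_cst.
by move=> t; exact: polygon_derive.
Qed.

End Polygons.

Section PolygonLength.
Context {R : realType}.
Variable beta : R.
Variable K : kform beta.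
Local Notation mu := (@lebesgue_measure R).

Lemma plen_sum (p : R * R) s :
  plen K p s = \sum_(i < size s) seg K (vertex p s i) (vertex p s i.+1).
Proof.
elim: s p => [|q s IH] p; first by rewrite big_ord0.
by rewrite /= big_ord_recl IH.
Qed.

Lemma polygon_length (p : R * R) s : (0 < size s)%N ->
  \int[mu]_(t in `[0, 1]) nrm K (polygon p s t) (derive1 (polygon p s) t) = plen K p s.
Proof.
move=> n0; set n := size s; have nR0 : 0 < n%:R :> R by rewrite ltr0n.
pose h (i : nat) (t : R) := nrm K (vertex p s i + (n%:R * t - i%:R) *: side p s i) (n%:R *: side p s i).
have slt (i : nat) : (i < n)%N -> i%:R / n%:R < i.+1%:R / n%:R :> R.
  by move=> _; rewrite ltr_pM2r ?invr_gt0// ltr_nat.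
have ch i : continuous (h i).
  move=> t; apply: (@continuous_comp _ _ _ (fun t : R => vertex p s i + (n%:R * t - i%:R) *: side p s i)
    (fun x => nrm K x (n%:R *: side p s i))); last exact: nrm_cont.
  apply: cvgD; first exact: cvg_cst.
  apply: cvgZr_tmp; apply: cvgB; last exact: cvg_cst.
  by apply: cvgM; [exact: cvg_cst|exact: cvg_id].
have [|i iN t ti|_] := @piecewise_integral _ (fun i => i%:R / n%:R) n slt
    (fun t => nrm K (polygon p s t) (derive1 (polygon p s) t)) h.
- by move=> i _; exact: ch.
- have ti' : t \in `[i%:R / n%:R, i.+1%:R / n%:R] by exact: subset_itv_oo_cc ti.
  rewrite (polygon_piece p n0 iN ti') derive1E.
  by have [_ ->] := polygon_derive p n0 iN ti.
rewrite mul0r divff ?gt_eqF// => ->; rewrite plen_sum; apply: eq_bigr => i _.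
rewrite Rintegral_affine//; last exact: ltW (slt i (ltn_ord i)).
have E : i.+1%:R / n%:R - i%:R / n%:R = n%:R^-1 :> R.
  by rewrite -mulrBl -natrB// subSnn mul1r.
rewrite E /seg -RintegralZl//; last first.
  apply: (@continuous_integrable _ (fun t : R => h i (i%:R / n%:R + t / n%:R))) => t.
  apply: (@continuous_comp _ _ _ (fun t : R => i%:R / n%:R + t / n%:R) (h i)); last exact: ch.
  by apply: cvgD; [exact: cvg_cst|apply: cvgM; [exact: cvg_id|exact: cvg_cst]].
apply: eq_Rintegral => t _; rewrite /h nrmZ gtr0_norm// mulKf ?gt_eqF//.
congr nrm; congr (_ + _ *: _).
by rewrite mulrDr mulrCA divff ?gt_eqF// mulr1 mulrCA divff ?gt_eqF// mulr1 addrAC subrr add0r.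
Qed.

End PolygonLength.

(** * From smooth metrics to continuous forms, and strictness *)

Section MetricToForm.
Context {R : realType}.
Variable beta : R.
Hypothesis beta0 : 0 < beta.
Local Notation mu := (@lebesgue_measure R).
Local Notation mu2 := (mu \x mu)%E.

Lemma scale_mul (a b : R) : a *: (b : R^o) = a * b. Proof. by []. Qed.

Section Metric.
Variable g : riemannian_metric beta.

Let gE p := g p (1, 0) (1, 0).
Let gF p := g p (1, 0) (0, 1).
Let gG p := g p (0, 1) (0, 1).

Lemma metric_continuous u v : continuous (fun p => g p u v).
Proof. by move=> p; apply: differentiable_continuous; exact: (metric_smooth g u v [::] p). Qed.

Lemma metric_lin0 p v : g p 0 v = 0.
Proof.
by have := metric_linear g p v 1 0 0; rewrite scaler0 addr0 mul1r => h; lra.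
Qed.

Lemma metric_expand p v : g p v v = qf (gE p) (gF p) (gG p) v.
Proof.
have lin (u w : R * R) : g p (u.1, u.2) w = u.1 * g p (1, 0) w + u.2 * g p (0, 1) w.
  have -> : (u.1, u.2) = u.1 *: (1, 0) + (u.2 *: (0, 1) + 0) :> R * R.
    by rewrite addr0; apply: pair_ext; rewrite /= ?scale_mul; ring.
  by rewrite !metric_linear metric_lin0 addr0.
case: v => x y.
have lin2 u : g p u (x, y) = x * g p u (1, 0) + y * g p u (0, 1).
  by rewrite Defs.metric_sym (lin (x, y)) /= !(Defs.metric_sym g p _ u).
rewrite (lin (x, y)) /= !lin2.
by rewrite /qf /gE /gF /gG /= (Defs.metric_sym g p (0, 1) (1, 0)); ring.
Qed.

Lemma metric_disc_gt0 p : 0 < gE p * gG p - gF p ^+ 2.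
Proof.
(* At the vector [(- F, E)] the form takes the value [E (E G - F ^ 2)]. *)
have v0 : (- gF p, gE p) != 0 :> R * R.
  apply/eqP => -[_ h]; have : 0 < gE p by apply: Defs.metric_pos; apply/eqP => -[]; lra.
  by rewrite h ltxx.
have E0 : 0 < gE p by apply: Defs.metric_pos; apply/eqP => -[]; lra.
have := Defs.metric_pos g p v0; rewrite metric_expand /qf /= => h.
have {}h : 0 < gE p * (gE p * gG p - gF p ^+ 2) by move: h; congr (_ < _); ring.
by rewrite pmulr_rgt0 in h.
Qed.

Lemma metric_neg p u v : g p (- u) v = - g p u v.
Proof. by have := metric_linear g p v (-1) u 0; rewrite scaleN1r addr0 metric_lin0 addr0 mulN1r. Qed.

(** Kept transparent, so that [volume_form_of] holds by computation. *)
Definition form_of : kform beta.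
Proof.
apply: (@KForm _ _ gE gF gG); try exact: metric_continuous.
- by move=> p; rewrite /gE -[RHS](metric_glide g) /= oppr0.
- move=> p; rewrite /gF -[g p _ _](metric_glide g) /= oppr0.
  by rewrite [in RHS]Defs.metric_sym -metric_neg [RHS]Defs.metric_sym; congr (g _ _ _); apply: pair_ext; rewrite /=; lra.
- move=> p; rewrite /gG -[RHS](metric_glide g) /=.
  have -> : (0, -1) = - (0, 1) :> R * R by apply: pair_ext; rewrite /=; lra.
  by rewrite metric_neg Defs.metric_sym metric_neg opprK.
- by move=> p; exact: metric_vtrans.
- by move=> p; exact: metric_vtrans.
- by move=> p; exact: metric_vtrans.
- by move=> p; apply: Defs.metric_pos; apply/eqP => -[]; lra.
- exact: metric_disc_gt0.
Defined.

Lemma nrm_form_of p v : nrm form_of p v = Num.sqrt (g p v v).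
Proof. by rewrite metric_expand. Qed.

Lemma volume_form_of :
  volume g = \int[mu2]_(p in `[0, pi] `*` `[0, 2 * beta]) area_density form_of p.
Proof. by []. Qed.

Lemma length_ge0 (c : R -> R * R) : 0 <= length g c.
Proof. by apply: Rintegral_ge0 => t _; exact: sqrtr_ge0. Qed.

Lemma length_form_of (c : R -> R * R) :
  length g c = \int[mu]_(s in `[0, 1]) nrm form_of (c s) (derive1 c s).
Proof. by apply: eq_Rintegral => s _; rewrite nrm_form_of. Qed.

Lemma least_length_le (f : R * R -> R * R) c : in_free_class beta f c -> least_length f g <= length g c.
Proof.
move=> fc; apply: ge_inf; last by exists c.
by exists 0 => _ [c' _ <-]; exact: length_ge0.
Qed.

Lemma least_length_ge0 (f : R * R -> R * R) : 0 <= least_length f g.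
Proof.
(* For an arbitrary [f] the class may be empty, and [inf] then takes the default value 0. *)
rewrite /least_length; have [->|/set0P h] := eqVneq [set length g c | c in in_free_class beta f] set0.
  by rewrite inf0.
by apply: lb_le_inf => // _ [c _ <-]; exact: length_ge0.
Qed.

Lemma least_length_le_dist (f : R * R -> R * R) (p : R * R) : deck beta f ->
  (forall (r : R) (p q : R * R), f ((1 - r) *: p + r *: q) = (1 - r) *: f p + r *: f q) ->
  f p <> p -> least_length f g <= dist form_of p (f p).
Proof.
move=> df af fp; apply: dist_lb => s sp.
(* As [f] moves [p], the polygon has at least one side, as its parametrization by [[0, 1]]
   requires. *)
have s0 : (0 < size s)%N by case: s sp => // h; case: fp.
rewrite -polygon_length// -length_form_of; apply: least_length_le.
apply: affine_lift_in_free_class => //.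
- exact: polygon_cont.
- exact: polygon_piecewise_C1.
- by rewrite polygon1// polygon0.
Qed.

Lemma l_sigma_le p : l_sigma g <= dist form_of p (glide p).
Proof.
apply: least_length_le_dist; first exact: deck_glide.
- by move=> r u w; apply: pair_ext; rewrite /= ?scale_mul; ring.
- by case: p => x y [] h _; have := pi_gt0 R; lra.
Qed.

Lemma l_v_le p : l_v g <= dist form_of p (p + tvec beta).
Proof.
rewrite -vtransE; apply: least_length_le_dist; first exact: deck_vtrans.
- by move=> r u w; apply: pair_ext; rewrite /= ?scale_mul; ring.
- by case: p => x y [] h; have := beta0; lra.
Qed.

Lemma l_h_le p : l_h g <= dist form_of p (p + hvec).
Proof.
rewrite -glide_glide; apply: (@least_length_le_dist (glide \o glide)).
- by apply: deck_comp; exact: deck_glide.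
- by move=> r u w; apply: pair_ext; rewrite /= ?scale_mul; ring.
- by case: p => x y /= [] h _; have := pi_gt0 R; lra.
Qed.

Theorem strict_isosystolic : L_sigma g * l_v g < 2 * volume g.
Proof.
have v0 : 0 < volume g.
  rewrite volume_form_of.
  have b0 : 0 < 2 * beta by rewrite mulr_gt0.
  have := @rect_integral_lt _ pi (2 * beta) (pi_gt0 R) b0 (fun=> 0) (area_density form_of).
  rewrite (_ : \int[mu2]_(p in _) 0 = 0); last by rewrite /Rintegral integral0.
  apply => //.
  - by move=> p; exact: cvg_cst.
  - exact: area_density_cont.
  - by move=> p; exact: ltW (area_density_gt0 _ p).
  - exists 0; split; rewrite ?in_itv/= ?lexx ?pi_ge0 ?mulr_ge0 ?(ltW beta0)//.
    exact: area_density_gt0.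
have Ls0 : 0 <= L_sigma g by rewrite le_min !least_length_ge0.
(* The conformal factor [L / e] makes sense as a metric for [L > 0] only; when [L = 0], positivity
   of the area is enough. *)
have [L0|/eqP L0] := eqVneq (L_sigma g) 0; first by rewrite L0 mul0r mulr_gt0.
have {L0}Ls0 : 0 < L_sigma g by rewrite lt0r Ls0 andbT; apply/eqP.
have Lh p : L_sigma g <= dist form_of p (p + hvec) by rewrite ge_min l_h_le orbT.
have Lg p : L_sigma g <= dist form_of p (glide p) by rewrite ge_min l_sigma_le.
have [//|cst] := strict_or_constant beta0 Ls0 (least_length_ge0 _) Lh l_v_le.
by case: (no_constant_displacement beta0 Ls0 cst Lg).
Qed.

End Metric.
End MetricToForm.

(** * Linear calibrations of piecewise C1 curves *)

Section LengthVariation.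
Context {R : realType}.
Variable beta : R.
Variable K : kform beta.
Local Notation mu := (@lebesgue_measure R).

Lemma nrm_cont_along (c v : R -> R * R) : continuous c -> continuous v ->
  continuous (fun t => nrm K (c t) (v t)).
Proof.
move=> cc cv t; apply: (@continuous_comp _ _ _
  (fun t => qf (kE K (c t)) (kF K (c t)) (kG K (c t)) (v t))); last exact: sqrt_continuous.
have cont1 (k : R * R -> R) : continuous k -> continuous (fun t => k (c t)).
  by move=> ck u; apply: (@continuous_comp _ _ _ c k); [exact: cc|exact: ck].
have v1 := comp_fst_cont cv; have v2 := comp_snd_cont cv.
apply: cvgD; first apply: cvgD.
- by apply: cvgM; [exact: cont1 _ (@kE_cont _ _ K) t|apply: (@continuous_comp _ _ _ (fun t => (v t).1) (fun x : R => x ^+ 2)); [exact: v1|exact: exprn_continuous]].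
- apply: cvgM; last exact: v2.
  apply: cvgM; last exact: v1.
  by apply: cvgM; [exact: cvg_cst|exact: cont1 _ (@kF_cont _ _ K) t].
- by apply: cvgM; [exact: cont1 _ (@kG_cont _ _ K) t|apply: (@continuous_comp _ _ _ (fun t => (v t).2) (fun x : R => x ^+ 2)); [exact: v2|exact: exprn_continuous]].
Qed.

Lemma clamp_continuous (c : R -> R * R) : {within `[0, 1], continuous c} ->
  continuous (fun t : R => c (clamp t)).
Proof.
move=> /subspace_continuousP cc t.
have h01 (u : R) : `[0, 1]%classic (clamp u).
  by have [a b] := clamp_itv u; rewrite /= in_itv /= a b.
have h := cc _ (h01 t).
apply: (cvg_comp _ _ _ h) => A /=; rewrite /within /= => hA.
have := clamp_cont hA; rewrite !nbhs_simpl /=.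
by apply: filterS => u; apply; exact: h01.
Qed.

Lemma is_derive_linear (c : R -> R * R) (phi : R * R -> R) (t : R) (v : R * R) :
  continuous phi -> (forall a p q, phi (a *: (p - q)) = a * (phi p - phi q)) ->
  is_derive t 1 c v -> is_derive t 1 (phi \o c) (phi v).
Proof.
move=> cphi lphi [/cvg_ex[l cl] dv].
have lv : l = v by rewrite -dv; apply/esym; exact: cvg_lim cl.
rewrite {}lv in cl.
have h : (fun h : R => h^-1 *: ((phi \o c) (h *: 1 + t) - (phi \o c) t)) @ 0^' --> phi v.
  rewrite (_ : (fun h => _) = phi \o (fun h : R => h^-1 *: (c (h *: 1 + t) - c t))).
    by apply: cvg_comp cl _; exact: cphi.
  by apply/funext => h /=; rewrite lphi.
by apply: DeriveDef; [apply/cvg_ex; exists (phi v)|exact: cvg_lim h].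
Qed.

Variable c : R -> R * R.
Hypothesis pc : piecewise_C1 c.

Let speed (t : R) := nrm K (c t) (derive1 c t).

Lemma speed_integrable : mu.-integrable `[0, 1] (EFin \o speed).
Proof.
have [cc [n [s [s0 sn sP]]]] := pc.
have /choice[d dP] : forall i, exists d : R -> R * R, (i < n)%N -> continuous d /\
    forall t, t \in `]s i, s i.+1[ -> is_derive t 1 c (d t).
  move=> i; have [iN|] := ltnP i n; last by exists (fun=> 0).
  by have [_ [d cd dd]] := sP i iN; exists d.
have slt i : (i < n)%N -> s i < s i.+1 by move=> iN; case: (sP i iN).
have [||+ _] := @piecewise_integral _ s n slt speed (fun i t => nrm K (c (clamp t)) (d i t)).
- by move=> i iN; apply: nrm_cont_along; [exact: clamp_continuous|exact: (dP i iN).1].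
- move=> i iN t ti; have [_ E] := (dP i iN).2 t ti.
  have tb : s 0 <= s i /\ s i.+1 <= s n.
    by split; apply: (breakpoints_le slt) => //; exact: ltnW.
  move: (ti); rewrite in_itv /= => /andP[t1 t2].
  rewrite /speed derive1E E clamp_id//.
    by rewrite -s0; apply: le_trans tb.1 (ltW t1).
  by rewrite -sn; apply: le_trans (ltW t2) tb.2.
- by rewrite s0 sn.
Qed.

(** A linear form of dual norm at most 1 at the points of the curve calibrates: its derivative along
    the curve is bounded by the speed. This replaces any comparison of curves with polygons when
    lengths are bounded from below. *)
Lemma variation_le_length (phi : R * R -> R) (x y : R) :
  continuous phi -> (forall a p q, phi (a *: (p - q)) = a * (phi p - phi q)) ->
  (forall t v, 0 <= t -> t <= 1 -> `|phi v| <= nrm K (c t) v) ->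
  0 <= x -> x <= y -> y <= 1 ->
  `|phi (c y) - phi (c x)| <= \int[mu]_(t in `[x, y]) speed t.
Proof.
move=> cphi lphi phiK x0 xy y1.
have [cc [n [s [s0 sn sP]]]] := pc.
have /choice[d dP] : forall i, exists d : R -> R * R, (i < n)%N -> continuous d /\
    forall t, t \in `]s i, s i.+1[ -> is_derive t 1 c (d t).
  move=> i; have [iN|] := ltnP i n; last by exists (fun=> 0).
  by have [_ [d cd dd]] := sP i iN; exists d.
have slt i : (i < n)%N -> s i < s i.+1 by move=> iN; case: (sP i iN).
apply: (@piecewise_variation _ s n slt (phi \o c) speed (fun i t => phi (d i t))); rewrite ?s0 ?sn//.
- apply/subspace_continuousP => t t01; move/subspace_continuousP: cc => /(_ _ t01) h.
  by apply: cvg_comp h _; exact: cphi.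
- move=> i iN t; apply: (@continuous_comp _ _ _ (d i) phi); last exact: cphi.
  exact: (dP i iN).1.
- by move=> i iN t ti; apply: is_derive_linear => //; exact: (dP i iN).2.
- exact: speed_integrable.
- move=> i iN t ti; have [_ E] := (dP i iN).2 t ti.
  have tb : s 0 <= s i /\ s i.+1 <= s n.
    by split; apply: (breakpoints_le slt) => //; exact: ltnW.
  move: (ti); rewrite in_itv /= => /andP[t1 t2].
  rewrite /speed derive1E E; apply: phiK.
    by rewrite -s0; apply: le_trans tb.1 (ltW t1).
  by rewrite -sn; apply: le_trans (ltW t2) tb.2.
Qed.

End LengthVariation.

(** * Lifting free homotopies *)

Section Lifting.
Context {R : realType}.
Variable beta : R.
Hypothesis beta0 : 0 < beta.
Local Notation lat := (lat beta).
Local Notation proj := (@klein_proj R beta).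

Lemma glideDlat (p : R * R) k n : glide (p + lat k n) = glide p + lat k (- n).
Proof. by rewrite glideD refl2_lat. Qed.

(** The normal form of group elements: the translations form a subgroup of index two, with [glide]
    representing the other coset. *)
Lemma deckP f : deck beta f -> exists k n : int,
  (forall p, f p = p + lat k n) \/ (forall p, f p = glide p + lat k n).
Proof.
elim=> {f} [|||f h _ [k [n fE]] _ [k' [n' hE]]|f h _ [k [n fE]] fh hf].
- by exists 0, 0; left => p; rewrite lat00 addr0.
- by exists 0, 0; right => p; rewrite lat00 addr0.
- by exists 0, 1; left => p; rewrite vtransE lat01.
- case: fE hE => fE [] hE.
  + by exists (k' + k), (n' + n); left => p /=; rewrite fE hE -addrA -latD.
  + by exists (k' + k), (n' + n); right => p /=; rewrite fE hE -addrA -latD.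
  + by exists (k' + k), (- n' + n); right => p /=; rewrite fE hE glideDlat -addrA -latD.
  + exists (1 + (k' + k)), (0 + (- n' + n)); left => p /=.
    by rewrite fE hE glideDlat glide_glide -(lat10 beta) !latD !addrA.
- case: fE => fE.
  + exists (- k), (- n); left => p; rewrite -[p in LHS](subrK (lat k n)) -fE fh latN//.
  + exists (- (1 + k)), n; right => p.
    have := hf p; set q := h p => <-.
    rewrite fE glideDlat glide_glide -(lat10 beta) -!(addrA q) -!(addrA _ (lat k _)) -!latD.
    by rewrite add0r addNr addrA subrr lat00 addr0.
Qed.

Lemma refl2_norm (v : R * R) : `|refl2 v| = `|v|.
Proof. by rewrite !prod_normE /= normrN. Qed.

Lemma deck_isometry f p q : deck beta f -> `|f p - f q| = `|p - q|.
Proof.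
move=> /deckP[k [n [] fE]]; rewrite !fE opprD addrACA subrr addr0//.
by rewrite glideB refl2_norm.
Qed.

(** In the sup norm every nontrivial element moves every point at least this far: elements outside
    the translation subgroup shift the first coordinate by an odd multiple of [pi], and translations
    shift one coordinate by at least a full period. *)
Definition inj_radius : R := Num.min pi (2 * beta).

Lemma inj_radius_gt0 : 0 < inj_radius.
Proof. by rewrite lt_min pi_gt0 mulr_gt0. Qed.

Lemma small_int (a : R) (k : int) : 0 < a -> `|a * k%:~R| < a -> k = 0.
Proof.
move=> a0; rewrite normrM gtr0_norm// -[ltRHS]mulr1 ltr_pM2l//.
by rewrite -intr_norm -[1]/((1 : int)%:~R) ltr_int => h; move: h; clear; lia.
Qed.

Lemma deck_small f p : deck beta f -> `|f p - p| < inj_radius -> f =1 id.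
Proof.
move=> /deckP[k [n [] fE]]; rewrite fE lt_min => /andP[s1 s2] q; rewrite fE.
  have E : p + lat k n - p = lat k n by rewrite addrAC subrr add0r.
  rewrite E in s1 s2; have [n1 n2] := coord_le_norm (lat k n).
  have -> : n = 0 by apply: (@small_int (2 * beta)); [rewrite mulr_gt0|exact: le_lt_trans s2].
  have -> : k = 0.
    apply: (@small_int (2 * pi)); first by rewrite mulr_gt0// pi_gt0.
    apply: lt_trans (le_lt_trans n1 s1) _; have := pi_gt0 R; lra.
  by rewrite lat00 addr0.
have [n1 _] := coord_le_norm (glide p + lat k n - p).
have := le_lt_trans n1 s1.
have -> : (glide p + lat k n - p).1 = pi * (1 + 2 * k)%:~R.
  by rewrite /= intrD intrM /=; ring.
by move/(small_int (pi_gt0 R)) => h; move: h; clear; lia.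
Qed.

Lemma lift_unique x y : proj x = proj y -> `|x - y| < inj_radius -> x = y.
Proof.
move=> /klein_projE[f df <-]; rewrite distrC => /(deck_small df) fid.
by rewrite fid.
Qed.

Lemma deck_eq f h p : deck beta f -> deck beta h -> f p = h p -> f =1 h.
Proof.
move=> df /deck_has_inverse[h' [dh' hh' h'h]] fh q.
have : (h' \o f) =1 id.
  apply: (@deck_small _ p); first exact: deck_comp.
  by rewrite /= fh hh' subrr normr0 inj_radius_gt0.
by move=> /(_ q) /= E; rewrite -(h'h (f q)) E.
Qed.

Lemma proj_surj k : exists x, proj x = k.
Proof. by exists (repr k); exact: reprK. Qed.

(** The preimage in the plane is the union of the images of a ball under the group, hence open,
    because the group acts by isometries of the sup norm. *)
Lemma nbhs_lifts (x0 : R * R) (e : R) : 0 < e ->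
  nbhs (proj x0) [set k | exists2 x, proj x = k & `|x0 - x| < e].
Proof.
move=> e0; apply: open_nbhs_nbhs; split; last by exists x0; rewrite ?subrr ?normr0.
rewrite /open /=.
change (open (proj @^-1` [set k | exists2 x, proj x = k & `|x0 - x| < e])).
rewrite openE => y [x xy xe]; apply/nbhs_ballP.
exists (e - `|x0 - x|); first by rewrite /= subr_gt0.
move=> y'; rewrite -ball_normE /= => yy.
have [f df fx] := (klein_projE beta _ _).1 xy.
have [f' [df' ff' f'f]] := deck_has_inverse df.
exists (f' y').
  by apply/klein_projE; exists f.
have -> : x0 - f' y' = (x0 - x) + (f' y - f' y') by rewrite -fx ff' addrA subrK.
apply: le_lt_trans (ler_normD _ _) _; rewrite deck_isometry//; lra.
Qed.

Local Notation square := (`[0, 1] `*` `[0, 1] : set (R * R)).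

(** Locally the homotopy stays in the image of a small ball, so close points have close lifts; a
    deck transformation adapts them to the prescribed lift [x], and a Lebesgue number makes this
    uniform. *)
Lemma small_lifts (H : R * R -> klein beta) (e : R) : {within square, continuous H} -> 0 < e ->
  exists2 d : R, 0 < d & forall z z', square z -> square z' -> `|z - z'| < d ->
    forall x, proj x = H z -> exists2 x', proj x' = H z' & `|x - x'| < e.
Proof.
move=> /subspace_continuousP cH e0; apply: lebesgue_number; first exact: rect_compact.
move=> z zS; have [x0 x0z] := proj_surj (H z).
have e2 : 0 < e / 2 by rewrite divr_gt0.
have hz : nbhs (H z) [set k | exists2 x, proj x = k & `|x0 - x| < e / 2].
  by rewrite -x0z; exact: nbhs_lifts.
have /nbhs_ballP[r /= r0 rP] : \forall w \near z, square w -> exists2 x, proj x = H w & `|x0 - x| < e / 2.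
  exact: (cH z zS _ hz).
exists r => // z1 z2 z1S z2S zz1 zz2 x xz1.
have [x1 x1E x1d] : exists2 x, proj x = H z1 & `|x0 - x| < e / 2 by apply: rP z1S; rewrite -ball_normE.
have [x2 x2E x2d] : exists2 x, proj x = H z2 & `|x0 - x| < e / 2 by apply: rP z2S; rewrite -ball_normE.
have [f df fx] : exists2 f, deck beta f & f x1 = x by apply/klein_projE; rewrite x1E.
exists (f x2).
  by rewrite -x2E; apply/esym/klein_projE; exists f.
rewrite -fx deck_isometry// -(subrKA x0) (splitr e).
by apply: le_lt_trans (ler_normD _ _) _; rewrite ltrD// distrC.
Qed.

(** The homotopy is lifted on the nodes of a fine grid only, row by row. The deck transformation [g]
    relating the ends of a row is the same for all rows, since lifts of one point that are close
    coincide; on the last row, a lift of [deck_loop f], it is conjugate to [f]. *)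
Theorem free_class_lift f c : deck beta f -> in_free_class beta f c ->
  exists del p, [/\ deck beta del, c 0 = del p & c 1 = del (f p)].
Proof.
move=> df [[cc _] c01 [H [cH H0 H1 Hper]]].
(* Lifts are compared through chains of total length below [4 e] ([near4]), which is less than
   [inj_radius] as [lift_unique] requires. *)
have r0 := inj_radius_gt0; pose e := inj_radius / 8.
have e0 : 0 < e by rewrite divr_gt0.
have [d1 d10 d1P] := small_lifts cH e0.
have [d2 d20 d2P] : exists2 d : R, 0 < d & forall s t, `[0, 1]%classic s -> `[0, 1]%classic t ->
    `|s - t| < d -> `|c s - c t| < e.
  apply: lebesgue_number; first exact: segment_compact.
  move=> s s01; move/subspace_continuousP: cc => /(_ _ s01) /cvgrPdist_lt /(_ (e / 2)).
  rewrite divr_gt0// => /(_ isT) /nbhs_ballP[r /= rr rP]; exists r => // u v u01 v01 su sv.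
  have hu : `|c s - c u| < e / 2 by apply: rP u01; rewrite -ball_normE.
  have hv : `|c s - c v| < e / 2 by apply: rP v01; rewrite -ball_normE.
  rewrite -(subrKA (c s)) (splitr e).
  by apply: le_lt_trans (ler_normD _ _) _; rewrite ltrD// distrC.
pose D := Num.min d1 d2 ; have D0 : 0 < D by rewrite lt_min d10 d20.
(* The mesh [1 / N] is below [D], and the segment from 0 to [f 0] advances by less than [e] per
   step. *)
have [N [N0 NP]] := exists_nat_gt (2 / D + `|f 0| * 2 / e).
have N0R : 0 < N%:R :> R by rewrite ltr0n.
have h1 : 0 < 2 / D by rewrite divr_gt0.
have h2 : 0 <= `|f 0| * 2 / e by rewrite divr_ge0 ?mulr_ge0// ltW.
have hN : N%:R^-1 < D.
  rewrite invf_plt ?posrE//; apply: lt_le_trans NP; apply: ltr_wpDr => //.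
  by rewrite -[ltLHS]mul1r ltr_pM2r ?invr_gt0// ltr1n.
have hf : `|f 0| / N%:R < e.
  rewrite ltr_pdivrMr// mulrC -ltr_pdivrMr//; apply: lt_le_trans NP.
  have : `|f 0| / e <= `|f 0| * 2 / e by rewrite ler_pM2r ?invr_gt0// ler_peMr// ler1n.
  by move: h1; lra.
have node (i : nat) : (i <= N)%N -> i%:R / N%:R \in (`[0, 1] : interval R).
  move=> iN; rewrite in_itv /= divr_ge0 ?ler0n//= ler_pdivrMr// mul1r ler_nat//.
have step (i : nat) : `|i%:R / N%:R - i.+1%:R / N%:R| = N%:R^-1 :> R.
  by rewrite -mulrBl -natr1 opprD addrA subrr add0r mulN1r normrN gtr0_norm ?invr_gt0.
have node_near (i j i' j' : nat) : (i <= N)%N -> (j <= N)%N -> (i' <= N)%N -> (j' <= N)%N ->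
    (i' = i /\ j' = j.+1) \/ (i' = i.+1 /\ j' = j) ->
    forall x, proj x = H (i%:R / N%:R, j%:R / N%:R) ->
    exists2 x', proj x' = H (i'%:R / N%:R, j'%:R / N%:R) & `|x - x'| < e.
  move=> iN jN i'N j'N ij x xE.
  apply: d1P xE; try by split; apply: node.
  apply: lt_le_trans (_ : D <= _); last by rewrite ge_min lexx.
  rewrite prod_normE /= gt_max.
  by case: ij => -[-> ->]; rewrite step subrr normr0 D0 hN.
pose row (i : nat) (g : R * R -> R * R) := exists x : nat -> R * R,
  [/\ forall j, (j <= N)%N -> proj (x j) = H (i%:R / N%:R, j%:R / N%:R),
      forall j, (j < N)%N -> `|x j - x j.+1| < e & x N = g (x 0)].
have near4 (x y z w : R * R) (k : klein beta) : proj x = k -> proj w = k ->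
    `|x - y| < e -> `|y - z| < e -> `|z - w| < 2 * e -> x = w.
  move=> xk wk xy yz zw; apply: lift_unique; first by rewrite xk wk.
  have -> : x - w = (x - y) + (y - z) + (z - w) by rewrite !subrKA.
  have := ler_normD (x - y + (y - z)) (z - w); have := ler_normD (x - y) (y - z).
  move: xy yz zw; rewrite /e; lra.
have [g dg gc] := (klein_projE beta _ _).1 c01.
have rowS i : (i < N)%N -> row i g -> row i.+1 g.
  move=> iN [x [xH xs xN]].
  have /choice[y yP] : forall j, exists y, (j <= N)%N ->
      proj y = H (i.+1%:R / N%:R, j%:R / N%:R) /\ `|x j - y| < e.
    move=> j; have [jN|] := leqP j N; last by exists 0.
    have [y yE yd] := node_near i j i.+1 j (ltnW iN) jN iN jN (or_intror (conj erefl erefl)) _ (xH j jN).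
    by exists y.
  exists y; split.
  - by move=> j jN; case: (yP j jN).
  - move=> j jN; have [yE yd] := yP j (ltnW jN); have [yE' yd'] := yP j.+1 jN.
    have [z zE zd] := node_near i.+1 j i.+1 j.+1 iN (ltnW jN) iN jN (or_introl (conj erefl erefl)) _ yE.
    suff -> : y j.+1 = z by [].
    apply: (near4 _ (x j.+1) (x j) _ _ yE' zE); [by rewrite distrC|by rewrite distrC; exact: xs|].
    have := ler_normD (x j - y j) (y j - z); rewrite addrA subrK; move: yd zd; lra.
  - have [yE yd] := yP N (leqnn N); have [yE0 yd0] := yP 0%N (leq0n N).
    have gy : proj (g (y 0)) = H (i.+1%:R / N%:R, N%:R / N%:R).
      have <- : proj (y 0) = proj (g (y 0)) by apply/klein_projE; exists g.
      by rewrite yE0 mul0r divff ?gt_eqF//; apply: Hper; exact: node.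
    apply: (near4 _ (x N) (x N) _ _ yE gy); [by rewrite distrC|by rewrite subrr normr0|].
    by rewrite xN deck_isometry//; move: yd0 e0; lra.
have row0 : row 0%N g.
  exists (fun j => c (j%:R / N%:R)); split.
  - by move=> j jN; rewrite mul0r H0//; exact: node.
  - move=> j jN; apply: d2P; [exact: node (ltnW jN)|exact: node jN|].
    by rewrite step (lt_le_trans hN)// ge_min lexx orbT.
  - by rewrite mul0r divff ?gt_eqF.
have rowN : row N g.
  have : forall i, (i <= N)%N -> row i g.
    by elim=> // i IH iN; apply: rowS => //; apply: IH; exact: ltnW.
  exact.
have [x [xH xs xN]] := rowN.
have NN : N%:R / N%:R = 1 :> R by rewrite divff ?gt_eqF.
have xH' j : (j <= N)%N -> proj (x j) = proj ((j%:R / N%:R) *: f 0).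
  by move=> jN; rewrite xH// NN H1//; exact: node.
have [del ddel dx0] : exists2 f, deck beta f & f 0 = x 0%N.
  by apply/klein_projE; rewrite xH'// mul0r scale0r.
have xE j : (j <= N)%N -> x j = del ((j%:R / N%:R) *: f 0).
  elim: j => [|j IH] jN; first by rewrite mul0r scale0r.
  apply: (near4 _ (x j) (x j) _ _ (xH' _ jN)).
  - by apply/esym/klein_projE; exists del.
  - by rewrite distrC; exact: xs.
  - by rewrite subrr normr0.
  - rewrite (IH (ltnW jN)) deck_isometry// -scalerBl normrZ step mulrC.
    by move: hf e0; lra.
(* The last row is the image under [del] of the segment from 0 to [f 0]. Both compositions send 0 to
   its final point, and the action is free. *)
have gd : (g \o del) =1 (del \o f).
  apply: (@deck_eq _ _ 0); try exact: deck_comp.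
  by rewrite /= dx0 -xN xE// NN scale1r.
have [del' [ddel' dd' d'd]] := deck_has_inverse ddel.
exists del, (del' (c 0)); split; rewrite ?d'd//.
by rewrite -[RHS]/((del \o f) _) -gd /= d'd.
Qed.

End Lifting.

(** * Collapsing metrics *)

Section ClassEndpoints.
Context {R : realType}.
Variable beta : R.
Hypothesis beta0 : 0 < beta.

Lemma vtrans_class_end c : in_free_class beta (vtrans beta) c -> `|(c 1).2 - (c 0).2| = 2 * beta.
Proof.
move=> /(free_class_lift beta0 (deck_vtrans beta))[f [p [df -> ->]]].
have b0 : 0 <= 2 * beta by rewrite mulr_ge0// ltW.
have [k [n [] fE]] := deckP df; rewrite !fE /=.
  by rewrite -[RHS]ger0_norm//; congr `|_|; ring.
by rewrite -[RHS]ger0_norm// -[RHS]normrN; congr `|_|; ring.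
Qed.

(** A conjugate of [glide] is a glide reflection with the same horizontal shift whose axis [y = y0]
    has been translated by a multiple of [2 beta]. *)
Lemma glide_class_end c : in_free_class beta glide c ->
  (c 1).1 - (c 0).1 = pi /\ exists y0 : R, (c 1).2 - y0 = - ((c 0).2 - y0) /\ exists m : int, y0 = 2 * beta * m%:~R.
Proof.
move=> /(free_class_lift beta0 (deck_glide beta))[f [p [df -> ->]]].
have [k [n [] fE]] := deckP df; rewrite !fE /=.
  by split; [ring|exists (2 * beta * n%:~R); split; [ring|exists n]].
by split; [ring|exists (2 * beta * n%:~R); split; [ring|exists n]].
Qed.

Lemma glide2_class_end c : in_free_class beta (glide \o glide) c -> c 1 = c 0 + hvec.
Proof.
have dg := deck_glide beta.
move=> /(free_class_lift beta0 (deck_comp dg dg))[f [p [df -> ->]]].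
have [k [n [] fE]] := deckP df; rewrite !fE /= glide_glide ?glide_hvec addrAC//.
Qed.

Lemma least_length_ge (g : riemannian_metric beta) (f : R * R -> R * R) (b : R) : deck beta f ->
  (forall (r : R) (p q : R * R), f ((1 - r) *: p + r *: q) = (1 - r) *: f p + r *: f q) ->
  (forall c, in_free_class beta f c -> b <= length g c) -> b <= least_length f g.
Proof.
move=> df af fb; apply: lb_le_inf => [|_ [c cf <-]]; last exact: fb.
exists (length g (polygon 0 [:: f 0])), (polygon 0 [:: f 0]) => //.
apply: affine_lift_in_free_class => //.
- exact: polygon_cont.
- exact: polygon_piecewise_C1.
- by rewrite polygon1// polygon0.
Qed.

End ClassEndpoints.

(** * Smoothness of trigonometric polynomials *)

Section TrigonometricFunctions.
Context {R : realType}.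
Variable w : R.

(** A class of functions closed under differentiation, so that [smooth] follows by induction on the
    list of directions. *)
Inductive trig : (R -> R) -> Prop :=
| trig_cst k : trig (fun=> k)
| trig_sin : trig (fun y => sin (w * y))
| trig_cos : trig (fun y => cos (w * y))
| trig_add f h : trig f -> trig h -> trig (fun y => f y + h y)
| trig_mul f h : trig f -> trig h -> trig (fun y => f y * h y).

Lemma trig_derivative f : trig f -> exists2 f', trig f' & forall y : R, is_derive y 1 f (f' y).
Proof.
have lin (y : R) : is_derive y 1 (fun y : R => w * y) w.
  have := is_deriveM (is_derive_cst w y 1) (is_derive_id y 1).
  by rewrite scaler0 addr0 => h; apply: is_derive_eq h _; exact: mulr1.
elim=> {f} [k|||f h _ [f' tf' df] _ [h' th' dh]|f h tf [f' tf' df] th [h' th' dh]].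
- by exists (fun=> 0); [exact: trig_cst|move=> y; exact: is_derive_cst].
- exists (fun y => cos (w * y) * w).
    by apply: trig_mul; [exact: trig_cos|exact: trig_cst].
  by move=> y; exact: (is_derive1_comp (is_derive_sin _) (lin y)).
- exists (fun y => ((-1) * sin (w * y)) * w).
    apply: trig_mul; last exact: trig_cst.
    by apply: trig_mul; [exact: trig_cst|exact: trig_sin].
  by move=> y; rewrite mulN1r; exact: (is_derive1_comp (is_derive_cos _) (lin y)).
- exists (fun y => f' y + h' y); first exact: trig_add.
  by move=> y; exact: (is_deriveD (df y) (dh y)).
- exists (fun y => f y * h' y + h y * f' y).
    by apply: trig_add; exact: trig_mul.
  by move=> y; exact: (is_deriveM (df y) (dh y)).
Qed.

Lemma trig_comp_snd f f' (p v : R * R) : (forall y : R, is_derive y 1 f (f' y)) ->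
  differentiable (fun p : R * R => f p.2) p /\ 'D_v (fun p : R * R => f p.2) p = v.2 * f' p.2.
Proof.
move=> df.
have snd_cont : continuous (snd : R * R -> R) by move=> q; exact: cvg_snd.
have dsnd : differentiable (snd : R * R -> R) p by exact: linear_differentiable.
have dfp : differentiable f p.2 by apply/derivable1_diffP; case: (df p.2).
have dF : differentiable (f \o snd) p by exact: differentiable_comp.
split => //; rewrite -[LHS]/('D_v (f \o snd) p) deriveE// diff_comp//= diff_lin//=.
rewrite -{1}[v.2]mulr1 -[_ * 1]/(_ *: (1 : R^o)) linearZ /= -deriveE//.
by have [_ ->] := df p.2.
Qed.

Lemma trig_smooth f : trig f -> smooth (fun p : R * R => f p.2).
Proof.
move=> tf vs p.
have [h th ->] : exists2 h, trig h &
    foldr (fun v h => 'D_v h) (fun p : R * R => f p.2) vs = (fun p => h p.2).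
  elim: vs => [|v vs [h th IH]]; first by exists f.
  have [h' th' dh] := trig_derivative th.
  exists (fun y => v.2 * h' y); first by apply: trig_mul => //; exact: trig_cst.
  by rewrite /= IH; apply/funext => q; have [_ ->] := trig_comp_snd q v dh.
have [h' _ dh] := trig_derivative th.
by have [] := trig_comp_snd p 0 dh.
Qed.

End TrigonometricFunctions.

Section StripIntegral.
Context {R : realType}.
Local Notation mu := (@lebesgue_measure R).
Local Notation mu2 := (mu \x mu)%E.

Lemma strip_integral (A B c d : R) : 0 < A -> 0 < B -> 0 <= c -> c <= d -> d <= B ->
  mu2.-integrable (`[0, A] `*` `[0, B]) (EFin \o \1_(`[0, A] `*` `[c, d])) /\
  \int[mu2]_(p in `[0, A] `*` `[0, B]) (\1_(`[0, A] `*` `[c, d]) p) = A * (d - c).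
Proof.
move=> A0 B0 c0 cd dB.
have mc : measurable (`[0, A] `*` `[c, d] : set (_ * _)) by apply: measurableX; exact: measurable_itv.
split.
  apply: (@rect_bounded_integrable _ _ _ A0 B0 _ 1); first exact: measurable_indic.
  by move=> p _; rewrite indicE; case: (_ \in _); rewrite ?normr1 ?normr0.
rewrite /Rintegral integral_indic//; last exact: measurable_rect.
rewrite classical_sets.setIidl; last first.
  move=> p [h1 h2]; split => //; move: h2; apply: subset_itv; rewrite bnd_simp//.
by rewrite (congr1 fine (product_itvE true false true false (ltW A0) cd)) /= subr0.
Qed.

End StripIntegral.

(** * A family of nearly optimal metrics *)

Section CollapsingMetrics.
Context {R : realType}.
Variable beta : R.
Hypothesis beta0 : 0 < beta.
Local Notation mu := (@lebesgue_measure R).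
Local Notation mu2 := (mu \x mu)%E.

Let w : R := pi / (2 * beta).
Let b20 : 0 < 2 * beta. Proof. by rewrite mulr_gt0. Qed.
Let w0 : 0 < w. Proof. by rewrite divr_gt0// pi_gt0. Qed.
Let wE : w * (2 * beta) = pi. Proof. by rewrite /w divfK// gt_eqF. Qed.

Section Profile.
Variable N : nat.

(** The squared cosine is even, has period [2 beta] and equals 1 exactly at the multiples of
    [2 beta], the heights of the axes of the conjugates of [glide]. The glide reflections with axes
    at odd multiples of [beta] belong to another class, so the profile may be small there. *)
Definition profile (y : R) : R := 1 / 2 + (cos (w * y) ^+ 2) ^+ N.

Lemma trig_profile : trig w profile.
Proof.
have texp f n : trig w f -> trig w (fun y => f y ^+ n).
  move=> tf; elim: n => [|n IH]; first exact: (trig_cst w 1).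
  rewrite (_ : (fun y => _) = fun y => f y * f y ^+ n); first exact: trig_mul.
  by apply/funext => y; rewrite exprS.
apply: trig_add; first exact: trig_cst.
exact: (texp _ _ (texp _ _ (trig_cos w))).
Qed.

Lemma profile_ge y : 1 / 2 <= profile y.
Proof. by rewrite lerDl exprn_ge0// sqr_ge0. Qed.

Lemma profile_gt0 y : 0 < profile y.
Proof. by apply: lt_le_trans (profile_ge y). Qed.

Lemma profileN y : profile (- y) = profile y.
Proof. by rewrite /profile mulrN cosN. Qed.

Lemma profile_period y : profile (y + 2 * beta) = profile y.
Proof. by rewrite /profile mulrDr wE cosDpi sqrrN. Qed.

Lemma profile_lat y (m : int) : profile (y - 2 * beta * m%:~R) = profile y.
Proof.
have h : profile ((0, y) + lat beta 0 (- m)).2 = profile y.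
  apply: (@periodic_lat R beta R (fun p => profile p.2)) => p /=; first by rewrite addr0.
  exact: profile_period.
by rewrite -[in RHS]h /= intrN mulrN.
Qed.

Lemma profile_cont : continuous profile.
Proof.
have [f' _ df] := trig_derivative trig_profile.
move=> y; apply: differentiable_continuous; apply/derivable1_diffP.
by case: (df y).
Qed.

Lemma profile_near0 : exists2 r : R, 0 < r & forall y, `|y| <= r -> 1 <= profile y.
Proof.
have h0 : profile 0 = 3 / 2 by rewrite /profile mulr0 cos0 !expr1n; lra.
have /cvgrPdist_lt/(_ (1 / 2)) := @profile_cont 0.
rewrite divr_gt0// => /(_ isT) /nbhs_ballP[r /= r0 rP].
exists (r / 2); first by rewrite divr_gt0.
move=> y yr; have : `|profile 0 - profile y| < 1 / 2.
  apply: rP; rewrite -ball_normE /= sub0r normrN; apply: le_lt_trans yr _.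
  by rewrite ltr_pdivrMr// ltr_pMr// ltr1n.
by rewrite h0 ltr_norml => /andP[_]; lra.
Qed.

(** The angle [w * y] stays between [w * del] and [pi - w * del], where the absolute value of the
    cosine is at most [cos (w * del)]. *)
Lemma profile_le (del y : R) : 0 < del -> del < beta -> del <= y -> y <= 2 * beta - del ->
  profile y <= 1 / 2 + (cos (w * del) ^+ 2) ^+ N.
Proof.
move=> d0 db y1 y2; rewrite lerD2l; apply: lerXn2r; rewrite ?nnegrE ?sqr_ge0//.
have wd : 0 < w * del by rewrite mulr_gt0.
have wb : w * del < pi by rewrite -wE ltr_pM2l//; lra.
have wy1 : w * del <= w * y by rewrite ler_pM2l.
have wy2 : w * y <= pi - w * del by rewrite -wE -mulrBr ler_pM2l.
have c1 : cos (w * y) <= cos (w * del).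
  by rewrite leNgt ltr_cos ?in_itv/= -?leNgt//; apply/andP; split; lra.
have c2 : cos (pi - w * y) <= cos (w * del).
  by rewrite leNgt ltr_cos ?in_itv/= -?leNgt//; try (apply/andP; split); lra.
rewrite addrC cosDpi cosN in c2.
rewrite -real_normK ?num_real// -[leRHS]real_normK ?num_real//.
by apply: lerXn2r; rewrite ?nnegrE// (le_trans _ (ler_norm _))// ler_norml lerNl c2.
Qed.

Variable a : R.
Hypothesis a0 : 0 < a.

Let form (p u v : R * R) : R :=
  profile p.2 * profile p.2 * (u.1 * v.1) + a * a * (u.2 * v.2).

Definition collapsing_metric : riemannian_metric beta.
Proof.
apply: (@RiemannianMetric _ _ form); rewrite /form.
- move=> u v; apply: (trig_smooth (w := w)
    (f := fun y => profile y * profile y * (u.1 * v.1) + a * a * (u.2 * v.2))).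
  apply: trig_add; last exact: trig_cst.
  apply: trig_mul; last exact: trig_cst.
  by apply: trig_mul; exact: trig_profile.
- by move=> p v k u x /=; rewrite !scale_mul; ring.
- by move=> p u v; rewrite [u.1 * _]mulrC [u.2 * _]mulrC.
- move=> p [x y] xy /=; have h0 := profile_gt0 p.2.
  have X := sqr_ge0 (profile p.2 * x); have Y := sqr_ge0 (a * y).
  have -> : profile p.2 * profile p.2 * (x * x) + a * a * (y * y) = (profile p.2 * x) ^+ 2 + (a * y) ^+ 2.
    by ring.
  rewrite lt0r addr_ge0// andbT paddr_eq0// !sqrf_eq0 !mulf_eq0 (gt_eqF h0) (gt_eqF a0) /=.
  by apply: contra xy => /andP[/eqP-> /eqP->].
- by move=> p u v /=; rewrite profileN mulrNN.
- by move=> p u v /=; rewrite profile_period.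
Defined.

Local Notation K := (form_of collapsing_metric).

Lemma collapsing_nrm p v :
  nrm K p v = Num.sqrt ((profile p.2 * v.1) ^+ 2 + (a * v.2) ^+ 2).
Proof. by rewrite nrm_form_of /= /form; congr Num.sqrt; ring. Qed.

Lemma collapsing_nrm_fst p v : profile p.2 * `|v.1| <= nrm K p v.
Proof.
rewrite collapsing_nrm -[profile _ in leLHS](gtr0_norm (profile_gt0 _)) -normrM -sqrtr_sqr.
by rewrite ler_wsqrtr// lerDl sqr_ge0.
Qed.

Lemma collapsing_nrm_snd p v : `|a * v.2| <= nrm K p v.
Proof. by rewrite collapsing_nrm -sqrtr_sqr ler_wsqrtr// lerDr sqr_ge0. Qed.

Let scaled_snd (v : R * R) : R := a * v.2.

Let scaled_snd_cont : continuous scaled_snd.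
Proof. by move=> p; apply: cvgM; [exact: cvg_cst|exact: cvg_snd]. Qed.

Let scaled_snd_lin k p q : scaled_snd (k *: (p - q)) = k * (scaled_snd p - scaled_snd q).
Proof. by rewrite /scaled_snd /= scale_mul; ring. Qed.

Let fst_lin k (p q : R * R) : (k *: (p - q)).1 = k * (p.1 - q.1).
Proof. by []. Qed.

Let fst_cont : continuous (fst : R * R -> R). Proof. by move=> p; exact: cvg_fst. Qed.

(** Calibrated by the function [a y], which changes by [2 beta a] in absolute value along every
    curve of the class. *)
Lemma collapsing_l_v : 2 * beta * a <= l_v collapsing_metric.
Proof.
apply: least_length_ge; first exact: deck_vtrans.
  by move=> r u v; apply: pair_ext; rewrite /= ?scale_mul; ring.
move=> c cc; have e := vtrans_class_end beta0 cc; have [pc _ _] := cc.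
have := variation_le_length pc scaled_snd_cont scaled_snd_lin
  (fun t v _ _ => collapsing_nrm_snd (c t) v) (lexx 0) ler01 (lexx 1).
by rewrite -length_form_of /scaled_snd -mulrBr normrM e gtr0_norm// mulrC.
Qed.

(** Calibrated by [x / 2], since the profile is at least 1/2 everywhere; along the class [x]
    increases by [2 pi]. *)
Lemma collapsing_l_h : pi <= l_h collapsing_metric.
Proof.
apply: (@least_length_ge _ _ _ (glide \o glide)).
- by apply: deck_comp; exact: deck_glide.
- by move=> r u v; apply: pair_ext; rewrite /= ?scale_mul; ring.
move=> c cc; have e := glide2_class_end beta0 cc; have [pc _ _] := cc.
pose phi (v : R * R) := 1 / 2 * v.1.
have cphi : continuous phi by move=> p; apply: cvgM; [exact: cvg_cst|exact: cvg_fst].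
have lphi k p q : phi (k *: (p - q)) = k * (phi p - phi q) by rewrite /phi fst_lin; ring.
have bphi t v : 0 <= t -> t <= 1 -> `|phi v| <= nrm K (c t) v.
  move=> _ _; apply: le_trans (collapsing_nrm_fst _ _).
  by rewrite normrM ger0_norm ?divr_ge0// ler_wpM2r// profile_ge.
have := variation_le_length pc cphi lphi bphi (lexx 0) ler01 (lexx 1).
rewrite -length_form_of /phi e /= -mulrBr addrAC subrr add0r mulrA => h.
apply: le_trans h; apply: le_trans (ler_norm _); lra.
Qed.

Variable r : R.
Hypothesis r_profile : forall y, `|y| <= r -> 1 <= profile y.
Hypothesis ar : a * (2 * r) = pi.

(* A curve leaving the strip around the axis of a glide reflection is long,  *)
(* since its end points are symmetric with respect to that axis.             *)
Lemma collapsing_l_sigma : pi <= l_sigma collapsing_metric.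
Proof.
apply: least_length_ge; first exact: deck_glide.
  by move=> r' u v; apply: pair_ext; rewrite /= ?scale_mul; ring.
move=> c cc; have [e1 [y0 [e2 [m y0E]]]] := glide_class_end beta0 cc; have [pc _ _] := cc.
rewrite length_form_of.
have [[s [s0 s1 sr]]|nos] := pselect (exists s : R, [/\ 0 <= s, s <= 1 & r < `|(c s).2 - y0|]).
  have v1 := variation_le_length pc scaled_snd_cont scaled_snd_lin
    (fun t v _ _ => collapsing_nrm_snd (c t) v) (lexx 0) s0 s1.
  have v2 := variation_le_length pc scaled_snd_cont scaled_snd_lin
    (fun t v _ _ => collapsing_nrm_snd (c t) v) s0 s1 (lexx 1).
  rewrite (Rintegral_cut s0 s1 (speed_integrable K pc)).
  apply: le_trans (lerD v1 v2); rewrite addrC; apply: le_trans (ler_normB _ _).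
  have -> : scaled_snd (c 1) - scaled_snd (c s) - (scaled_snd (c s) - scaled_snd (c 0)) =
      - (a * (2 * ((c s).2 - y0))).
    have e3 : (c 1).2 = y0 - ((c 0).2 - y0) by move: e2; lra.
    by rewrite /scaled_snd e3; ring.
  rewrite normrN -ar normrM gtr0_norm// ler_pM2l// normrM ger0_norm// ler_pM2l//.
  exact: ltW.
have near t : 0 <= t -> t <= 1 -> `|(c t).2 - y0| <= r.
  by move=> t0 t1; rewrite leNgt; apply/negP => h; apply: nos; exists t.
have bphi t v : 0 <= t -> t <= 1 -> `|v.1| <= nrm K (c t) v.
  move=> t0 t1; apply: le_trans (collapsing_nrm_fst _ _).
  by rewrite ler_peMl// -(profile_lat _ m) -y0E r_profile// near.
have := variation_le_length pc fst_cont fst_lin bphi (lexx 0) ler01 (lexx 1).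
by rewrite e1 ger0_norm// pi_ge0.
Qed.

(** In the two strips of height [del] along the sides [y = 0] and [y = 2 beta] the profile is at
    most 3/2; between them [profile_le] bounds it by 1/2 plus a term that tends to 0 as [N]
    grows. *)
Lemma collapsing_volume (del : R) : 0 < del -> del < beta ->
  volume collapsing_metric <=
  a * pi * (beta + 2 * del + 2 * beta * (cos (w * del) ^+ 2) ^+ N).
Proof.
move=> d0 db; set q := _ ^+ N; rewrite volume_form_of.
have q0 : 0 <= q by rewrite exprn_ge0// sqr_ge0.
have p0 := pi_gt0 R.
have dE p : area_density K p = a * profile p.2.
  rewrite /area_density /= /form /= !(mul0r, mulr0, mulr1, addr0, add0r) expr0n subr0.
  have -> : profile p.2 * profile p.2 * (a * a) = (a * profile p.2) ^+ 2 by ring.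
  by rewrite sqrtr_sqr gtr0_norm// mulr_gt0// profile_gt0.
have db2 : del <= 2 * beta by lra.
have db3 : 0 <= 2 * beta - del by lra.
have [i1 e1] := strip_integral p0 b20 (lexx 0) (ltW d0) db2.
have [i2 e2] := strip_integral p0 b20 db3 (ltac:(lra) : 2 * beta - del <= 2 * beta) (lexx _).
set S1 := (X in \1_X) in i1 e1; set S2 := (X in \1_X) in i2 e2.
have ic : mu2.-integrable (`[0, pi] `*` `[0, 2 * beta]) (EFin \o (fun=> 1 / 2 + q)).
  by apply: rect_integrable => // p; exact: cvg_cst.
have mr := @measurable_rect R pi (2 * beta).
have i12 : mu2.-integrable (`[0, pi] `*` `[0, 2 * beta]) (EFin \o (fun p => \1_S1 p + \1_S2 p)).
  exact: (integrableD mr i1 i2).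
have i3 : mu2.-integrable (`[0, pi] `*` `[0, 2 * beta])
    (EFin \o (fun p => 1 / 2 + q + (\1_S1 p + \1_S2 p))).
  exact: (integrableD mr ic i12).
have E : \int[mu2]_(p in `[0, pi] `*` `[0, 2 * beta]) (a * (1 / 2 + q + (\1_S1 p + \1_S2 p))) =
    a * pi * (beta + 2 * del + 2 * beta * q).
  rewrite RintegralZl// (RintegralD mr ic i12) (RintegralD mr i1 i2) e1 e2.
  rewrite Rintegral_cst//.
  rewrite (congr1 fine (product_itvE true false true false (ltW p0) (ltW b20))) /=.
  by field.
rewrite -E; apply: le_Rintegral => //.
- by apply: rect_integrable => //; exact: area_density_cont.
- exact: (integrableZl mr a i3).
move=> p [p1 p2] /=; rewrite dE ler_pM2l//.
have ind (S : set (R * R)) : 0 <= \1_S p :> R by rewrite indicE.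
have q1 : profile p.2 <= 1 / 2 + 1.
  rewrite lerD2l exprn_ile1 ?sqr_ge0// -real_normK ?num_real// exprn_ile1// cos_max//.
move: p1 p2; rewrite /= !in_itv /= => p1 /andP[p2 p2'].
have [y1|/ltW y1] := leP p.2 del.
  have -> : \1_S1 p = 1 :> R by rewrite indicE mem_set//; split; rewrite /= in_itv /= ?p2.
  by have := ind S2; lra.
have [y2|/ltW y2] := leP (2 * beta - del) p.2.
  have -> : \1_S2 p = 1 :> R by rewrite indicE mem_set//; split; rewrite /= in_itv /= ?y2.
  by have := ind S1; lra.
have := profile_le d0 db y1 y2; rewrite -/q; have := ind S1; have := ind S2; lra.
Qed.

End Profile.

Theorem optimal_constant (C : R) :
  (forall g : riemannian_metric beta, L_sigma g * l_v g <= C * volume g) -> 2 <= C.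
Proof.
move=> HC; rewrite leNgt; apply/negP => C2.
have p0 := pi_gt0 R.
(* With [C < 2], the inequality would give [2 beta <= C (beta + 2 del + 2 beta q)]. Choosing
   [del <= t / 16] and [q < t / (16 beta)] keeps [2 (2 del + 2 beta q)] below [t / 2], less than the
   gap [t = 2 beta - C beta]. *)
pose t := (2 - C) * beta.
have t0 : 0 < t by rewrite mulr_gt0// subr_gt0.
pose del := Num.min (beta / 2) (t / 16).
have d0 : 0 < del by rewrite lt_min !divr_gt0.
have db : del < beta by rewrite gt_min ltr_pdivrMr// ltr_pMr// ltr1n.
have dt : del <= t / 16 by rewrite ge_min lexx orbT.
have wd : 0 < w * del by rewrite mulr_gt0.
have wb : w * del < pi by rewrite -wE ltr_pM2l//; lra.
have c1 : cos (w * del) < 1.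
  by rewrite -cos0 ltr_cos ?in_itv/= ?lexx ?ltW.
have c2 : - 1 < cos (w * del).
  by rewrite -cospi ltr_cos ?in_itv/= ?lexx ?ltW.
have q1 : `|cos (w * del) ^+ 2| < 1.
  by rewrite normrX expr_lt1// ltr_norml c2.
have tb : 0 < t / (16 * beta) by rewrite divr_gt0// mulr_gt0.
have /cvgrPdist_lt/(_ _ tb)[N _ NP] := cvg_expr q1.
have {NP} := NP N (leqnn N); rewrite /= sub0r normrN ger0_norm; last by apply: exprn_ge0; exact: sqr_ge0.
move=> qN.
have [r r0 rP] := profile_near0 N.
(* As [r] depends on [N], the scale [a] comes last; it makes an excursion out of the strip of
   half-width [r] around an axis cost [2 r a = pi]. *)
pose a := pi / (2 * r).
have a0 : 0 < a by rewrite divr_gt0// mulr_gt0.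
have ar : a * (2 * r) = pi by rewrite /a divfK// gt_eqF// mulr_gt0.
have h1 : pi <= L_sigma (collapsing_metric N a0).
  by rewrite le_min (collapsing_l_sigma a0 rP ar) collapsing_l_h.
have h2 := collapsing_l_v N a0.
have h3 := collapsing_volume N a0 d0 db.
have h4 := HC (collapsing_metric N a0).
have ba : 0 < 2 * beta * a by rewrite mulr_gt0.
have h5 : pi * (2 * beta * a) <= L_sigma (collapsing_metric N a0) * l_v (collapsing_metric N a0).
  exact: ler_pM (ltW p0) (ltW ba) h1 h2.
have h6 : 0 < pi * (2 * beta * a) by rewrite mulr_gt0.
have v0 : 0 <= volume (collapsing_metric N a0).
  by rewrite volume_form_of; apply: Rintegral_ge0 => p _; exact: ltW (area_density_gt0 _ p).
set q := (_ ^+ N) in qN h3.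
have q0 : 0 <= q by apply: exprn_ge0; exact: sqr_ge0.
have [Cn|Cp] := leP C 0.
  by have := mulr_le0_ge0 Cn v0; lra.
have h7 := ler_wpM2l (ltW Cp) h3.
have ap : 0 < a * pi by rewrite mulr_gt0.
have h8 : 2 * beta <= C * (beta + 2 * del + 2 * beta * q).
  rewrite -(ler_pM2l ap); have := le_trans (le_trans h5 h4) h7; clear; nra.
have qt : 4 * beta * q <= t / 4.
  move: qN; rewrite ltr_pdivlMr ?mulr_gt0//; lra.
have dq : 0 <= 2 * del + 2 * beta * q by rewrite addr_ge0// mulr_ge0// ltW.
have h9 : C * (2 * del + 2 * beta * q) <= 2 * (2 * del + 2 * beta * q).
  by rewrite ler_wpM2r// ltW.
by move: h8 h9 qt dt t0; rewrite /t; clear; lra.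
Qed.

End CollapsingMetrics.

Theorem corollary1p4 (R : realType) (beta : R) (beta_gt0 : 0 < beta) :
  [/\ forall g : riemannian_metric beta,
        L_sigma g * l_v g <= 2 * volume g,
      forall C : R,
        (forall g : riemannian_metric beta, L_sigma g * l_v g <= C * volume g) ->
        2 <= C &
      forall g : riemannian_metric beta, L_sigma g * l_v g <> 2 * volume g].
Proof.
split.
- by move=> g; exact: ltW (strict_isosystolic beta_gt0 g).
- exact: optimal_constant.
- by move=> g E; have := strict_isosystolic beta_gt0 g; rewrite E ltxx.
Qed.
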